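(* Let $(M^4,g)$ be an oriented hypersurface isometrically immersed in a locally conformally flat manifold $(N^5,g_N)$. (1) For $p\in M$ let $m$ be the number of distinct principal curvatures at $p$ and $w$ the number of distinct eigenvalues of $\mathcal{W}^+$ at $p$. Then, at $p$: - $w=3$ if and only if $m=4$; - $w=2$ if and only if either $m=3$, or there are exactly two distinct principal curvatures, both with multiplicity two (in this case $m=2$); - $w=1$ if and only if at least three principal curvatures are equal (and hence $m\le 2$). In this case $\operatorname{W}^+=0$ at $p$. (2) Suppose that $(N^5,g_N)$ is a space form with constant sectional curvature $c$. If the scalar curvature $R$ and the mean curvature $H$ of $(M^4,g)$ are constant, then $(M^4,g)$ is isoparametric if and only if the eigenvalues of $\mathcal{W}^+$ are constant functions on $M$. The same results hold with $\mathcal{W}^-$ (and $\operatorname{W}^-$) in place of $\mathcal{W}^+$ (and $\operatorname{W}^+$).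
   Context: $M$ is connected. There is an immersion $\iota:M^4\to N^5$ with $g=\iota^*g_N$. $(N^5,g_N)$ is locally conformally flat if every point has an open neighborhood $U$ and $u\in C^\infty(U)$ with $e^{2u}g_N$ flat on $U$. A space form is a connected orientable Riemannian manifold with constant sectional curvature $c$, normalized so that $c\in\{-1,0,1\}$. $A$ is the second fundamental form of the immersion (with respect to a local unit normal); its eigenvalues with respect to $g$ are the principal curvatures, and $H=\operatorname{tr}_g A$ is the mean curvature. The hypersurface is isoparametric if its principal curvatures are constant functions on $M$. $\operatorname{W}$ is the Weyl tensor of $g$, $\mu_{ijkl}$ the Levi-Civita symbol (volume form in an oriented orthonormal frame), and $W^{\pm}_{ijkl}=\frac12\left(W_{ijkl}\pm\frac12\mu_{ijpq}W_{pqkl}\right)$. $\Lambda_\pm$ is the rank-three bundle of $2$-forms $\omega$ with $\star\omega=\pm\omega$. $\mathcal{W}^{\pm}:\Lambda_\pm\to\Lambda_\pm$ is the symmetric, trace-free endomorphism sending $\omega=\frac12\omega_{ij}\theta^i\wedge\theta^j$ to $\frac14W^\pm_{ijkl}\omega_{kl}\theta^i\wedge\theta^j$; it has three real eigenvalues (with multiplicity) at each point. *)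

(* Defs.v *)
From HB Require Import structures.
From mathcomp Require Import all_boot all_order all_algebra.
From mathcomp Require Import all_classical all_reals all_analysis.

Set Implicit Arguments.
Unset Strict Implicit.
Unset Printing Implicit Defensive.

Import Order.TTheory GRing.Theory Num.Theory.
Import numFieldNormedType.Exports.

Local Open Scope classical_set_scope.
Local Open Scope ring_scope.

(* C^k: [f] is C^(k+1) when it is differentiable and all its directional
   derivatives are C^k; only used on open sets. *)
Fixpoint Ck {R : realType} {V W : normedModType R} (k : nat) (D : set V)
    (f : V -> W) : Prop :=
  if k is k'.+1 then
    (forall x, D x -> differentiable f x) /\ (forall v, Ck k' D ('D_v f))
  else forall x, D x -> {for x, continuous f}.

Definition smooth_on {R : realType} {V W : normedModType R} (D : set V)
  (f : V -> W) : Prop := forall k, Ck k D f.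

Definition partial {R : realType} {n : nat} {W : normedModType R} (i : 'I_n)
  (f : 'rV[R]_n -> W) : 'rV[R]_n -> W := 'D_(delta_mx 0 i) f.

(* A chart is a homeomorphism [fwd : dom -> fwd @` dom] with inverse [bwd];
   the values of [fwd] and [bwd] outside these sets are irrelevant. *)
Record chart (R : realType) (n : nat) (T : topologicalType) := Chart {
  dom : set T;
  fwd : T -> 'rV[R]_n;
  bwd : 'rV[R]_n -> T;
  dom_open : open dom;
  img_open : open (fwd @` dom);
  fwdK : forall p, dom p -> bwd (fwd p) = p;
  fwd_cont : forall p, dom p -> {for p, continuous fwd};
  bwd_cont : forall p, dom p -> {for fwd p, continuous bwd} }.

Definition transition (R : realType) (n : nat) (T : topologicalType)
  (c d : chart R n T) : 'rV[R]_n -> 'rV[R]_n := fwd d \o bwd c.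

(* [chart_at] is a choice of a chart of the atlas around each point. *)
Record manifold (R : realType) (n : nat) := Manifold {
  carrier :> topologicalType;
  hausdorff_carrier : hausdorff_space carrier;
  second_countable_carrier : @second_countable carrier;
  atlas : set (chart R n carrier);
  chart_at : carrier -> chart R n carrier;
  chart_at_atlas : forall p, atlas (chart_at p);
  chart_at_dom : forall p, dom (chart_at p) p;
  transition_smooth : forall c d, atlas c -> atlas d ->
    smooth_on (fwd c @` (dom c `&` dom d)) (transition c d) }.

(* The sign of each chart (true: positive) at each point of its domain. *)
Record orientation (R : realType) (n : nat) (M : manifold R n) := Orientation {
  osign :> chart R n M -> M -> bool;
  osign_locally_constant : forall c p, atlas c -> dom c p ->
    \forall q \near p, osign c q = osign c p;
  osign_compat : forall c d p, atlas c -> atlas d -> dom c p -> dom d p ->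
    (0 < \det ('J (transition c d) (fwd c p))) = (osign c p == osign d p) }.

Definition orientable (R : realType) (n : nat) (M : manifold R n) : Prop :=
  inhabited (orientation M).

(* Tangent vectors at a point are row vectors of components in a chart; since
   differentials act on row vectors by ['d f x v = v *m 'J f x], the entry
   [('J f x) i j] is the i-th partial derivative of the j-th component. *)
Record metric (R : realType) (n : nat) (M : manifold R n) := Metric {
  gcoef :> chart R n M -> 'rV[R]_n -> 'M[R]_n;
  gcoef_smooth : forall c, atlas c -> smooth_on (fwd c @` dom c) (gcoef c);
  gcoef_sym : forall c p, atlas c -> dom c p ->
    (gcoef c (fwd c p))^T = gcoef c (fwd c p);
  gcoef_pos : forall c p (v : 'rV[R]_n), atlas c -> dom c p -> v != 0 ->
    0 < (v *m gcoef c (fwd c p) *m v^T) 0 0;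
  gcoef_compat : forall c d p, atlas c -> atlas d -> dom c p -> dom d p ->
    gcoef c (fwd c p) = 'J (transition c d) (fwd c p) *m gcoef d (fwd d p)
                          *m ('J (transition c d) (fwd c p))^T }.

Section Curvature.
Context {R : realType} {n : nat} (G : 'rV[R]_n -> 'M[R]_n).

Definition ginv (x : 'rV[R]_n) : 'M[R]_n := invmx (G x).

Definition christoffel (k i j : 'I_n) (x : 'rV[R]_n) : R :=
  2^-1 * \sum_l ginv x k l *
    (partial i (fun y => G y j l) x + partial j (fun y => G y i l) x
     - partial l (fun y => G y i j) x).

(* Component m of R(e_i, e_j) e_l, where
   R(X, Y) Z = D_X D_Y Z - D_Y D_X Z - D_[X, Y] Z. *)
Definition curvature_op (i j l m : 'I_n) (x : 'rV[R]_n) : R :=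
  partial i (christoffel m j l) x - partial j (christoffel m i l) x
  + \sum_p (christoffel m i p x * christoffel p j l x
            - christoffel m j p x * christoffel p i l x).

(* R_ijkl = g(R(e_i, e_j) e_l, e_k), so that R_ijij > 0 on round spheres. *)
Definition riem (i j k l : 'I_n) (x : 'rV[R]_n) : R :=
  \sum_m G x k m * curvature_op i j l m x.

Definition ricci (i k : 'I_n) (x : 'rV[R]_n) : R :=
  \sum_j \sum_l ginv x j l * riem i j k l x.

Definition scalar (x : 'rV[R]_n) : R :=
  \sum_i \sum_k ginv x i k * ricci i k x.

Definition weyl (i j k l : 'I_n) (x : 'rV[R]_n) : R :=
  riem i j k l x
  - (n%:R - 2)^-1 * (ricci i k x * G x j l - ricci i l x * G x j k
                     + ricci j l x * G x i k - ricci j k x * G x i l)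
  + scalar x / ((n%:R - 1) * (n%:R - 2))
      * (G x i k * G x j l - G x i l * G x j k).

Definition inner (x u v : 'rV[R]_n) : R := (u *m G x *m v^T) 0 0.

Definition sectional (x u v : 'rV[R]_n) : R :=
  (\sum_i \sum_j \sum_k \sum_l
     riem i j k l x * u 0 i * v 0 j * u 0 k * v 0 l)
  / (inner x u u * inner x v v - inner x u v ^+ 2).

End Curvature.

Definition locally_conformally_flat (R : realType) (n : nat)
    (N : manifold R n) (g : metric N) : Prop :=
  forall q : N, exists (U : set N) (u : N -> R),
    [/\ open U, U q,
        forall d, atlas d ->
          smooth_on (fwd d @` (dom d `&` U)) (u \o bwd d) &
        forall d, atlas d -> forall x, (fwd d @` (dom d `&` U)) x ->
          forall i j k l,
            riem (fun y => expR (2 * u (bwd d y)) *: g d y) i j k l x = 0].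

Definition constant_sectional_curvature (R : realType) (n : nat)
    (N : manifold R n) (g : metric N) (c : R) : Prop :=
  forall d q, atlas d -> dom d q -> forall u v : 'rV[R]_n,
    row_free (col_mx u v) -> sectional (g d) (fwd d q) u v = c.

Definition space_form (R : realType) (n : nat) (N : manifold R n)
    (g : metric N) (c : R) : Prop :=
  [/\ connected [set: N], orientable N, [\/ c = -1, c = 0 | c = 1] &
      constant_sectional_curvature g c].

Definition scalar_at (R : realType) (n : nat) (M : manifold R n)
  (g : metric M) (p : M) : R := scalar (g (chart_at p)) (fwd (chart_at p) p).

Definition constant_fun {T U : Type} (f : T -> U) : Prop :=
  exists a, forall p, f p = a.

(* [mult p a] is the multiplicity of [a] as an eigenvalue at [p], 0 if [a] is
   not an eigenvalue; the k eigenvalues are constant functions of [p]. *)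
Definition constant_eigenvalues {R : realType} {T : Type} (k : nat)
    (mult : T -> R -> nat) : Prop :=
  exists s : k.-tuple R, forall p a, mult p a = count_mem a s.

Definition distinct_eigenvalues {R : realType} (mult : R -> nat) (k : nat) :
  Prop := ([set a | (0 < mult a)%N] #= `I_k)%card.

(* 2-forms at a point of an oriented 4-manifold are identified with the
   antisymmetric matrices of their components omega_ij in a chart, [g] being
   the matrix of the metric and [o] the sign of the chart at this point. *)
Section TwoForms.
Context {R : realType} (g : 'M[R]_4).

(* The 2-form with components (1/2) T_ijkl omega^kl. *)
Definition form_act (T : 'I_4 -> 'I_4 -> 'I_4 -> 'I_4 -> R)
    (omega : 'M[R]_4) : 'M[R]_4 :=
  \matrix_(i, j) (2^-1 * \sum_k \sum_l
     T i j k l * (invmx g *m omega *m (invmx g)^T) k l).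

Lemma form_act_is_linear T : linear (form_act T).
Proof.
move=> a u v; apply/matrixP => i j; rewrite !mxE mulrCA -mulrDr; congr (_ * _).
rewrite mulr_sumr -big_split; apply: eq_bigr => k _ /=.
rewrite mulr_sumr -big_split; apply: eq_bigr => l _ /=.
by rewrite mulmxDr mulmxDl -scalemxAr -scalemxAl mulrCA -mulrDr [in LHS]mxE
  [X in _ * (X + _)]mxE.
Qed.

HB.instance Definition _ T := GRing.isLinear.Build R 'M[R]_4 'M[R]_4 *:%R
  (form_act T) (form_act_is_linear T).

(* mu_ijkl = +/- sqrt(det g) epsilon_ijkl *)
Definition volume_form (o : bool) (i j k l : 'I_4) : R :=
  (-1) ^+ (~~ o) * Num.sqrt (\det g) *
  \det (\matrix_(a < 4, b < 4) (tnth [tuple i; j; k; l] a == b)%:R : 'M[R]_4).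

Definition hodge (o : bool) : 'M[R]_4 -> 'M[R]_4 := form_act (volume_form o).

(* Lambda_+ for [b = false], Lambda_- for [b = true]. *)
Definition Lambda (o b : bool) : {vspace 'M[R]_4} :=
  (passmx.leigenspace (linfun (trmx : 'M[R]_4 -> 'M[R]_4)) (-1)
   :&: passmx.leigenspace (linfun (form_act (volume_form o))) ((-1) ^+ b))%VS.

End TwoForms.

Section WeylPM.
Context {R : realType} (M : manifold R 4) (g : metric M) (o : orientation M).

Definition metric_at (p : M) : 'M[R]_4 := g (chart_at p) (fwd (chart_at p) p).
Definition weyl_at (p : M) (i j k l : 'I_4) : R :=
  weyl (g (chart_at p)) i j k l (fwd (chart_at p) p).
Definition osign_at (p : M) : bool := o (chart_at p) p.

(* W^+_ijkl for [b = false], W^-_ijkl for [b = true]. *)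
Definition weyl_pm (b : bool) (p : M) (i j k l : 'I_4) : R :=
  2^-1 * (weyl_at p i j k l
    + (-1) ^+ b * hodge (metric_at p) (osign_at p)
                    (\matrix_(r, s) weyl_at p r s k l) i j).

(* Multiplicity of [a] as an eigenvalue of the endomorphism
   omega |-> (1/2) W^+/-_ijkl omega^kl of Lambda_+/-. As this endomorphism is
   symmetric, the dimension of the eigenspace is the multiplicity. *)
Definition weyl_mult (b : bool) (p : M) (a : R) : nat :=
  \dim (Lambda (metric_at p) (osign_at p) b
        :&: passmx.leigenspace (linfun (form_act (metric_at p) (weyl_pm b p))) a)%VS.

End WeylPM.

Section Immersion.
Context {R : realType} {m n : nat} {M : manifold R m} {N : manifold R n}.
Implicit Types (c : chart R m M) (d : chart R n N).

Definition overlap (f : M -> N) c d : set M := dom c `&` f @^-1` dom d.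

Definition local_expr (f : M -> N) c d : 'rV[R]_m -> 'rV[R]_n :=
  fwd d \o f \o bwd c.

Definition jac_at (f : M -> N) c d (p : M) : 'M[R]_(m, n) :=
  'J (local_expr f c d) (fwd c p).

Definition smooth_map (f : M -> N) : Prop :=
  continuous f /\
  forall c d, atlas c -> atlas d ->
    smooth_on (fwd c @` overlap f c d) (local_expr f c d).

Definition immersion (f : M -> N) : Prop :=
  smooth_map f /\
  forall c d p, atlas c -> atlas d -> overlap f c d p ->
    row_free (jac_at f c d p).

Definition isometric_immersion (g : metric M) (gN : metric N) (f : M -> N) :
    Prop :=
  immersion f /\
  forall c d p, atlas c -> atlas d -> overlap f c d p ->
    g c (fwd c p)
    = jac_at f c d p *m gN d (fwd d (f p)) *m (jac_at f c d p)^T.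

(* [nu] is the vector of components in the chart [d] of a unit vector at [f p]
   orthogonal to the image of the differential of [f] at [p]. *)
Definition unit_normal (gN : metric N) (f : M -> N) d (p : M) (nu : 'rV[R]_n) :
    Prop :=
  jac_at f (chart_at p) d p *m gN d (fwd d (f p)) *m nu^T = 0 /\
  inner (gN d) (fwd d (f p)) nu nu = 1.

Record unit_normal_field (gN : metric N) (f : M -> N) := UnitNormalField {
  nfield :> chart R n N -> M -> 'rV[R]_n;
  nfield_unit_normal : forall d p, atlas d -> dom d (f p) ->
    unit_normal gN f d p (nfield d p);
  nfield_smooth : forall c d, atlas c -> atlas d ->
    smooth_on (fwd c @` overlap f c d) (nfield d \o bwd c);
  nfield_compat : forall d d' p, atlas d -> atlas d' ->
    dom d (f p) -> dom d' (f p) ->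
    nfield d' p = nfield d p *m 'J (transition d d') (fwd d (f p)) }.

(* A_ij = gN(D_i (d_j F), nu), F being the expression of [f] in charts and D
   the covariant derivative along F of the Levi-Civita connection of gN. *)
Definition sff (gN : metric N) (f : M -> N) c d (p : M) (nu : 'rV[R]_n) :
    'M[R]_m :=
  let F := local_expr f c d in
  let x := fwd c p in
  \matrix_(i, j) inner (gN d) (F x)
    (\row_a (partial i (partial j (fun y => F y 0 a)) x
             + \sum_r \sum_s christoffel (gN d) a r s (F x)
                 * partial i (fun y => F y 0 r) x
                 * partial j (fun y => F y 0 s) x))
    nu.

(* The matrix of A with one index raised by g; its eigenvalues are those of A
   with respect to g. *)
Definition shape (g : metric M) (gN : metric N) (f : M -> N) (p : M)
    (nu : 'rV[R]_n) : 'M[R]_m :=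
  sff gN f (chart_at p) (chart_at (f p)) p nu
  *m invmx (g (chart_at p) (fwd (chart_at p) p)).

(* Multiplicity of [a] as a principal curvature at [p] (A is symmetric with
   respect to g, so this is the dimension of the eigenspace). *)
Definition principal_mult (g : metric M) (gN : metric N) (f : M -> N) (p : M)
  (nu : 'rV[R]_n) (a : R) : nat := \rank (eigenspace (shape g gN f p nu) a).

Definition mean_curvature (g : metric M) (gN : metric N) (f : M -> N)
    (nu : unit_normal_field gN f) (p : M) : R :=
  \tr (shape g gN f p (nu (chart_at (f p)) p)).

(* When M and N are orientable, a unit normal field exists on all of M; when M
   is connected, it is unique up to sign, so that the choice is immaterial in
   the next two definitions. *)
Definition constant_mean_curvature (g : metric M) (gN : metric N)
    (f : M -> N) : Prop :=
  exists nu : unit_normal_field gN f, constant_fun (mean_curvature g nu).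

Definition isoparametric (g : metric M) (gN : metric N) (f : M -> N) : Prop :=
  exists nu : unit_normal_field gN f,
    constant_eigenvalues m
      (fun p => principal_mult g gN f p (nu (chart_at (f p)) p)).

End Immersion.

(* Main.v *)
Require Import Defs.
From mathcomp Require Import all_boot all_order all_algebra.
From mathcomp Require Import perm finmap complex.
From mathcomp Require Import all_classical all_reals all_analysis.
From mathcomp Require Import ring lra.

Set Implicit Arguments.
Unset Strict Implicit.
Unset Printing Implicit Defensive.

Import Order.TTheory GRing.Theory Num.Theory.
Import numFieldNormedType.Exports.

Local Open Scope classical_set_scope.
Local Open Scope ring_scope.

(* Write the conformally flat ambient curvature as a Kulkarni-Nomizu product
   P o g_N.  By the Gauss equation the curvature of M is T o g + (1/2) A o A, T
   being the restriction of P, and T does not contribute to the Weyl tensor. In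
   an orthonormal frame diagonalizing A, with principal curvatures x0, ..., x3,
   the two-form e_i e_j is then multiplied by the same factor as the
   complementary one, so that W^+ and W^- have the same three eigenvalues
   a_r / 2 - e_2 / 6, where a_0 = x0 x1 + x2 x3, a_1 = x0 x2 + x1 x3,
   a_2 = x0 x3 + x1 x2 and e_k is the k-th elementary symmetric function of the
   x_i.  Part (1) follows from a_1 - a_2 = (x0 - x1) (x2 - x3) and its
   conjugates.

   In part (2), H = e_1 and e_2 = (R - 12 c) / 2 are constant, and the a_r are
   the roots of the resolvent cubic, whose coefficients are e_2,
   e_1 e_3 - 4 e_4 and e_3^2 + e_1^2 e_4 - 4 e_2 e_4.  If these are constant,
   then e_3 is a root of a fixed quadratic polynomial; being continuous on the
   connected manifold M it is constant, and so are e_4 and the x_i. *)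

(** * Derivatives of matrix-valued maps *)

(** Curvature is defined through directional derivatives of Christoffel symbols, hence of the
    inverse metric. To keep derivatives of inverses out of the calculations, every curvature
    identity is first put in terms of the 2-jet of the metric at one point ([riem_form]), where the
    behaviour under immersions and conformal factors becomes a rational identity. Third derivatives
    of the immersion cancel there only because mixed derivatives commute, which has to be derived
    from [Ck]. Part (2) hides a difficulty. The quadratic equation for e_3 leaves two candidate
    values at each point, and continuity must select one; but [shape] is computed in [chart_at p],
    which may jump from point to point, so that its entries need not be continuous. The trace of its
    cube is continuous, being invariant under the conjugations induced by chart changes, and with
    e_1 and e_2 constant it determines e_3. The frame diagonalizing A may have either orientation.
    This sign only decides which family of forms [sdbasis] spans Lambda_+; both families carry the
    same eigenvalues, so W^+ and W^- are treated at once. *)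

Section ClosedClass.
Context {R : realType} {T : Type} (P : (T -> R) -> Prop).
Hypotheses (Pcst : forall a, P (fun=> a))
  (PD : forall f g, P f -> P g -> P (fun t => f t + g t))
  (PM : forall f g, P f -> P g -> P (fun t => f t * g t)).

(** Determinants and cofactors are polynomials in the entries. The abstract class [P] is
    instantiated twice: with derivability at a point in a direction, and with continuity at a
    point. *)
Lemma closed_sum I (r : seq I) (Q : pred I) (F : I -> T -> R) :
  (forall i, P (F i)) -> P (fun t => \sum_(i <- r | Q i) F i t).
Proof.
move=> PF; elim: r => [|i r IH].
  by under eq_fun do rewrite big_nil; exact: Pcst.
under eq_fun do rewrite big_cons.
by case: (Q i) => //; apply: PD.
Qed.

Lemma closed_prod I (r : seq I) (Q : pred I) (F : I -> T -> R) :
  (forall i, P (F i)) -> P (fun t => \prod_(i <- r | Q i) F i t).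
Proof.
move=> PF; elim: r => [|i r IH].
  by under eq_fun do rewrite big_nil; exact: Pcst.
under eq_fun do rewrite big_cons.
by case: (Q i) => //; apply: PM.
Qed.

Lemma closed_det n (A : T -> 'M[R]_n) :
  (forall i j, P (fun t => A t i j)) -> P (fun t => \det (A t)).
Proof.
move=> PA; rewrite /determinant.
by apply: closed_sum => s; apply: PM => //; apply: closed_prod.
Qed.

Lemma closed_mulmx m n p (A : T -> 'M[R]_(m, n)) (B : T -> 'M[R]_(n, p)) :
  (forall i j, P (fun t => A t i j)) -> (forall i j, P (fun t => B t i j)) ->
  forall i j, P (fun t => (A t *m B t) i j).
Proof.
move=> PA PB i j; under eq_fun do rewrite mxE.
by apply: closed_sum => k; exact: PM.
Qed.

Lemma closed_adj n (A : T -> 'M[R]_n) :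
  (forall i j, P (fun t => A t i j)) ->
  forall i j, P (fun t => (\adj (A t)) i j).
Proof.
move=> PA i j; under eq_fun do rewrite mxE /cofactor.
apply: PM => //; apply: closed_det => a b.
by under eq_fun do rewrite !mxE.
Qed.

End ClosedClass.

Section Derivatives.
Context {R : realType} {V : normedModType R}.
Implicit Types (x v : V).

Lemma derivable_entry m n (A : V -> 'M[R]_(m, n)) x v i j :
  derivable A x v -> derivable (fun y => A y i j) x v.
Proof. by move=> /derivable_mxP. Qed.

Lemma derive_entry m n (A : V -> 'M[R]_(m, n)) x v i j :
  derivable A x v -> 'D_v (fun y => A y i j) x = ('D_v A x) i j.
Proof. by move=> dA; rewrite (derive_mx dA) mxE. Qed.

Lemma is_derive_entry m n (A : V -> 'M[R]_(m, n)) x v dA i j :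
  is_derive x v A dA -> is_derive x v (fun y => A y i j) (dA i j).
Proof.
move=> [ex <-]; apply: DeriveDef; first exact: derivable_entry.
exact: derive_entry.
Qed.

Lemma is_derive_mx m n (A : V -> 'M[R]_(m, n)) x v (dA : 'M[R]_(m, n)) :
  (forall i j, is_derive x v (fun y => A y i j) (dA i j)) -> is_derive x v A dA.
Proof.
move=> dAij; have dA' : derivable A x v.
  by apply/derivable_mxP => i j; exact: (@ex_derive _ _ _ _ _ _ _ (dAij i j)).
apply: DeriveDef => //; rewrite (derive_mx dA'); apply/matrixP => i j.
by rewrite mxE; exact: (@derive_val _ _ _ _ _ _ _ (dAij i j)).
Qed.

Lemma is_derive_bigsum (W : normedModType R) I (r : seq I) (F : I -> V -> W)
    x v (dF : I -> W) :
  (forall i, is_derive x v (F i) (dF i)) ->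
  is_derive x v (fun y => \sum_(i <- r) F i y) (\sum_(i <- r) dF i).
Proof.
move=> H; elim: r => [|i r IH].
  by under eq_fun do rewrite big_nil; rewrite big_nil; exact: is_derive_cst.
under eq_fun do rewrite big_cons; rewrite big_cons.
exact: is_deriveD.
Qed.

Lemma is_derive_mul (f g : V -> R) x v (df dg : R) :
  is_derive x v f df -> is_derive x v g dg ->
  is_derive x v (fun y => f y * g y) (df * g x + f x * dg).
Proof.
move=> hf hg; apply: is_derive_eq (is_deriveM hf hg) _.
by rewrite addrC; congr (_ + _); rewrite /GRing.scale /= mulrC.
Qed.

Lemma is_derive_mulmx m n p (A : V -> 'M[R]_(m, n)) (B : V -> 'M[R]_(n, p))
    x v dA dB :
  is_derive x v A dA -> is_derive x v B dB ->
  is_derive x v (fun y => A y *m B y) (dA *m B x + A x *m dB).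
Proof.
move=> hA hB; apply: is_derive_mx => i j.
under eq_fun do rewrite mxE; rewrite !mxE -big_split /=.
by apply: is_derive_bigsum => k; apply: is_derive_mul; exact: is_derive_entry.
Qed.

Lemma is_derive_trmx m n (A : V -> 'M[R]_(m, n)) x v dA :
  is_derive x v A dA -> is_derive x v (fun y => (A y)^T) dA^T.
Proof.
move=> hA; apply: is_derive_mx => i j; rewrite mxE.
by under eq_fun do rewrite mxE; exact: is_derive_entry.
Qed.

Lemma is_derive_scalemx m n (s : V -> R) (A : V -> 'M[R]_(m, n)) x v ds dA :
  is_derive x v s ds -> is_derive x v A dA ->
  is_derive x v (fun y => s y *: A y) (ds *: A x + s x *: dA).
Proof.
move=> hs hA; apply: is_derive_mx => i j; rewrite !mxE.
under eq_fun do rewrite mxE; apply: is_derive_mul => //.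
exact: is_derive_entry.
Qed.

Lemma derivable_invmx n (A : V -> 'M[R]_n) x v :
  (\forall y \near x, A y \in unitmx) -> derivable A x v ->
  derivable (fun y => invmx (A y)) x v.
Proof.
move=> uA dA; apply/derivable_mxP => i j.
(* [invmx] follows the adjugate formula only on invertible matrices and returns its argument
   elsewhere, so the two functions agree only near [x]. *)
have adjE : {near x, (fun y => (\det (A y))^-1 * (\adj (A y)) i j) =1
                     (fun y => invmx (A y) i j)}.
  by near do (rewrite /invmx ifT ?mxE //).
apply: near_eq_derivable adjE _.
have dAij a b : derivable (fun t => A t a b) x v by exact: derivable_entry.
pose P f := @derivable R V R f x v.
have Pc a : P (fun=> a) by exact: derivable_cst.
have PD f g : P f -> P g -> P (fun t => f t + g t) by exact: derivableD.
have PM f g : P f -> P g -> P (fun t => f t * g t) by exact: derivableM.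
apply: (PM); last exact: (closed_adj Pc PD PM).
apply: derivableV; last exact: (closed_det Pc PD PM).
by move: (nbhs_singleton uA); rewrite unitmxE unitfE.
Unshelve. all: by end_near. Qed.

End Derivatives.

Lemma is_derive_chain {R : realType} {V W U : normedModType R}
    (f : V -> W) (g : W -> U) x v :
  differentiable f x -> differentiable g (f x) ->
  is_derive x v (g \o f) ('D_('D_v f x) g (f x)).
Proof.
move=> df dg; have dgf : differentiable (g \o f) x by exact: differentiable_comp.
apply: DeriveDef; first exact: diff_derivable.
by rewrite deriveE // diff_comp // !deriveE.
Qed.

Lemma differentiable_entry {R : realType} {V : normedModType R} m n
    (A : V -> 'M[R]_(m, n)) x i j :
  differentiable A x -> differentiable (fun y => A y i j) x.
Proof.
move=> dA; apply: (@differentiable_comp _ _ _ _ A (fun N : 'M[R]_(m, n) => N i j)) => //.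
exact: differentiable_coord.
Qed.

Lemma derive_row {R : realType} {n : nat} {W : normedModType R}
    (f : 'rV[R]_n -> W) (x v : 'rV[R]_n) :
  differentiable f x -> 'D_v f x = \sum_i v 0 i *: partial i f x.
Proof.
move=> df; rewrite deriveE // {1}(row_sum_delta v) linear_sum.
by apply: eq_bigr => i _; rewrite linearZ /partial deriveE.
Qed.

(** * Symmetry of second derivatives *)

Lemma dist_half {R : realFieldType} (q a b X e : R) :
  `|X - q * a| <= q * (e / 2) -> `|X - q * b| <= q * (e / 2) ->
  `|q * (a - b)| <= q * e.
Proof. by rewrite !ler_norml => /andP[? ?] /andP[? ?]; apply/andP; split; lra. Qed.

Section Schwarz.
Context {R : realType} {V : normedModType R}.
Implicit Types (f : V -> R) (D : set V) (x v w : V).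

Lemma is_derive_line f (a b : V) (t : R) :
  differentiable f (a + t *: b) ->
  is_derive t 1 (fun s : R => f (a + s *: b)) ('D_b f (a + t *: b)).
Proof.
move=> df; pose l (s : R) : V := a + s *: b.
have [dl Dl] : is_diff t l ( *:%R^~ b).
  by apply: is_diff_eq (is_diffD _ _) _; rewrite add0r.
have := is_derive_chain (1 : R) dl df.
by rewrite (deriveE _ dl) Dl scale1r.
Qed.

Lemma MVT_line f (a b : V) :
  (forall t : R, 0 <= t <= 1 -> differentiable f (a + t *: b)) ->
  exists2 t : R, 0 <= t <= 1 & f (a + b) - f a = 'D_b f (a + t *: b).
Proof.
move=> df; have [||| t t01 E] :=
  @MVT R (fun s => f (a + s *: b)) (fun t => 'D_b f (a + t *: b)) 0 1.
- exact: ltr01.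
- move=> t; rewrite in_itv /= => /andP[t0 t1]; apply: is_derive_line.
  by apply: df; rewrite !ltW.
- apply: continuous_in_subspaceT => t; rewrite inE /= in_itv /= => t01.
  apply: differentiable_continuous; apply/derivable1_diffP.
  by have [] := is_derive_line (df t t01).
- exists t; first by move: t01; rewrite in_itv /= => /andP[/ltW -> /ltW].
  by move: E; rewrite scale1r scale0r addr0 subr0 mulr1.
Qed.

Lemma deriveZv f x v (h : R) : differentiable f x ->
  'D_(h *: v) f x = h * 'D_v f x.
Proof. by move=> df; rewrite !deriveE // linearZ. Qed.

(** The mean value theorem is applied twice: to [y |-> f (y + h *: w) - f y] along [h *: v], then to
    [fv] along [h *: w]. The second difference is thus [h ^+ 2] times a value of [fvw] close to
    [x]. *)
Lemma second_difference f fv fvw D x v w (e : R) : open D -> D x ->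
  (forall y, D y -> differentiable f y) ->
  (forall y, D y -> 'D_v f y = fv y) ->
  (forall y, D y -> differentiable fv y) ->
  (forall y, D y -> 'D_w fv y = fvw y) ->
  {for x, continuous fvw} -> 0 < e ->
  exists2 r : R, 0 < r & forall h, 0 < h < r ->
    `| f (x + h *: v + h *: w) - f (x + h *: v) - f (x + h *: w) + f x
       - h ^+ 2 * fvw x | <= h ^+ 2 * e.
Proof.
move=> oD Dx df Efv ddf Efvw cdf e0.
have : \forall y \near x, D y /\ `|fvw x - fvw y| < e.
  near=> y; split; first by near: y; exact: open_nbhs_nbhs.
  near: y; have /cvgrPdist_lt := cdf; exact.
(* For [h < r / N] the whole parallelogram spanned by [h *: v] and [h *: w] stays in the ball; the
   summand 1 keeps [N] positive when both vectors vanish. *)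
case/nbhs_ballP => r /= r0 br; pose N := `|v| + `|w| + 1.
have N0 : 0 < N by rewrite /N ltr_wpDl // addr_ge0.
exists (r / N); first exact: divr_gt0.
move=> h /andP[h0 hr].
have inD s t : 0 <= s <= 1 -> 0 <= t <= 1 ->
    ball x r (x + s *: (h *: v) + t *: (h *: w)).
  move=> /andP[s0 s1] /andP[t0 t1]; rewrite -ball_normE /=.
  rewrite opprD opprD !addrA subrr add0r -opprD normrN.
  apply: le_lt_trans (ler_normD _ _) _; rewrite !normrZ.
  rewrite (ger0_norm s0) (ger0_norm t0) (gtr0_norm h0).
  apply: (@le_lt_trans _ _ (h * `|v| + h * `|w|)).
    by rewrite lerD // ler_piMl // mulr_ge0 // ltW.
  rewrite -mulrDr; apply: (@le_lt_trans _ _ (h * N)).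
    by rewrite ler_pM2l // /N lerDl.
  by rewrite -ltr_pdivlMr.
have z01 : (0 <= 0 :> R) && (0 <= 1 :> R) by rewrite lexx ler01.
have o01 : (0 <= 1 :> R) && (1 <= 1 :> R) by rewrite lexx ler01.
pose g y := f (y + h *: w) - f y.
have inD1 s : 0 <= s <= 1 -> D (x + s *: (h *: v) + h *: w).
  by move=> s01; have [] := br _ (inD s 1 s01 o01); rewrite scale1r.
have inD0 s : 0 <= s <= 1 -> D (x + s *: (h *: v)).
  by move=> s01; have [] := br _ (inD s 0 s01 z01); rewrite scale0r addr0.
have shift_diff y : D (y + h *: w) -> is_diff y (fun y => f (y + h *: w))
    ('d f (y + h *: w)).
  move=> Dy; have -> : (fun y => f (y + h *: w)) = f \o (fun z => z + h *: w) by [].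
  have dsh : is_diff y (fun z : V => z + h *: w) id.
    by apply: is_diff_eq (is_diffD _ _) _; rewrite addr0.
  have dfy : differentiable f (y + h *: w) by exact: df.
  have [dz Ez] := dsh.
  apply: DiffDef; first exact: differentiable_comp.
  by rewrite diff_comp // Ez.
have dg y : D (y + h *: w) -> D y -> 
    is_diff y g (('d f (y + h *: w) : V -> R) - ('d f y : V -> R)).
  move=> D1 D2; have := shift_diff _ D1 => I1.
  have I2 : is_diff y f ('d f y) by apply: differentiableP; exact: df.
  exact: is_diffB.
have [s s01 gE] : exists2 s : R, 0 <= s <= 1 &
    g (x + h *: v) - g x = 'D_(h *: v) g (x + s *: (h *: v)).
  apply: MVT_line => t t01.
  by have [] := dg _ (inD1 t t01) (inD0 t t01).
have {}gE : g (x + h *: v) - g x =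
    h * (fv (x + s *: (h *: v) + h *: w) - fv (x + s *: (h *: v))).
  have [dgs Egs] := dg _ (inD1 s s01) (inD0 s s01).
  rewrite gE deriveZv // (deriveE _ dgs) Egs /=.
  rewrite -(Efv _ (inD1 s s01)) -(Efv _ (inD0 s s01)) !deriveE //.
    exact: df (inD0 s s01).
  exact: df (inD1 s s01).
have [t t01 kE] : exists2 t : R, 0 <= t <= 1 &
    fv (x + s *: (h *: v) + h *: w) - fv (x + s *: (h *: v)) =
    'D_(h *: w) fv (x + s *: (h *: v) + t *: (h *: w)).
  apply: (MVT_line (f := fv)) => t t01.
  by apply: ddf; have [] := br _ (inD s t s01 t01).
have [Dst lt_e] := br _ (inD s t s01 t01).
have -> : f (x + h *: v + h *: w) - f (x + h *: v) - f (x + h *: w) + f x =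
    g (x + h *: v) - g x by rewrite /g; ring.
rewrite gE kE deriveZv ?Efvw //; last exact: ddf.
rewrite mulrA -expr2 -mulrBr normrM ger0_norm ?sqr_ge0 //.
by rewrite ler_wpM2l ?sqr_ge0 // distrC ltW.
Unshelve. all: by end_near. Qed.

(** The second difference is symmetric in [v] and [w], so both mixed derivatives approximate the
    same quotient. *)
Lemma mixed_derivatives f fv fw fvw fwv D x v w : open D -> D x ->
  (forall y, D y -> differentiable f y) ->
  (forall y, D y -> 'D_v f y = fv y) -> (forall y, D y -> 'D_w f y = fw y) ->
  (forall y, D y -> differentiable fv y) ->
  (forall y, D y -> differentiable fw y) ->
  (forall y, D y -> 'D_w fv y = fvw y) -> (forall y, D y -> 'D_v fw y = fwv y) ->
  {for x, continuous fvw} -> {for x, continuous fwv} -> fvw x = fwv x.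
Proof.
move=> oD Dx df Ev Ew dv dw Evw Ewv cvw cwv.
apply/eqP; rewrite -subr_eq0 -normr_le0.
apply/ler_addgt0Pr => e e0; rewrite add0r.
have e20 : 0 < e / 2 by rewrite divr_gt0.
have [r1 r10 H1] := second_difference oD Dx df Ev dv Evw cvw e20.
have [r2 r20 H2] := second_difference oD Dx df Ew dw Ewv cwv e20.
pose h := Num.min r1 r2 / 2.
have m0 : 0 < Num.min r1 r2 by rewrite lt_min r10.
have h0 : 0 < h by rewrite divr_gt0.
have hm : h < Num.min r1 r2 by rewrite /h; lra.
have {}H1 := H1 h; have {}H2 := H2 h; move: hm; rewrite lt_min => /andP[h1 h2].
move: H1 H2; rewrite h0 h1 h2 => /(_ isT) H1 /(_ isT) H2.
have q0 := exprn_gt0 2 h0.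
have H : `|h ^+ 2 * (fvw x - fwv x)| <= h ^+ 2 * e.
  apply: (dist_half H1); rewrite (addrAC x (h *: w)) in H2.
  by rewrite (addrAC (f _)).
by move: H; rewrite normrM gtr0_norm // ler_pM2l.
Qed.

Theorem schwarz_scalar f D x v w :
  open D -> D x -> Ck 2 D f -> 'D_w ('D_v f) x = 'D_v ('D_w f) x.
Proof.
move=> oD Dx [df C1f].
apply: (@mixed_derivatives f ('D_v f) ('D_w f) ('D_w ('D_v f)) ('D_v ('D_w f))
  D x v w) => //.
- exact: (C1f v).1.
- exact: (C1f w).1.
- exact: (C1f v).2.
- exact: (C1f w).2.
Qed.

(** Reduction to entries. The derivative of an entry is the entry of the derivative only where the
    map is derivable, which is why [mixed_derivatives] takes derivatives as functions prescribed on
    [D]. *)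
Theorem schwarz m n (A : V -> 'M[R]_(m, n)) D x v w :
  open D -> D x -> Ck 2 D A -> 'D_w ('D_v A) x = 'D_v ('D_w A) x.
Proof.
move=> oD Dx [dA C1A]; apply/matrixP => i j.
have entry_cont (B : V -> 'M[R]_(m, n)) : {for x, continuous B} ->
    {for x, continuous (fun y => B y i j)}.
  move=> cB; apply: (@continuous_comp _ _ _ _ (fun N : 'M[R]_(m, n) => N i j)) => //.
  exact: coord_continuous.
apply: (@mixed_derivatives (fun y => A y i j) (fun y => 'D_v A y i j)
  (fun y => 'D_w A y i j) (fun y => 'D_w ('D_v A) y i j)
  (fun y => 'D_v ('D_w A) y i j) D x v w oD Dx).
- by move=> y Dy; apply: differentiable_entry; exact: dA.
- by move=> y Dy; apply/derive_entry/diff_derivable; exact: dA.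
- by move=> y Dy; apply/derive_entry/diff_derivable; exact: dA.
- by move=> y Dy; apply: differentiable_entry; exact: (C1A v).1.
- by move=> y Dy; apply: differentiable_entry; exact: (C1A w).1.
- by move=> y Dy; apply/derive_entry/diff_derivable; exact: (C1A v).1.
- by move=> y Dy; apply/derive_entry/diff_derivable; exact: (C1A w).1.
- exact/entry_cont/(C1A v).2.
- exact/entry_cont/(C1A w).2.
Qed.

End Schwarz.


(** * The curvature tensor in terms of Christoffel symbols of the first kind *)

Definition dot {R : comNzRingType} {n : nat} (B : 'M[R]_n) (u v : 'rV[R]_n) : R :=
  (u *m B *m v^T) 0 0.

Lemma dotC {R : comNzRingType} {n : nat} (B : 'M[R]_n) (u v : 'rV[R]_n) :
  B^T = B -> dot B u v = dot B v u.
Proof.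
by move=> sB; rewrite /dot -[u *m B *m v^T]trmxK mxE !trmx_mul trmxK sB mulmxA.
Qed.

Section DotLinear.
Context {R : comNzRingType} {n : nat}.
Implicit Types (B : 'M[R]_n) (u v w : 'rV[R]_n) (a : R).

Lemma dotDl B u v w : dot B (u + v) w = dot B u w + dot B v w.
Proof. by rewrite /dot !mulmxDl mxE. Qed.
Lemma dotDr B u v w : dot B u (v + w) = dot B u v + dot B u w.
Proof. by rewrite /dot linearD /= mulmxDr mxE. Qed.
Lemma dotZl B a u v : dot B (a *: u) v = a * dot B u v.
Proof. by rewrite /dot -!scalemxAl mxE. Qed.
Lemma dotZr B a u v : dot B u (a *: v) = a * dot B u v.
Proof. by rewrite /dot linearZ /= -scalemxAr mxE. Qed.
Lemma dotNl B u v : dot B (- u) v = - dot B u v.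
Proof. by rewrite -scaleN1r dotZl mulN1r. Qed.
Lemma dotNr B u v : dot B u (- v) = - dot B u v.
Proof. by rewrite -scaleN1r dotZr mulN1r. Qed.
Lemma dotBD B B' u v : dot (B + B') u v = dot B u v + dot B' u v.
Proof. by rewrite /dot mulmxDr mulmxDl mxE. Qed.
Lemma dotBZ B a u v : dot (a *: B) u v = a * dot B u v.
Proof. by rewrite /dot -scalemxAr -scalemxAl mxE. Qed.
Lemma dot_delta B i j : dot B (delta_mx 0 i) (delta_mx 0 j) = B i j.
Proof. by rewrite /dot -rowE trmx_delta -colE !mxE. Qed.
Lemma dot_deltar B u k : dot B u (delta_mx 0 k) = (u *m B) 0 k.
Proof. by rewrite /dot trmx_delta -colE mxE. Qed.
End DotLinear.

Lemma half_sum3 {R : realFieldType} (a b c : R) :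
  2^-1 * (a + b - c) + 2^-1 * (a + c - b) = a.
Proof. by field. Qed.

Section RiemAlgebra.
Context {R : realFieldType} {n : nat}.

(** For [P] the first derivatives of a metric, these are its Christoffel symbols of the first kind,
    kept as covectors so that no inverse matrix enters. *)
Definition chr1 (P : 'I_n -> 'M[R]_n) (i j : 'I_n) : 'rV[R]_n :=
  \row_k (2^-1 * (P i j k + P j i k - P k i j)).

Lemma chr1E P i j k : chr1 P i j 0 k = 2^-1 * (P i j k + P j i k - P k i j).
Proof. by rewrite mxE. Qed.

(** Compatibility of the Levi-Civita connection with the metric. *)
Lemma chr1_sum P i k p : (forall k, (P k)^T = P k) ->
  chr1 P i k 0 p + chr1 P i p 0 k = P i p k.
Proof.
move=> sP; have sPe a b c : P a b c = P a c b by rewrite -{1}sP mxE.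
by rewrite !chr1E (sPe i k p); exact: half_sum3.
Qed.

(* [P], [H] and [Gi] stand for the first and second derivatives of the metric and
   for its inverse. *)
Definition riem_form (Gi : 'M[R]_n) (P : 'I_n -> 'M[R]_n)
    (H : 'I_n -> 'I_n -> 'M[R]_n) (i j k l : 'I_n) : R :=
  2^-1 * (H i l j k - H i k j l - H j l i k + H j k i l)
  - dot Gi (chr1 P i k) (chr1 P j l) + dot Gi (chr1 P j k) (chr1 P i l).

(** The hypothesis on [dGam] is the Leibniz rule for [Gam *m G], which replaces the derivative of
    the inverse metric. By [chr1_sum] the correction term [Gam *m P] splits in two: one half cancels
    the products of Christoffel symbols in the curvature, the other half supplies the [dot Gi] terms
    of [riem_form]. *)
Lemma riem_algebra (G Gi : 'M[R]_n) (P : 'I_n -> 'M[R]_n)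
    (H : 'I_n -> 'I_n -> 'M[R]_n) (Gam : 'I_n -> 'I_n -> 'rV[R]_n)
    (dGam : 'I_n -> 'I_n -> 'I_n -> 'rV[R]_n) (i j k l : 'I_n) :
  G^T = G -> Gi^T = Gi -> (forall k, (P k)^T = P k) ->
  (forall i j, H i j = H j i) ->
  (forall i j, Gam i j *m G = chr1 P i j) ->
  (forall i j, Gam i j = chr1 P i j *m Gi) ->
  (forall i j k l, (dGam i j l *m G) 0 k =
    2^-1 * (H i j l k + H i l j k - H i k j l) - (Gam j l *m P i) 0 k) ->
  \sum_m G k m * (dGam i j l 0 m - dGam j i l 0 m +
    \sum_p (Gam i p 0 m * Gam j l 0 p - Gam j p 0 m * Gam i l 0 p)) =
  riem_form Gi P H i j k l.
Proof.
move=> sG sGi sP sH GamG GamE dGamE; rewrite /riem_form.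
have sGe a b : G a b = G b a by rewrite -{1}sG mxE.
have S1 a b c d : \sum_m G d m * dGam a b c 0 m =
    2^-1 * (H a b c d + H a c b d - H a d b c) - (Gam b c *m P a) 0 d.
  by rewrite -dGamE mxE; apply: eq_bigr => m _; rewrite mulrC (sGe d).
have S2 a b c : \sum_m G a m * Gam b c 0 m = chr1 P b c 0 a.
  by rewrite -GamG mxE; apply: eq_bigr => m _; rewrite mulrC (sGe a).
have Q a b c d : dot Gi (chr1 P a b) (chr1 P c d) =
    \sum_p Gam c d 0 p * chr1 P a b 0 p.
  rewrite dotC // /dot mxE -GamE.
  by apply: eq_bigr => p _; rewrite [_^T _ _]mxE.
have S3 a b c d : (Gam b c *m P a) 0 d =
    dot Gi (chr1 P a d) (chr1 P b c) + \sum_p Gam b c 0 p * chr1 P a p 0 d.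
  rewrite Q mxE -big_split /=; apply: eq_bigr => p _.
  by rewrite -mulrDr chr1_sum.
under eq_bigr do rewrite mulrDr mulrBr mulr_sumr.
rewrite big_split sumrB /= !S1 !S3 exchange_big /=.
under [X in _ + X]eq_bigr => p _.
  under eq_bigr do rewrite mulrBr !mulrA.
  rewrite sumrB -!mulr_suml !S2 mulrC [X in _ - X]mulrC.
  over.
rewrite sumrB (sH j i).
move: (dot _ _ _) (dot _ _ _) (\sum_p _) (\sum_p _) => a b c d.
ring.
Qed.

End RiemAlgebra.

Section Jet.
Context {R : realType} {n : nat}.
Implicit Types (x : 'rV[R]_n).

(** The regularity at one point that the curvature formula consumes. For a product such as [s *: G]
    it can be read off from explicit derivatives. *)
Definition jet2 {p q : nat} (G : 'rV[R]_n -> 'M[R]_(p, q)) x : Prop :=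
  [/\ \forall y \near x, forall i : 'I_n, derivable G y (delta_mx 0 i),
      forall i j : 'I_n, derivable (partial i G) x (delta_mx 0 j) &
      forall i j : 'I_n, partial i (partial j G) x = partial j (partial i G) x].

Lemma Ck_jet2 p q (G : 'rV[R]_n -> 'M[R]_(p, q)) D x :
  open D -> D x -> Ck 2 D G -> jet2 G x.
Proof.
move=> oD Dx CG; have [dG C1G] := CG; split.
- near=> y => i; apply: diff_derivable; apply: dG.
  by near: y; exact: open_nbhs_nbhs.
- by move=> i j; apply: diff_derivable; exact: (C1G (delta_mx 0 i)).1.
- by move=> i j; exact: schwarz oD Dx CG.
Unshelve. all: by end_near. Qed.

(* Christoffel symbols of the first kind, as covectors: entry [k] is
   g(D_i e_j, e_k). *)
Definition chris1 (G : 'rV[R]_n -> 'M[R]_n) (i j : 'I_n) x : 'rV[R]_n :=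
  chr1 (fun a => partial a G x) i j.

Definition chris2 (G : 'rV[R]_n -> 'M[R]_n) (i j : 'I_n) x : 'rV[R]_n :=
  chris1 G i j x *m ginv G x.

Lemma christoffelE (G : 'rV[R]_n -> 'M[R]_n) k i j x :
  (forall l : 'I_n, derivable G x (delta_mx 0 l)) -> (G x)^T = G x ->
  christoffel G k i j x = chris2 G i j x 0 k.
Proof.
move=> dG sG; rewrite /christoffel /chris2 mxE mulr_sumr; apply: eq_bigr => l _.
rewrite mxE -mulrA mulrCA [in RHS]mulrA mulrA [in LHS]mulrC mulrAC [2^-1 * _]mulrC.
have -> : ginv G x k l = ginv G x l k.
  by rewrite /ginv -[in LHS]sG -trmx_inv mxE.
rewrite /partial !(derive_entry _ _ (dG _)) [in RHS]mulrC; ring.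
Qed.

Section RiemFormula.
Variables (G : 'rV[R]_n -> 'M[R]_n) (x : 'rV[R]_n).
Hypotheses (jG : jet2 G x) (sG : \forall y \near x, (G y)^T = G y)
  (uG : \forall y \near x, G y \in unitmx).

Let dG : forall i, derivable G x (delta_mx 0 i).
Proof. by have [dG _ _] := jG; exact: nbhs_singleton dG. Qed.

Lemma is_derive_chris1 i j l : is_derive x (delta_mx 0 i) (chris1 G j l)
  (\row_k (2^-1 * (partial i (partial j G) x l k + partial i (partial l G) x j k
                   - partial i (partial k G) x j l))).
Proof.
have [_ ddG _] := jG.
have E a b c : is_derive x (delta_mx 0 i) (fun y => partial a G y b c)
    (partial i (partial a G) x b c).
  by apply: is_derive_entry; apply: DeriveDef => //; exact: ddG.
apply: is_derive_mx => a k; rewrite mxE; under eq_fun do rewrite mxE.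
apply: is_derive_eq (is_derive_mul (is_derive_cst _ _ _) _) _; last first.
  by rewrite mul0r add0r.
Qed.

Lemma derivable_chris2 i j l : derivable (chris2 G j l) x (delta_mx 0 i).
Proof.
have dc := is_derive_chris1 i j l.
have dg : derivable (ginv G) x (delta_mx 0 i) by exact: derivable_invmx.
exact: (@ex_derive _ _ _ _ _ _ _ (is_derive_mulmx dc (derivableP dg))).
Qed.

Lemma chris2K i j y : G y \in unitmx -> chris2 G i j y *m G y = chris1 G i j y.
Proof. by move=> u; rewrite /chris2 /ginv mulmxKV. Qed.

(** Obtained by differentiating the product [chris2 *m G = chris1]. The inverse metric only has to
    be derivable; its derivative is never computed. *)
Lemma derive_chris2 i j l k :
  ('D_(delta_mx 0 i) (chris2 G j l) x *m G x) 0 k =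
  2^-1 * (partial i (partial j G) x l k + partial i (partial l G) x j k
                   - partial i (partial k G) x j l)
  - (chris2 G j l x *m partial i G x) 0 k.
Proof.
have E : {near x, (fun y => chris2 G j l y *m G y) =1 chris1 G j l}.
  by near=> y; apply: chris2K; near: y.
have D1 := is_derive_mulmx (derivableP (@derivable_chris2 i j l)) (derivableP (@dG i)).
have D2 := near_eq_is_derive E D1.
have := (@derive_val _ _ _ _ _ _ _ D2).
rewrite (@derive_val _ _ _ _ _ _ _ (is_derive_chris1 i j l)) => /rowP/(_ k).
by rewrite [in LHS]mxE [in RHS]mxE => ->; rewrite addrK.
Unshelve. all: by end_near. Qed.

Lemma partial_sym k a b : partial k G x a b = partial k G x b a.
Proof.
have E : {near x, (fun y => (G y)^T) =1 G} by exact: sG.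
have := near_eq_derive (delta_mx 0 k) E.
rewrite (@derive_val _ _ _ _ _ _ _ (is_derive_trmx (derivableP (@dG k)))).
by move/matrixP/(_ b a); rewrite mxE.
Qed.

Lemma riemE i j k l :
  riem G i j k l x =
  riem_form (ginv G x) (fun a => partial a G x)
    (fun a b => partial a (partial b G) x) i j k l.
Proof.
have sGx := nbhs_singleton sG; have uGx := nbhs_singleton uG.
have [ndG _ sch] := jG.
(* The identification holds near [x], where [G] is symmetric and derivable; that suffices to
   differentiate both sides at [x]. *)
have cE k' i' j' : {near x, christoffel G k' i' j' =1 (fun y => chris2 G i' j' y 0 k')}.
  near=> y; apply: christoffelE; last by near: y.
  by near: y.
have D a b c d : partial a (christoffel G b c d) x =
    'D_(delta_mx 0 a) (chris2 G c d) x 0 b.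
  have dc : derivable (chris2 G c d) x (delta_mx 0 a) by apply: derivable_chris2.
  by rewrite /partial (near_eq_derive _ (cE b c d)) (derive_entry _ _ dc).
have C b c d : christoffel G b c d x = chris2 G c d x 0 b.
  exact: nbhs_singleton (cE b c d).
apply: etrans (@riem_algebra _ _ (G x) (ginv G x) (fun a => partial a G x)
  (fun i j => partial i (partial j G) x) (fun c d => chris2 G c d x)
  (fun a c d => 'D_(delta_mx 0 a) (chris2 G c d) x) i j k l _ _ _ _ _ _ _) => //.
- apply: eq_bigr => m _; congr (_ * (_ - _ + _)); [exact: D|exact: D|].
  by apply: eq_bigr => p _; congr (_ * _ - _ * _); exact: C.
- by rewrite /ginv trmx_inv sGx.
- by move=> a; apply/matrixP => b c; rewrite mxE; exact: partial_sym.
- by move=> a b; exact: chris2K.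
- by move=> a b c d; exact: derive_chris2.
Unshelve. all: by end_near. Qed.

End RiemFormula.
End Jet.

(** * Contractions of the jets of a metric *)

Section Multilinear.
Context {R : comNzRingType} {n : nat}.
Implicit Types (u v w z : 'rV[R]_n).

Definition lin1 (f : 'rV[R]_n -> R) : Prop :=
  forall a u v, f (a *: u + v) = a * f u + f v.

Lemma lin1_sum f u : lin1 f -> f u = \sum_i u 0 i * f (delta_mx 0 i).
Proof.
move=> lf; have f0 : f 0 = 0.
  by have := lf 1 0 0; rewrite scaler0 addr0 mul1r => /eqP; rewrite -subr_eq0 opprD addNKr oppr_eq0 => /eqP.
rewrite {1}(row_sum_delta u).
by elim/big_rec2: _ => [|i a b _ <-]; rewrite ?f0 ?lf.
Qed.

(** Moves between components and arbitrary vectors: an identity of quadrilinear forms need only be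
    compared on basis vectors. *)
Lemma multilinear4 (T : 'rV[R]_n -> 'rV[R]_n -> 'rV[R]_n -> 'rV[R]_n -> R) u v w z :
  (forall v w z, lin1 (fun u => T u v w z)) ->
  (forall u w z, lin1 (fun v => T u v w z)) ->
  (forall u v z, lin1 (fun w => T u v w z)) ->
  (forall u v w, lin1 (fun z => T u v w z)) ->
  \sum_i \sum_j \sum_k \sum_l
    T (delta_mx 0 i) (delta_mx 0 j) (delta_mx 0 k) (delta_mx 0 l)
      * u 0 i * v 0 j * w 0 k * z 0 l = T u v w z.
Proof.
move=> T1 T2 T3 T4; rewrite (lin1_sum _ (T1 v w z)); apply: eq_bigr => i _.
rewrite (lin1_sum _ (T2 _ w z)) mulr_sumr; apply: eq_bigr => j _.
rewrite (lin1_sum _ (T3 _ _ z)) !mulr_sumr; apply: eq_bigr => k _.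
rewrite (lin1_sum _ (T4 _ _ _)) !mulr_sumr; apply: eq_bigr => l _.
ring.
Qed.

End Multilinear.

Section Contractions.
Context {R : realFieldType} {n p q : nat}.
Variables (T : 'I_n -> 'M[R]_(p, q)) (TT : 'I_n -> 'I_n -> 'M[R]_(p, q)).
Implicit Types (u v w z : 'rV[R]_n) (a : R).

Definition con1 u : 'M[R]_(p, q) := \sum_c u 0 c *: T c.
(** The first argument is paired with the second index of [TT]. If [TT d c] is the derivative of
    [T c] in direction [d], this is the derivative of [con1 T u] in direction [v] for fixed [u]. *)
Definition con2 u v : 'M[R]_(p, q) := \sum_c u 0 c *: \sum_d v 0 d *: TT d c.

Lemma con1P a u v : con1 (a *: u + v) = a *: con1 u + con1 v.
Proof.
rewrite scaler_sumr -big_split; apply: eq_bigr => c _ /=.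
by rewrite !mxE scalerDl scalerA.
Qed.

Lemma con2Pl a u v w : con2 (a *: u + v) w = a *: con2 u w + con2 v w.
Proof.
rewrite scaler_sumr -big_split; apply: eq_bigr => c _ /=.
by rewrite !mxE scalerDl scalerA.
Qed.

Lemma con2Pr a u v w : con2 w (a *: u + v) = a *: con2 w u + con2 w v.
Proof.
rewrite scaler_sumr -big_split; apply: eq_bigr => c _ /=.
rewrite scalerA mulrC -scalerA -scalerDr; congr (_ *: _).
rewrite scaler_sumr -big_split; apply: eq_bigr => d _ /=.
by rewrite !mxE scalerDl scalerA.
Qed.

Lemma con2C u v : (forall c d, TT c d = TT d c) -> con2 u v = con2 v u.
Proof.
move=> sT; rewrite /con2; under eq_bigr do rewrite scaler_sumr.
rewrite exchange_big; apply: eq_bigr => d _ /=.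
rewrite scaler_sumr; apply: eq_bigr => c _.
by rewrite !scalerA mulrC sT.
Qed.

Lemma con1_delta i : con1 (delta_mx 0 i) = T i.
Proof.
rewrite /con1 (bigD1 i) //= big1 => [|c /negPf ci].
  by rewrite mxE !eqxx scale1r addr0.
by rewrite mxE ci scale0r.
Qed.

Lemma con2_delta i j : con2 (delta_mx 0 i) (delta_mx 0 j) = TT j i.
Proof.
rewrite /con2 (bigD1 i) //= [X in _ + X]big1 => [|c /negPf ic]; last first.
  by rewrite mxE ic scale0r.
rewrite mxE !eqxx scale1r addr0 (bigD1 j) //= big1 => [|d /negPf dj].
  by rewrite mxE !eqxx scale1r addr0.
by rewrite mxE dj scale0r.
Qed.

End Contractions.

Section CurvatureForm.
Context {R : realFieldType} {n : nat}.
Variables (T : 'I_n -> 'M[R]_n) (TT : 'I_n -> 'I_n -> 'M[R]_n).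
Implicit Types (u v w z : 'rV[R]_n) (a : R).

Definition conc u v : 'rV[R]_n := \sum_a \sum_b (u 0 a * v 0 b) *: chr1 T a b.

(** The Koszul formula for constant vector fields, checked on basis vectors because both sides are
    trilinear. *)
Lemma concE u v w : (conc u v *m w^T) 0 0 =
  2^-1 * (dot (con1 T u) v w + dot (con1 T v) u w - dot (con1 T w) u v).
Proof.
have L (t : 'rV[R]_n) : (t *m w^T) 0 0 = \sum_k t 0 k * w 0 k.
  by rewrite mxE; apply: eq_bigr => k _; rewrite mxE.
have cd (a b : 'I_n) : conc (delta_mx 0 a) (delta_mx 0 b) = chr1 T a b.
  rewrite /conc (bigD1 a) //= [X in _ + X]big1 => [|c /negPf ca]; last first.
    by rewrite big1 // => d _; rewrite !mxE ca mul0r scale0r.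
  rewrite (bigD1 b) //= big1 => [|d /negPf db]; last first.
    by rewrite !mxE db mulr0 scale0r.
  by rewrite !mxE !eqxx mul1r scale1r !addr0.
pose Lf u v w := 2^-1 * (dot (con1 T u) v w + dot (con1 T v) u w - dot (con1 T w) u v).
have lin := (@con1P R n n n T, @dotDl R n, @dotDr R n, @dotZl R n, @dotZr R n, @dotBD R n,
  @dotBZ R n).
have Ll v' w' : lin1 (fun u' => Lf u' v' w').
  by move=> a u1 u2; rewrite /Lf !lin; ring.
have Lm u' w' : lin1 (fun v' => Lf u' v' w').
  by move=> a u1 u2; rewrite /Lf !lin; ring.
have Lr u' v' : lin1 (fun w' => Lf u' v' w').
  by move=> a u1 u2; rewrite /Lf !lin; ring.
rewrite -/(Lf u v w) (lin1_sum u (Ll v w)) L.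
under eq_bigr => k _ do rewrite summxE mulr_suml.
rewrite exchange_big; apply: eq_bigr => a _ /=.
rewrite (lin1_sum v (Lm _ w)) mulr_sumr.
under eq_bigr => k _ do rewrite summxE mulr_suml.
rewrite exchange_big; apply: eq_bigr => b _ /=.
rewrite (lin1_sum w (Lr _ _)) !mulr_sumr.
apply: eq_bigr => k _; rewrite /Lf !con1_delta !dot_delta mxE chr1E.
ring.
Qed.

Lemma conc_delta i j : conc (delta_mx 0 i) (delta_mx 0 j) = chr1 T i j.
Proof.
apply/rowP => k.
have -> : conc (delta_mx 0 i) (delta_mx 0 j) 0 k =
    (conc (delta_mx 0 i) (delta_mx 0 j) *m (delta_mx 0 k : 'rV_n)^T) 0 0.
  by rewrite trmx_delta -colE mxE.
by rewrite concE !con1_delta !dot_delta chr1E.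
Qed.

Lemma concPl a u v w : conc (a *: u + v) w = a *: conc u w + conc v w.
Proof.
rewrite scaler_sumr -big_split; apply: eq_bigr => c _ /=.
rewrite scaler_sumr -big_split; apply: eq_bigr => d _ /=.
by rewrite !mxE scalerA mulrA -scalerDl mulrDl.
Qed.

Lemma concPr a u v w : conc w (a *: u + v) = a *: conc w u + conc w v.
Proof.
rewrite scaler_sumr -big_split; apply: eq_bigr => c _ /=.
rewrite scaler_sumr -big_split; apply: eq_bigr => d _ /=.
by rewrite !mxE scalerA mulrDr mulrCA -scalerDl.
Qed.

(** [riem_form] as a quadrilinear form on vectors: the ambient curvature has to be evaluated on the
    derivatives of the immersion. *)
Definition rmform (Gi : 'M[R]_n) u v w z : R :=
  2^-1 * (dot (con2 TT z u) v w - dot (con2 TT w u) v z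
          - dot (con2 TT z v) u w + dot (con2 TT w v) u z)
  - dot Gi (conc u w) (conc v z) + dot Gi (conc v w) (conc u z).

Lemma rmform_sum (Gi : 'M[R]_n) u v w z :
  \sum_i \sum_j \sum_k \sum_l
    riem_form Gi T TT i j k l * u 0 i * v 0 j * w 0 k * z 0 l = rmform Gi u v w z.
Proof.
have lin := (@con2Pl R n n n TT, @con2Pr R n n n TT, concPl, concPr,
  (@dotDl R n, @dotDr R n, @dotZl R n, @dotZr R n, @dotBD R n, @dotBZ R n)).
rewrite -(multilinear4 (T := rmform Gi)).
- apply: eq_bigr => i _; apply: eq_bigr => j _; apply: eq_bigr => k _.
  apply: eq_bigr => l _; congr (_ * _ * _ * _ * _).
  by rewrite /rmform !con2_delta !conc_delta !dot_delta.
- by move=> v' w' z' a u1 u2; rewrite /rmform !lin; ring.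
- by move=> v' w' z' a u1 u2; rewrite /rmform !lin; ring.
- by move=> v' w' z' a u1 u2; rewrite /rmform !lin; ring.
- by move=> v' w' z' a u1 u2; rewrite /rmform !lin; ring.
Qed.

End CurvatureForm.

(** * The Gauss equation *)

Section GaussAlgebra.
Context {R : realFieldType} {m n : nat}.
Variables (h hi : 'M[R]_n) (T : 'I_n -> 'M[R]_n) (TT : 'I_n -> 'I_n -> 'M[R]_n).
Variables (f : 'I_m -> 'rV[R]_n) (ff : 'I_m -> 'I_m -> 'rV[R]_n)
  (fff : 'I_m -> 'I_m -> 'I_m -> 'rV[R]_n).

(** [f], [ff], [fff] stand for the first three derivatives of a map, and [h], [T], [TT] for a metric
    and its first two derivatives at the image point. [pull0], [pull1], [pull2] are then the
    pulled-back metric and its derivatives, expanded by the Leibniz rule. *)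
Definition pull0 : 'M[R]_m := \matrix_(i, j) dot h (f i) (f j).

Definition pull1 k : 'M[R]_m := \matrix_(i, j)
  (dot (con1 T (f k)) (f i) (f j) + dot h (ff k i) (f j) + dot h (f i) (ff k j)).

Definition pull2 l k : 'M[R]_m := \matrix_(i, j)
  (dot (con1 T (ff l k) + con2 TT (f k) (f l)) (f i) (f j)
   + dot (con1 T (f k)) (ff l i) (f j) + dot (con1 T (f k)) (f i) (ff l j)
   + (dot (con1 T (f l)) (ff k i) (f j) + dot h (fff l k i) (f j)
      + dot h (ff k i) (ff l j))
   + (dot (con1 T (f l)) (f i) (ff k j) + dot h (ff l i) (ff k j)
      + dot h (f i) (fff l k j))).

(** The covariant derivative of the j-th tangent vector in direction i along the map, tangential
    part included; [hi] raises the index of the Christoffel covector. *)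
Definition bvec i j : 'rV[R]_n := ff i j + conc T (f i) (f j) *m hi.

Hypotheses (sh : h^T = h) (hK : hi *m h = 1%:M) (shi : hi^T = hi).
Hypotheses (sT : forall c, (T c)^T = T c)
  (sTT : forall c d, (TT c d)^T = TT c d) (sTT2 : forall c d, TT c d = TT d c).
Hypotheses (sff : forall i j, ff i j = ff j i)
  (sfff1 : forall i j k, fff i j k = fff j i k)
  (sfff2 : forall i j k, fff i j k = fff i k j).

Lemma con1_sym u : (con1 T u)^T = con1 T u.
Proof.
by rewrite linear_sum; apply: eq_bigr => c _; rewrite linearZ /= sT.
Qed.

Lemma con2_sym u v : (con2 TT u v)^T = con2 TT u v.
Proof.
rewrite linear_sum; apply: eq_bigr => c _; rewrite linearZ /= linear_sum.
by congr (_ *: _); apply: eq_bigr => d _; rewrite linearZ /= sTT.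
Qed.

Lemma dot_conc u v w : dot h (conc T u v *m hi) w =
  2^-1 * (dot (con1 T u) v w + dot (con1 T v) u w - dot (con1 T w) u v).
Proof. by rewrite /dot -[conc T u v *m hi *m h]mulmxA hK mulmx1 concE. Qed.

Lemma conc_sym u v : conc T u v = conc T v u.
Proof.
apply/rowP => k.
have E (t : 'rV[R]_n) : t 0 k = (t *m (delta_mx 0 k : 'rV_n)^T) 0 0.
  by rewrite trmx_delta -colE mxE.
rewrite !E !concE (@dotC R n _ u v (con1_sym _)); congr (_ * _); ring.
Qed.

Lemma bvec_sym i j : bvec i j = bvec j i.
Proof. by rewrite /bvec sff conc_sym. Qed.

(** The Levi-Civita connection of the induced metric is the tangential part of the ambient one. *)
Lemma chr1_pull i j k : chr1 pull1 i j 0 k = dot h (bvec i j) (f k).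
Proof.
rewrite chr1E !mxE /bvec (@dotDl R n) dot_conc.
have dh u v : dot h u v = dot h v u by exact: dotC.
rewrite (dh (f j) (ff i k)) (dh (f i) (ff j k)) (dh (f i) (ff k j)).
rewrite (sff k i) (sff k j) (sff j i); by field.
Qed.

Definition sffA (nu : 'rV[R]_n) i j := dot h (bvec i j) nu.

Lemma chr1_pull_row i j : chr1 pull1 i j = bvec i j *m h *m (\matrix_i f i)^T.
Proof.
apply/rowP => k; rewrite chr1_pull /dot !mxE; apply: eq_bigr => a _.
by rewrite !mxE.
Qed.

Variables (Gi : 'M[R]_m) (nu : 'rV[R]_n).
Hypothesis completeness :
  h *m (\matrix_i f i)^T *m Gi *m (\matrix_i f i) *m h
  + h *m nu^T *m (nu *m h) = h.

(** [completeness] decomposes [h] into a tangential and a normal part. The tangential part of the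
    product of two covariant derivatives is what [Gi] computes from the induced Christoffel symbols,
    so the normal part is left over. *)
Lemma dot_chr1_pull i j k l :
  dot Gi (chr1 pull1 i j) (chr1 pull1 k l) =
  dot h (bvec i j) (bvec k l) - sffA nu i j * sffA nu k l.
Proof.
rewrite !chr1_pull_row; apply/esym/eqP; rewrite subr_eq; apply/eqP.
have := completeness; set F := \matrix_i f i => cpl; set b := bvec i j; set b' := bvec k l.
have -> : dot h b b' = dot (h *m F^T *m Gi *m F *m h + h *m nu^T *m (nu *m h)) b b'.
  by rewrite cpl.
rewrite (@dotBD R n) /sffA (@dotC R n _ b' nu sh); congr (_ + _).
  by rewrite /dot !trmx_mul trmxK sh !mulmxA.
rewrite /dot; have -> : b *m (h *m nu^T *m (nu *m h)) *m b'^T =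
    (b *m h *m nu^T) *m (nu *m h *m b'^T) by rewrite !mulmxA.
by rewrite mxE big_ord1.
Qed.

(** After [dot_chr1_pull] the full products of covariant derivatives combine with the second
    derivatives of the pulled-back metric into the ambient curvature, the third derivatives of the
    map cancel, and the normal remainders form the Gauss term. *)
Theorem gauss_algebra i j k l :
  riem_form Gi pull1 pull2 i j k l =
  rmform T TT hi (f i) (f j) (f k) (f l)
  + sffA nu i k * sffA nu j l - sffA nu j k * sffA nu i l.
Proof.
rewrite /riem_form !dot_chr1_pull.
have bb a b c d : dot h (bvec a b) (bvec c d) = dot h (ff a b) (ff c d)
    + dot h (conc T (f a) (f b) *m hi) (ff c d)
    + dot h (conc T (f c) (f d) *m hi) (ff a b)
    + dot hi (conc T (f a) (f b)) (conc T (f c) (f d)).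
  rewrite [in LHS]/bvec (@dotDl R n) !(@dotDr R n) (@dotC R n _ (ff a b) (_ *m hi) sh).
  have -> : dot h (conc T (f a) (f b) *m hi) (conc T (f c) (f d) *m hi) =
      dot hi (conc T (f a) (f b)) (conc T (f c) (f d)).
    by rewrite /dot -[_ *m hi *m h]mulmxA hK mulmx1 trmx_mul shi mulmxA.
  ring.
rewrite !bb /rmform !dot_conc !mxE !(@dotBD R n).
rewrite !(con2C (f l) _ sTT2).
rewrite !(con2C (f k) (f i) sTT2) !(con2C (f k) (f j) sTT2).
rewrite !(sff j i) !(sff k i) !(sff l i) !(sff k j) !(sff l j) !(sff l k).
rewrite (sfff2 i l j) (sfff2 j l i) (sfff1 j i l).
rewrite (sfff2 i k j) (sfff2 j k i) (sfff1 j i k).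
rewrite (sfff2 i l k) (sfff2 j l k).
have dh u v : dot h u v = dot h v u by exact: dotC.
have dc w u v : dot (con1 T w) u v = dot (con1 T w) v u by exact/dotC/con1_sym.
rewrite !(dh (f _) (fff _ _ _)).
rewrite (dh (ff j l) (ff i k)) (dh (ff i l) (ff j k)).
rewrite !(dc _ (f _) (ff _ _)) ?(dc _ (f j) (f i)) ?(dc _ (f k) (f i)) ?(dc _ (f l) (f i)).
rewrite ?(dc _ (f k) (f j)) ?(dc _ (f l) (f j)) ?(dc _ (f l) (f k)).
have dcc u v w z : dot (con2 TT u v) w z = dot (con2 TT u v) z w.
  exact/dotC/con2_sym.
rewrite ?(dcc _ _ (f l)) ?(dcc _ _ (f k) (f i)) ?(dcc _ _ (f k) (f j)) ?(dcc _ _ (f j) (f i)).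
by field.
Qed.

End GaussAlgebra.

Lemma is_derive_dot {R : realType} {V : normedModType R} n
    (B : V -> 'M[R]_n) (u w : V -> 'rV[R]_n) x v dB du dw :
  is_derive x v B dB -> is_derive x v u du -> is_derive x v w dw ->
  is_derive x v (fun y => dot (B y) (u y) (w y))
    (dot dB (u x) (w x) + dot (B x) du (w x) + dot (B x) (u x) dw).
Proof.
move=> hB hu hw; apply: is_derive_eq.
  apply: is_derive_entry; apply: is_derive_mulmx (is_derive_trmx hw).
  exact: is_derive_mulmx hu hB.
by rewrite /dot !mulmxDl !mxE; congr (_ + _); rewrite addrC.
Qed.

(** In the basis formed by the rows of [J] and [nu], the matrix of [h] is block diagonal with blocks
    [J *m h *m J^T] and 1. Codimension one makes the stacked matrix [K] square, so the right inverse
    read off from these blocks is also a left inverse. *)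
Lemma completeness_relation {R : fieldType} {m : nat} (J : 'M[R]_(m, m + 1))
    (h : 'M[R]_(m + 1)) (nu : 'rV[R]_(m + 1)) :
  h^T = h -> J *m h *m J^T \in unitmx -> J *m h *m nu^T = 0 ->
  (nu *m h *m nu^T) 0 0 = 1 ->
  h *m J^T *m invmx (J *m h *m J^T) *m J *m h + h *m nu^T *m (nu *m h) = h.
Proof.
move=> sh uG Jnu nunu; set Gi := invmx _.
pose K := col_mx J nu; pose B : 'M[R]_(m + 1) := block_mx Gi 0 0 1%:M.
have nuJ : nu *m h *m J^T = 0.
  by apply: trmx_inj; rewrite !trmx_mul trmxK sh trmx0 mulmxA.
have KhKB : K *m (h *m K^T *m B) = 1%:M.
  rewrite !mulmxA /K tr_col_mx mul_col_mx mul_col_row Jnu nuJ.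
  have -> : nu *m h *m nu^T = 1%:M.
    by apply/matrixP => i j; rewrite !ord1 nunu mxE.
  rewrite mulmx_block !(mulmx0, mul0mx, mulmx1, mul1mx, addr0, add0r).
  by rewrite mulmxV // -scalar_mx_block.
have hQ : h *m (J^T *m Gi *m J + nu^T *m nu) = 1%:M.
  rewrite -(mulmx1C KhKB) -!mulmxA /K /B tr_col_mx; congr (_ *m _).
  by rewrite mul_block_col mul_row_col !(mul0mx, mul1mx, addr0, add0r).
transitivity (h *m (J^T *m Gi *m J + nu^T *m nu) *m h); last by rewrite hQ mul1mx.
by rewrite mulmxDr mulmxDl !mulmxA.
Qed.

Section Chain.
Context {R : realType} {m n p q : nat}.
Variables (F : 'rV[R]_m -> 'rV[R]_n) (H : 'rV[R]_n -> 'M[R]_(p, q)).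

Lemma is_derive_comp y l : differentiable F y -> differentiable H (F y) ->
  is_derive y (delta_mx 0 l) (H \o F)
    (con1 (fun c => partial c H (F y)) (partial l F y)).
Proof.
move=> dFy dHy.
apply: is_derive_eq (is_derive_chain (delta_mx 0 l) dFy dHy) _.
exact: derive_row.
Qed.

Lemma is_derive_comp2 y l k : differentiable F y ->
  differentiable (partial k F) y ->
  (forall c, differentiable (partial c H) (F y)) ->
  is_derive y (delta_mx 0 l)
    (fun y => con1 (fun c => partial c H (F y)) (partial k F y))
    (con1 (fun c => partial c H (F y)) (partial l (partial k F) y)
     + con2 (fun c d => partial c (partial d H) (F y)) (partial k F y) (partial l F y)).
Proof.
move=> dFy dFk dHy; rewrite /con1 /con2 -big_split /=.
apply: is_derive_bigsum => c; apply: is_derive_scalemx.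
  by apply: is_derive_entry; apply: DeriveDef => //; exact: diff_derivable.
apply: is_derive_eq (is_derive_chain (delta_mx 0 l) dFy (dHy c)) _.
exact: derive_row.
Qed.

End Chain.

(** * Derivatives of a pulled-back metric and the Gauss equation in coordinates *)

Section Pullback.
Context {R : realType} {m n : nat}.
Variables (F : 'rV[R]_m -> 'rV[R]_n) (Gh : 'rV[R]_n -> 'M[R]_n).
Variables (D : set 'rV[R]_m) (E : set 'rV[R]_n).
Hypotheses (oD : open D) (oE : open E) (FDE : forall y, D y -> E (F y)).
Hypotheses (CF : Ck 3 D F) (CG : Ck 2 E Gh).

Definition dF y i := partial i F y.
Definition ddF y i j := partial i (partial j F) y.
Definition dddF y i j k := partial i (partial j (partial k F)) y.
Definition dG z c := partial c Gh z.
Definition ddG z c d := partial c (partial d Gh) z.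

Lemma is_derive_dF y l k : D y ->
  is_derive y (delta_mx 0 l) (partial k F) (ddF y l k).
Proof.
move=> Dy; apply: DeriveDef => //; apply: diff_derivable.
by have [_ /(_ (delta_mx 0 k)) [+ _]] := CF; apply.
Qed.

Lemma is_derive_ddF y l k i : D y ->
  is_derive y (delta_mx 0 l) (partial k (partial i F)) (dddF y l k i).
Proof.
move=> Dy; apply: DeriveDef => //; apply: diff_derivable.
by have [_ /(_ (delta_mx 0 i)) [_ /(_ (delta_mx 0 k)) [+ _]]] := CF; apply.
Qed.

Lemma is_derive_GF y l : D y ->
  is_derive y (delta_mx 0 l) (Gh \o F) (con1 (dG (F y)) (dF y l)).
Proof.
move=> Dy; have dFy : differentiable F y by have [+ _] := CF; apply.
have dGy : differentiable Gh (F y) by have [+ _] := CG; apply; exact: FDE.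
exact: is_derive_comp.
Qed.

Lemma is_derive_dGF y l k : D y ->
  is_derive y (delta_mx 0 l) (fun y => con1 (dG (F y)) (dF y k))
    (con1 (dG (F y)) (ddF y l k) + con2 (ddG (F y)) (dF y k) (dF y l)).
Proof.
move=> Dy; apply: is_derive_comp2.
- by have [+ _] := CF; apply.
- by have [_ /(_ (delta_mx 0 k)) [+ _]] := CF; apply.
- by move=> c; have [_ /(_ (delta_mx 0 c)) [+ _]] := CG; apply; exact: FDE.
Qed.

Definition pull y := pull0 (Gh (F y)) (dF y).
Definition dpull k y := pull1 (Gh (F y)) (dG (F y)) (dF y) (ddF y) k.

Lemma is_derive_pull y k : D y ->
  is_derive y (delta_mx 0 k) pull (dpull k y).
Proof.
move=> Dy; apply: is_derive_mx => i j; rewrite mxE.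
under eq_fun do rewrite mxE.
apply: is_derive_dot; [exact: is_derive_GF|exact: is_derive_dF..].
Qed.

Lemma is_derive_dpull y l k : D y ->
  is_derive y (delta_mx 0 l) (dpull k)
    (pull2 (Gh (F y)) (dG (F y)) (ddG (F y)) (dF y) (ddF y) (dddF y) l k).
Proof.
move=> Dy; apply: is_derive_mx => i j; rewrite mxE.
under eq_fun do rewrite mxE.
apply: is_deriveD; first apply: is_deriveD.
- apply: is_derive_dot; [exact: is_derive_dGF|exact: is_derive_dF..].
- by apply: is_derive_dot; [exact: is_derive_GF|exact: is_derive_ddF|exact: is_derive_dF].
- by apply: is_derive_dot; [exact: is_derive_GF|exact: is_derive_dF|exact: is_derive_ddF].
Qed.

Hypothesis sG : forall z, E z -> (Gh z)^T = Gh z.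
Hypothesis uG : forall z, E z -> Gh z \in unitmx.

Lemma dF_sym y i j : D y -> ddF y i j = ddF y j i.
Proof.
move=> Dy; rewrite /ddF /partial; apply: (schwarz _ _ oD Dy).
have [d1 c1] := CF; split=> // v; have [d2 c2] := c1 v; split=> // w x Dx.
by apply: differentiable_continuous; have [+ _] := c2 w; apply.
Qed.

Lemma ddF_sym1 y i j k : D y -> dddF y i j k = dddF y j i k.
Proof.
by move=> Dy; rewrite /dddF /partial; apply: (schwarz _ _ oD Dy); have [_] := CF; apply.
Qed.

Lemma ddF_sym2 y i j k : D y -> dddF y i j k = dddF y i k j.
Proof.
move=> Dy; rewrite /dddF {1 3}/partial; apply: near_eq_derive.
by near=> z; apply: dF_sym; near: z; exact: open_nbhs_nbhs.
Unshelve. all: by end_near. Qed.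

Lemma dG_sym z c : E z -> (dG z c)^T = dG z c.
Proof.
move=> Ez; have dGz : differentiable Gh z by have [+ _] := CG; apply.
have H : {near z, (fun y => (Gh y)^T) =1 Gh}.
  by near=> y; apply: sG; near: y; exact: open_nbhs_nbhs.
have := near_eq_derive (delta_mx 0 c) H.
have dc : derivable Gh z (delta_mx 0 c) by exact: diff_derivable.
by rewrite (@derive_val _ _ _ _ _ _ _ (is_derive_trmx (derivableP dc))).
Unshelve. all: by end_near. Qed.

Lemma ddG_sym z c d : E z -> (ddG z c d)^T = ddG z c d.
Proof.
move=> Ez; have dGz : differentiable (partial d Gh) z.
  by have [_ /(_ (delta_mx 0 d)) [+ _]] := CG; apply.
have H : {near z, (fun y => (partial d Gh y)^T) =1 partial d Gh}.
  by near=> y; apply: dG_sym; near: y; exact: open_nbhs_nbhs.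
have := near_eq_derive (delta_mx 0 c) H.
have dc : derivable (partial d Gh) z (delta_mx 0 c) by exact: diff_derivable.
by rewrite (@derive_val _ _ _ _ _ _ _ (is_derive_trmx (derivableP dc))).
Unshelve. all: by end_near. Qed.

Lemma ddG_sym2 z c d : E z -> ddG z c d = ddG z d c.
Proof. by move=> Ez; rewrite /ddG /partial; exact: schwarz oE Ez CG. Qed.

Lemma rmformE z u v w t : E z ->
  rmform (dG z) (ddG z) (ginv Gh z) u v w t =
  \sum_i \sum_j \sum_k \sum_l
     riem Gh i j k l z * u 0 i * v 0 j * w 0 k * t 0 l.
Proof.
move=> Ez; rewrite -rmform_sum.
have jG : jet2 Gh z by exact: Ck_jet2 oE Ez CG.
have sGz : \forall y \near z, (Gh y)^T = Gh y.
  by near=> y; apply: sG; near: y; exact: open_nbhs_nbhs.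
have uGz : \forall y \near z, Gh y \in unitmx.
  by near=> y; apply: uG; near: y; exact: open_nbhs_nbhs.
apply: eq_bigr => i _; apply: eq_bigr => j _; apply: eq_bigr => k _.
apply: eq_bigr => l _.
have H := riemE jG sGz uGz i j k l.
by rewrite H.
Unshelve. all: by end_near. Qed.

Variable G : 'rV[R]_m -> 'M[R]_m.
Hypothesis GE : forall y, D y -> G y = pull y.

Lemma partial_pullback y k : D y -> partial k G y = dpull k y.
Proof.
move=> Dy; have [_ <-] := is_derive_pull k Dy; apply: near_eq_derive.
by near=> z; apply: GE; near: z; exact: open_nbhs_nbhs.
Unshelve. all: by end_near. Qed.

Lemma partial2_pullback y l k : D y -> partial l (partial k G) y =
  pull2 (Gh (F y)) (dG (F y)) (ddG (F y)) (dF y) (ddF y) (dddF y) l k.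
Proof.
move=> Dy; have [_ <-] := is_derive_dpull l k Dy; apply: near_eq_derive.
by near=> z; apply: partial_pullback; near: z; exact: open_nbhs_nbhs.
Unshelve. all: by end_near. Qed.

Definition accel y i j : 'rV[R]_n :=
  bvec (ginv Gh (F y)) (dG (F y)) (dF y) (ddF y) i j.

(** Matches [accel], suited to the algebra, with the coordinate expression in the definition of
    [sff]. *)
Lemma accelE y i j : D y ->
  accel y i j = \row_a (partial i (partial j (fun y => F y 0 a)) y
             + \sum_r \sum_s christoffel Gh a r s (F y)
                 * partial i (fun y => F y 0 r) y
                 * partial j (fun y => F y 0 s) y).
Proof.
move=> Dy; have Ez := FDE Dy.
have pE z k a : D z -> partial k (fun y => F y 0 a) z = dF z k 0 a.
  move=> Dz; apply/derive_entry/diff_derivable; by have [+ _] := CF; apply.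
apply/rowP => a; rewrite /accel /bvec !mxE; congr (_ + _).
  have [dd <-] := is_derive_dF i j Dy; rewrite -(derive_entry _ _ dd).
  apply: near_eq_derive.
  by near=> z; rewrite pE //; near: z; exact: open_nbhs_nbhs.
rewrite /conc; under eq_bigr do rewrite summxE mulr_suml.
rewrite exchange_big; apply: eq_bigr => r _ /=.
under eq_bigr do rewrite summxE mulr_suml.
rewrite exchange_big; apply: eq_bigr => s _ /=.
rewrite !pE // christoffelE; last exact: sG.
  rewrite /chris2 /chris1 [in RHS]mxE !mulr_suml; apply: eq_bigr => b _.
  rewrite [in LHS]mxE; ring.
move=> l; apply: diff_derivable; by have [+ _] := CG; apply.
Unshelve. all: by end_near. Qed.

Lemma accel_tangent y i j k : D y ->
  chris1 G i j y 0 k = dot (Gh (F y)) (accel y i j) (dF y k).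
Proof.
move=> Dy; have Ez := FDE Dy.
rewrite /accel -(chr1_pull (dG (F y)) (dF y)).
- by rewrite !chr1E !partial_pullback.
- exact: sG.
- by rewrite /ginv mulVmx // uG.
- by move=> a b; exact: dF_sym.
Qed.

Theorem gauss_equation y (nu : 'rV[R]_n) i j k l : D y -> jet2 G y ->
  (forall z, D z -> G z \in unitmx) ->
  Gh (F y) *m (\matrix_i dF y i)^T *m ginv G y *m (\matrix_i dF y i) *m Gh (F y)
    + Gh (F y) *m nu^T *m (nu *m Gh (F y)) = Gh (F y) ->
  riem G i j k l y =
  (\sum_a \sum_b \sum_c \sum_d riem Gh a b c d (F y)
     * dF y i 0 a * dF y j 0 b * dF y k 0 c * dF y l 0 d)
  + dot (Gh (F y)) (accel y i k) nu * dot (Gh (F y)) (accel y j l) nu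
  - dot (Gh (F y)) (accel y j k) nu * dot (Gh (F y)) (accel y i l) nu.
Proof.
move=> Dy jG unG cpl; have Ez := FDE Dy.
have sGy : \forall z \near y, (G z)^T = G z.
  near=> z; have Dz : D z by near: z; exact: open_nbhs_nbhs.
  apply/matrixP => a b; rewrite mxE !GE // !mxE; apply: dotC.
  by apply: sG; exact: FDE.
have uGy : \forall z \near y, G z \in unitmx.
  by near=> z; apply: unG; near: z; exact: open_nbhs_nbhs.
rewrite -rmformE //.
have PE : (fun a => partial a G y) = pull1 (Gh (F y)) (dG (F y)) (dF y) (ddF y).
  by apply/funext => a; rewrite partial_pullback.
have HE : (fun a b => partial a (partial b G) y) =
    pull2 (Gh (F y)) (dG (F y)) (ddG (F y)) (dF y) (ddF y) (dddF y).
  by apply/funext => a; apply/funext => b; rewrite partial2_pullback.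
have H := riemE jG sGy uGy i j k l; rewrite PE HE in H.
apply: etrans H _; apply: gauss_algebra cpl i j k l.
- exact: sG.
- by rewrite /ginv mulVmx // uG.
- by rewrite /ginv trmx_inv sG.
- by move=> c; exact: dG_sym.
- by move=> c d; exact: ddG_sym.
- by move=> c d; exact: ddG_sym2.
- by move=> a b; exact: dF_sym.
- by move=> a b c; exact: ddF_sym1.
- by move=> a b c; exact: ddF_sym2.
Unshelve. all: by end_near. Qed.

End Pullback.

(** * Conformally flat metrics *)

(* Kulkarni-Nomizu product. *)
Definition kn {R : comNzRingType} {n : nat} (P Q : 'M[R]_n) (i j k l : 'I_n) : R :=
  P i k * Q j l + P j l * Q i k - P i l * Q j k - P j k * Q i l.

Section ConformalAlgebra.
Context {R : realFieldType} {n : nat}.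
Variables (G Gi : 'M[R]_n) (T : 'I_n -> 'M[R]_n) (TT : 'I_n -> 'I_n -> 'M[R]_n).
Variables (s : R) (s1 : 'I_n -> R) (s2 : 'I_n -> 'I_n -> R).
Hypotheses (sG : G^T = G) (GK : G *m Gi = 1%:M) (sGi : Gi^T = Gi) (s0 : s != 0).
Hypotheses (sT : forall c, (T c)^T = T c) (ss2 : forall i j, s2 i j = s2 j i).

Definition conf1 k : 'M[R]_n := s1 k *: G + s *: T k.
Definition conf2 l k : 'M[R]_n :=
  s2 l k *: G + s1 k *: T l + s1 l *: T k + s *: TT l k.

Lemma conf2_sym l k : (forall i j, TT i j = TT j i) -> conf2 l k = conf2 k l.
Proof.
move=> sTT2; rewrite /conf2 ss2 sTT2; congr (_ + _).
by rewrite -!addrA; congr (_ + _); rewrite addrC.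
Qed.

Let sig : 'rV[R]_n := \row_k s1 k.

(** If [s = e^(2u)] and [s g] is flat, the Schouten tensor of [g] is Hess u - du du + |du|^2 g / 2.
    Substituting du = ds / (2 s) gives the coefficients 1/2, 3/4 and 1/8;
    [s2 - dot Gi (chr1 T i k) sig] is the Hessian of [s]. *)
Definition conf_schouten : 'M[R]_n := \matrix_(i, k)
  (- s^-1 * (- (2^-1 * s2 i k) + 2^-1 * dot Gi (chr1 T i k) sig
    + 3 / 4 / s * s1 i * s1 k - dot Gi sig sig / 8 / s * G i k)).

Lemma conf_schouten_sym : conf_schouten^T = conf_schouten.
Proof.
have sGe a b : G a b = G b a by rewrite -{1}sG mxE.
have sTe c a b : T c a b = T c b a by rewrite -{1}sT mxE.
have chrC i k : chr1 T k i = chr1 T i k.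
  by apply/rowP => a; rewrite !chr1E (sTe a k i); ring.
by apply/matrixP => i k; rewrite mxE !mxE ss2 chrC (sGe k i); ring.
Qed.

Lemma conf_chr1 i j : chr1 conf1 i j = s *: chr1 T i j +
  2^-1 *: (s1 i *: row j G + s1 j *: row i G - G i j *: sig).
Proof.
by apply/rowP => k; rewrite chr1E !mxE; ring.
Qed.

Theorem conformal_algebra i j k l :
  riem_form (s^-1 *: Gi) conf1 conf2 i j k l = 0 ->
  riem_form Gi T TT i j k l =
  kn conf_schouten G i j k l.
Proof.
have cg a b : dot Gi a (row b G) = a 0 b.
  have -> : row b G = delta_mx 0 b *m G by rewrite rowE.
  by rewrite /dot trmx_mul sG mulmxA -[a *m Gi *m G]mulmxA (mulmx1C GK) mulmx1
    trmx_delta -colE mxE.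
have gc a b : dot Gi (row b G) a = a 0 b by rewrite (@dotC R n).
have sGe a b : G a b = G b a by rewrite -{1}sG mxE.
have sTe c a b : T c a b = T c b a by rewrite -{1}sT mxE.
have rowE' a b : row a G 0 b = G a b by rewrite mxE.
have sigE a : sig 0 a = s1 a by rewrite mxE.
have lin := (@dotDl R n, @dotDr R n, @dotZl R n, @dotZr R n, @dotBZ R n,
  @dotNl R n, @dotNr R n).
have E a b c d : dot (s^-1 *: Gi) (chr1 conf1 a b) (chr1 conf1 c d) =
  s * dot Gi (chr1 T a b) (chr1 T c d)
  + 2^-1 * (s1 c * chr1 T a b 0 d + s1 d * chr1 T a b 0 c
            - G c d * dot Gi (chr1 T a b) sig)
  + 2^-1 * (s1 a * chr1 T c d 0 b + s1 b * chr1 T c d 0 a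
            - G a b * dot Gi (chr1 T c d) sig)
  + (4 * s)^-1 * (s1 a * s1 c * G b d + s1 a * s1 d * G b c
      - 2 * G c d * s1 a * s1 b + s1 b * s1 c * G a d + s1 b * s1 d * G a c
      - 2 * G a b * s1 c * s1 d + G a b * G c d * dot Gi sig sig).
  rewrite !conf_chr1 !lin !cg !gc !rowE' !sigE (@dotC R n Gi sig (chr1 T c d) sGi).
  by field.
rewrite /riem_form !E /kn !mxE; clear E.
move: (dot Gi sig sig) => N.
move: (dot Gi (chr1 T i k) (chr1 T j l)) (dot Gi (chr1 T j k) (chr1 T i l)) => X Y.
move: (dot Gi (chr1 T i k) sig) (dot Gi (chr1 T j k) sig)
  (dot Gi (chr1 T j l) sig) (dot Gi (chr1 T i l) sig) => qik qjk qjl qil.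
rewrite ?(sGe j i) ?(sGe k i) ?(sGe l i) ?(sGe k j) ?(sGe l j) ?(sGe l k).
rewrite ?(fun a => sTe a j i) ?(fun a => sTe a k i) ?(fun a => sTe a l i)
  ?(fun a => sTe a k j) ?(fun a => sTe a l j) ?(fun a => sTe a l k).
(* The identity left to [field] is the transformation law: the curvature of [s g] equals [s] times
   the difference between the curvature of [g] and [kn conf_schouten G]. *)
move=> H0; apply/(mulfI s0)/eqP; rewrite -subr_eq0 -[X in _ == X]H0; apply/eqP.
by field.
Qed.

End ConformalAlgebra.

Section Conformal.
Context {R : realType} {n : nat}.
Variables (G : 'rV[R]_n -> 'M[R]_n) (v : 'rV[R]_n -> R) (D : set 'rV[R]_n).
Hypotheses (oD : open D) (CG : Ck 2 D G) (Cv : Ck 2 D v).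
Hypotheses (sG : forall z, D z -> (G z)^T = G z)
  (uG : forall z, D z -> G z \in unitmx).

Let s y := expR (2 * v y).
Let s1 y k := 2 * (s y * partial k v y).
Let s2 y l k := 2 * (s1 y l * partial k v y + s y * partial l (partial k v) y).
Let H y : 'M[R]_n := s y *: G y.

Let is_derive_s y k : D y -> is_derive y (delta_mx 0 k) s (s1 y k).
Proof.
move=> Dy; have dv : differentiable v y by have [+ _] := Cv; apply.
have dv2 : is_derive y (delta_mx 0 k) (fun y => 2 * v y) (2 * partial k v y).
  apply: is_derive_eq (is_derive_mul (is_derive_cst _ _ _) (derivableP _)) _.
    exact: diff_derivable.
  by rewrite mul0r add0r.
have dd : differentiable (fun y => 2 * v y) y.
  by apply: differentiableM => //; exact: differentiable_cst.
have de : differentiable (@expR R) (2 * v y) by apply/derivable1_diffP.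
apply: is_derive_eq (is_derive_chain (delta_mx 0 k) dd de) _.
rewrite (@derive_val _ _ _ _ _ _ _ dv2).
have -> : 2 * partial k v y = (2 * partial k v y) *: (1 : R) by rewrite /GRing.scale /= mulr1.
rewrite (deriveZv _ _ de) (@derive_val _ _ _ _ _ _ _ (is_derive_expR _)) /s1 /s.
by rewrite -mulrA [partial k v y * _]mulrC.
Qed.

Let is_derive_s1 y l k : D y -> is_derive y (delta_mx 0 l) (s1 ^~ k) (s2 y l k).
Proof.
move=> Dy; have d2v : differentiable (partial k v) y.
  by have [_ /(_ (delta_mx 0 k)) [+ _]] := Cv; apply.
apply: is_derive_eq (is_derive_mul (is_derive_cst _ _ _) (is_derive_mul
  (is_derive_s _ Dy) (derivableP (diff_derivable d2v)))) _.
by rewrite mul0r add0r.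
Qed.

Let is_derive_H y k : D y ->
  is_derive y (delta_mx 0 k) H (conf1 (G y) (fun a => partial a G y) (s y) (s1 y) k).
Proof.
move=> Dy; apply: is_derive_scalemx (is_derive_s _ Dy) (derivableP _).
by apply: diff_derivable; have [+ _] := CG; apply.
Qed.

Let is_derive_dH y l k : D y ->
  is_derive y (delta_mx 0 l)
    (fun y => conf1 (G y) (fun a => partial a G y) (s y) (s1 y) k)
    (conf2 (G y) (fun a => partial a G y) (fun a b => partial a (partial b G) y)
      (s y) (s1 y) (s2 y) l k).
Proof.
move=> Dy; have dG : differentiable G y by have [+ _] := CG; apply.
have d2G : differentiable (partial k G) y.
  by have [_ /(_ (delta_mx 0 k)) [+ _]] := CG; apply.
rewrite /conf1 /conf2 -addrA; apply: is_deriveD.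
  apply: is_derive_scalemx (is_derive_s1 _ _ Dy) (derivableP _).
  exact: diff_derivable.
apply: is_derive_scalemx (is_derive_s _ Dy) (derivableP _).
exact: diff_derivable.
Qed.

Let partial_H y k : D y -> partial k H y =
  conf1 (G y) (fun a => partial a G y) (s y) (s1 y) k.
Proof. by move=> Dy; have [_ <-] := is_derive_H k Dy. Qed.

Let partial2_H y l k : D y -> partial l (partial k H) y =
  conf2 (G y) (fun a => partial a G y) (fun a b => partial a (partial b G) y)
      (s y) (s1 y) (s2 y) l k.
Proof.
move=> Dy; have [_ <-] := is_derive_dH l k Dy; apply: near_eq_derive.
by near=> z; apply: partial_H; near: z; exact: open_nbhs_nbhs.
Unshelve. all: by end_near. Qed.

Theorem conformally_flat_riem x : D x ->
  (forall i j k l, riem (fun y => expR (2 * v y) *: G y) i j k l x = 0) ->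
  exists2 P : 'M[R]_n, P^T = P & forall i j k l, riem G i j k l x = kn P (G x) i j k l.
Proof.
move=> Dx flat.
have jG : jet2 G x by exact: Ck_jet2 oD Dx CG.
have sGx : \forall z \near x, (G z)^T = G z.
  by near=> z; apply: sG; near: z; exact: open_nbhs_nbhs.
have uGx : \forall z \near x, G z \in unitmx.
  by near=> z; apply: uG; near: z; exact: open_nbhs_nbhs.
have s0 y : s y != 0 by rewrite gt_eqF // expR_gt0.
have s2C l k : s2 x l k = s2 x k l.
  have sv : partial l (partial k v) x = partial k (partial l v) x.
    exact: schwarz_scalar oD Dx Cv.
  rewrite /s2 sv /s1; generalize (partial k (partial l v) x) => c.
  by generalize (partial l v x), (partial k v x), (s x) => a b d; ring.
have P2 : (fun a b => partial a (partial b H) x) =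
  conf2 (G x) (fun a => partial a G x) (fun a b => partial a (partial b G) x)
      (s x) (s1 x) (s2 x).
  by apply/funext => a; apply/funext => b; rewrite partial2_H.
have P1 : (fun a => partial a H x) =
  conf1 (G x) (fun a => partial a G x) (s x) (s1 x).
  by apply/funext => a; rewrite partial_H.
have GGC l k : partial l (partial k G) x = partial k (partial l G) x.
  by have [_ _ ->] := jG.
(* Read off from the explicit derivatives of [s *: G], without establishing [Ck 2] for the
   exponential factor. *)
have jH : jet2 H x.
  split.
  - near=> y => i; have Dy : D y by near: y; exact: open_nbhs_nbhs.
    by have [] := is_derive_H i Dy.
  - move=> i j; have [+ _] := is_derive_dH j i Dx; apply: near_eq_derivable.
    by near=> y; rewrite partial_H //; near: y; exact: open_nbhs_nbhs.
  - move=> i j; apply: etrans (partial2_H i j Dx) _.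
    apply: etrans (esym (partial2_H j i Dx)); exact: conf2_sym.
have sH : \forall z \near x, (H z)^T = H z.
  near=> z; rewrite /H linearZ /=; congr (_ *: _); near: z; exact: sGx.
have uH : \forall z \near x, H z \in unitmx.
  near=> z; rewrite /H unitmxZ ?unitfE //; near: z; exact: uGx.
have dGs k : (partial k G x)^T = partial k G x.
  by apply/matrixP => a b; rewrite mxE (partial_sym jG sGx).
have Gx_unit := nbhs_singleton uGx; have sGxx := nbhs_singleton sGx.
exists (conf_schouten (G x) (ginv G x) (fun a => partial a G x) (s x) (s1 x) (s2 x)).
  exact: conf_schouten_sym.
move=> i j k l; have E := riemE jG sGx uGx i j k l.
apply: etrans E _; apply: conformal_algebra => //.
- by rewrite /ginv mulmxV.
- by rewrite /ginv trmx_inv sGxx.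
- have EH := riemE jH sH uH i j k l; rewrite P1 P2 in EH.
  have gH : ginv H x = (s x)^-1 *: ginv G x.
    by rewrite /ginv /H invmxZ //; exact: nbhs_singleton uH.
  by rewrite gH in EH; rewrite -EH; exact: flat.
Unshelve. all: by end_near. Qed.

End Conformal.

(** * Simultaneous diagonalization *)

Section Spectral.
Context {R : rcfType}.

Lemma sqnorm_ge0 n (u : 'rV[R]_n) : 0 <= (u *m u^T) 0 0.
Proof. by rewrite mxE sumr_ge0 // => i _; rewrite mxE -expr2 sqr_ge0. Qed.

Lemma sqnorm_eq0 n (u : 'rV[R]_n) : (u *m u^T) 0 0 = 0 -> u = 0.
Proof.
rewrite mxE => /eqP; rewrite psumr_eq0; last first.
  by move=> i _; rewrite mxE -expr2 sqr_ge0.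
move=> /allP u0; apply/rowP => i; rewrite mxE.
have := u0 i; rewrite mem_index_enum mxE -expr2 sqrf_eq0 => /(_ isT) /eqP.
exact.
Qed.

(** A complex eigenvector x + i y with eigenvalue a + i b exists over the algebraic closure.
    Symmetry of [A] forces b (|x|^2 + |y|^2) = 0, hence b = 0, and whichever of x and y is nonzero
    is a real eigenvector. *)
Lemma symmetric_eigenvector n (A : 'M[R]_n.+1) : A^T = A ->
  exists (a : R) (u : 'rV[R]_n.+1), u != 0 /\ u *m A = a *: u.
Proof.
move=> sA; pose C : numClosedFieldType := complex.complex R.
pose cA : 'M[C]_n.+1 := map_mx (@complex.real_complex R) A.
have [z zroot] : exists z, root (char_poly cA) z.
  by apply/closed_rootP; rewrite size_char_poly.
have := zroot; rewrite -eigenvalue_root_char => /eigenvalueP [v vE vn0].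
pose x := map_mx (@complex.Re R) v; pose y := map_mx (@complex.Im R) v.
pose a := complex.Re z; pose b := complex.Im z.
have ReM (c : C) (r : R) : complex.Re (c * complex.real_complex R r) = complex.Re c * r.
  by case: c => c1 c2 /=; rewrite mulr0 subr0.
have ImM (c : C) (r : R) : complex.Im (c * complex.real_complex R r) = complex.Im c * r.
  by case: c => c1 c2 /=; rewrite mulr0 add0r.
have ReMM (c d : C) : complex.Re (c * d) =
    complex.Re c * complex.Re d - complex.Im c * complex.Im d.
  by case: c => ? ?; case: d.
have ImMM (c d : C) : complex.Im (c * d) =
    complex.Re c * complex.Im d + complex.Im c * complex.Re d.
  by case: c => ? ?; case: d.
have xE : x *m A = a *: x - b *: y.
  apply/rowP => j; have /rowP/(_ j)/(congr1 (@complex.Re R)) := vE.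
  rewrite !mxE ReMM raddf_sum /= => <-.
  by apply: eq_bigr => k _; rewrite !mxE ReM.
have yE : y *m A = b *: x + a *: y.
  apply/rowP => j; have /rowP/(_ j)/(congr1 (@complex.Im R)) := vE.
  rewrite !mxE ImMM raddf_sum /= => E; rewrite [RHS]addrC -E.
  by apply: eq_bigr => k _; rewrite !mxE ImM.
have b0 : b * ((x *m x^T) 0 0 + (y *m y^T) 0 0) = 0.
  have E : (x *m A *m y^T) 0 0 = (y *m A *m x^T) 0 0.
    by rewrite -[x *m A *m y^T]trmxK mxE !trmx_mul trmxK sA mulmxA.
  have xy : (x *m y^T) 0 0 = (y *m x^T) 0 0.
    by rewrite -[x *m y^T]trmxK mxE !trmx_mul trmxK.
  have dE (p q : 'rV[R]_n.+1) : (p *m q^T) 0 0 = dot 1%:M p q by rewrite /dot mulmx1.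
  have := E; rewrite xE yE !dE (@dotDl R n.+1) (@dotDl R n.+1) (@dotNl R n.+1) !(@dotZl R n.+1).
  rewrite -!dE xy !dE.
  have key (p q r : R) : a * r - b * q = b * p + a * r -> b * (p + q) = 0.
    by move=> K; rewrite -[RHS](subrr (b * p + a * r)) -[X in _ - X]K; ring.
  exact: key.
have b0' : b = 0 \/ (x = 0 /\ y = 0).
  move/eqP: b0; rewrite mulf_eq0 => /orP[/eqP|]; first by left.
  rewrite paddr_eq0 ?sqnorm_ge0 // => /andP[/eqP/sqnorm_eq0 ? /eqP/sqnorm_eq0 ?].
  by right.
have xy0 : x != 0 \/ y != 0.
  have [x0|] := eqVneq x 0; last by left.
  have [y0|] := eqVneq y 0; last by right.
  case/negP: vn0; apply/eqP/rowP => j; rewrite mxE.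
  move/rowP/(_ j): x0; move/rowP/(_ j): y0; rewrite !mxE.
  by case: (v 0 j) => c d /= -> ->.
case: b0' => [b0'|[x0 y0]]; last by move: xy0; rewrite x0 y0 eqxx => -[].
case: xy0 => [x0|y0]; [exists a, x|exists a, y]; split=> //.
  by rewrite xE b0' scale0r subr0.
by rewrite yE b0' scale0r add0r.
Qed.

Lemma orthogonal_extension n (u : 'rV[R]_n.+1) : (u *m u^T) 0 0 = 1 ->
  exists H : 'M[R]_n.+1, H *m H^T = 1%:M /\ delta_mx 0 0 *m H = u.
Proof.
move=> u1; pose e : 'rV[R]_n.+1 := delta_mx 0 0; have [w wE] : exists w, w = u - e by exists (u - e).
(* The reflection below divides by the squared norm of [w]; when [u] is already the first basis
   vector the identity serves instead. *)
have [w0|wn0] := eqVneq w 0.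
  exists 1%:M; rewrite trmx1 !mulmx1; split=> //.
  by apply/esym/eqP; rewrite -subr_eq0 -wE; apply/eqP.
pose q := (w *m w^T) 0 0.
have q0 : q != 0 by apply: contraNneq wn0 => /sqnorm_eq0 ->.
have wwE : w *m w^T = q%:M by apply/matrixP => i j; rewrite !ord1 [RHS]mxE.
(* Householder reflection exchanging the first basis vector and u *)
pose H : 'M[R]_n.+1 := 1%:M - (2 / q) *: (w^T *m w).
have HT : H^T = H by rewrite linearB /= trmx1 linearZ /= trmx_mul trmxK.
exists H; split.
  have WW : w^T *m w *m (w^T *m w) = q *: (w^T *m w).
    by rewrite mulmxA -[w^T *m w *m w^T]mulmxA wwE mul_mx_scalar -scalemxAl.
  rewrite HT mulmxBl !mulmxBr !mul1mx !mulmx1 -!scalemxAl -!scalemxAr WW.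
  have -> : 2 / q *: (2 / q *: (q *: (w^T *m w))) =
      2 / q *: (w^T *m w) + 2 / q *: (w^T *m w).
    by rewrite !scalerA -scalerDl; congr (_ *: _); field.
  by rewrite opprB addrK subrK.
rewrite mulmxBr mulmx1 -scalemxAr mulmxA.
(* Both [e] and [u] are unit vectors, so |u - e|^2 = -2 <e, u - e>; the reflection therefore sends
   [e] to [e + w = u]. *)
have ew : (e *m w^T) 0 0 = - q / 2.
  have ee : (e *m e^T) 0 0 = 1 by rewrite /e trmx_delta mul_delta_mx mxE !eqxx.
  have eu : (u *m e^T) 0 0 = (e *m u^T) 0 0.
    by rewrite -[u *m e^T]trmxK mxE trmx_mul trmxK.
  have dE (x y : 'rV[R]_n.+1) : (x *m y^T) 0 0 = dot 1%:M x y by rewrite /dot mulmx1.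
  move: u1 ee eu; rewrite /q wE !dE !(@dotDr R n.+1) !(@dotDl R n.+1).
  by rewrite !(@dotNr R n.+1) !(@dotNl R n.+1) => -> -> ->; field.
have -> : e *m w^T = (- q / 2)%:M by apply/matrixP => i j; rewrite !ord1 ew [RHS]mxE.
rewrite mul_scalar_mx scalerA.
have -> : 2 / q * (- q / 2) = -1 by field.
by rewrite scaleN1r opprK wE addrC subrK.
Qed.

(** Deflation: once a unit eigenvector is the first vector of an orthonormal basis, symmetry clears
    both the first row and the first column, and the induction applies to the remaining block. *)
Theorem spectral n (A : 'M[R]_n) : A^T = A ->
  exists (Q : 'M[R]_n) (d : 'rV[R]_n), Q *m Q^T = 1%:M /\ Q *m A *m Q^T = diag_mx d.
Proof.
elim: n A => [|n IH] A sA.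
  exists 1%:M, 0; rewrite trmx1 !mulmx1; split=> //.
  by apply/matrixP => -[].
have [a [v [v0 vA]]] := symmetric_eigenvector sA.
pose N := (v *m v^T) 0 0.
have N0 : 0 < N.
  by rewrite lt_neqAle sqnorm_ge0 andbT eq_sym; apply: contraNneq v0 => /sqnorm_eq0 ->.
pose u := (Num.sqrt N)^-1 *: v.
have u1 : (u *m u^T) 0 0 = 1.
  rewrite /u linearZ /= -scalemxAl -scalemxAr scalerA mxE -/N -invfM.
  by rewrite -expr2 sqr_sqrtr ?ltW // mulVf // gt_eqF.
have uA : u *m A = a *: u by rewrite /u -scalemxAl vA !scalerA mulrC.
have [H [HH eH]] := orthogonal_extension u1.
have [B BE0] : exists B : 'M[R]_(1 + n), B = H *m A *m H^T by exists (H *m A *m H^T).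
have sB : B^T = B by rewrite BE0 !trmx_mul trmxK sA mulmxA.
have rowB : row 0 B = a *: delta_mx 0 0.
  by rewrite rowE BE0 !mulmxA eH uA -scalemxAl -eH -mulmxA HH mulmx1.
pose B' := drsubmx B.
have BE : B = block_mx a%:M 0 0 B'.
  have B0 j : B 0 (rshift 1 j) = 0.
    have /rowP/(_ (rshift 1 j)) := rowB; rewrite mxE => ->.
    by rewrite !mxE -val_eqE /= ?andbF mulr0.
  have ur : ursubmx B = 0.
    by apply/matrixP => i j; rewrite !mxE ord1 [X in B X _](_ : _ = 0) ?B0 //; apply/val_inj.
  have dl : dlsubmx B = 0 by rewrite -sB -trmx_ursub ur trmx0.
  rewrite -[LHS](submxK B) ur dl; congr (block_mx _ _ _ _).
  apply/matrixP => i j; rewrite !ord1 !mxE.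
  have /rowP/(_ 0) := rowB; rewrite mxE !mxE !eqxx mulr1 => <-.
  by congr (B _ _); apply/val_inj.
have [Q' [d [QQ' Qd]]] : exists (Q : 'M[R]_n) (d : 'rV[R]_n),
    Q *m Q^T = 1%:M /\ Q *m B' *m Q^T = diag_mx d.
  by apply: IH; rewrite trmx_drsub sB.
pose Q1 : 'M[R]_(1 + n) := block_mx 1%:M 0 0 Q'.
have Q1T : Q1^T = block_mx 1%:M 0 0 Q'^T by rewrite tr_block_mx !trmx0 trmx1.
have Q1Q1 : Q1 *m Q1^T = 1%:M.
  rewrite Q1T /Q1 mulmx_block !(mulmx0, mul0mx, mulmx1, addr0, add0r) QQ'.
  by rewrite -scalar_mx_block.
have Q1B : Q1 *m B *m Q1^T = diag_mx (row_mx a%:M d).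
  rewrite BE Q1T /Q1 !mulmx_block !(mulmx0, mul0mx, mulmx1, mul1mx, addr0, add0r).
  rewrite Qd diag_mx_row; congr block_mx.
  by apply/matrixP => i j; rewrite !ord1 !mxE eqxx /= !mulr1n.
exists (Q1 *m H), (row_mx a%:M d); split.
  by rewrite trmx_mul mulmxA -[Q1 *m H *m H^T]mulmxA HH mulmx1.
by rewrite trmx_mul -Q1B BE0 !mulmxA.
Qed.

(** Diagonalize [g], rescale it to the identity, then diagonalize the transformed [A] orthogonally.
    The rows of [E] form a g-orthonormal frame of principal directions when [A] is the second
    fundamental form. *)
Theorem simultaneous_diagonalization n (g A : 'M[R]_n) :
  g^T = g -> (forall v : 'rV[R]_n, v != 0 -> 0 < (v *m g *m v^T) 0 0) -> A^T = A ->
  exists (E : 'M[R]_n) (d : 'rV[R]_n),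
    E *m g *m E^T = 1%:M /\ E *m A *m E^T = diag_mx d.
Proof.
move=> sg pg sA; have [Q [d0 [QQ Qd]]] := spectral sg.
have row_neq0 i : (delta_mx 0 i : 'rV[R]_n) *m Q != 0.
  apply/eqP => /(congr1 (mulmx^~ Q^T)); rewrite -mulmxA QQ mulmx1 mul0mx.
  by move/rowP/(_ i)/eqP; rewrite !mxE !eqxx oner_eq0.
have d0p i : 0 < d0 0 i.
  have -> : d0 0 i = dot (Q *m g *m Q^T) (delta_mx 0 i) (delta_mx 0 i).
    by rewrite dot_delta Qd mxE eqxx.
  have -> : dot (Q *m g *m Q^T) (delta_mx 0 i) (delta_mx 0 i) =
      dot g (delta_mx 0 i *m Q) (delta_mx 0 i *m Q).
    by rewrite /dot trmx_mul !mulmxA.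
  exact: pg.
pose S : 'M[R]_n := diag_mx (\row_i (Num.sqrt (d0 0 i))^-1).
have ST : S^T = S by rewrite tr_diag_mx.
have SdS : S *m diag_mx d0 *m S = 1%:M.
  rewrite !mulmx_diag -diag_const_mx; congr diag_mx; apply/rowP => i.
  rewrite !mxE mulrAC -invfM -expr2 sqr_sqrtr ?ltW // mulVf //.
  by rewrite gt_eqF.
have [Q' [d [QQ' Qd']]] : exists (Q' : 'M[R]_n) (d : 'rV[R]_n),
    Q' *m Q'^T = 1%:M /\ Q' *m (S *m Q *m A *m Q^T *m S) *m Q'^T = diag_mx d.
  by apply: spectral; rewrite !trmx_mul !trmxK ST sA !mulmxA.
exists (Q' *m S *m Q), d; rewrite !trmx_mul ST; split.
  have -> : Q' *m S *m Q *m g *m (Q^T *m (S *m Q'^T)) =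
      Q' *m (S *m (Q *m g *m Q^T) *m S) *m Q'^T by rewrite !mulmxA.
  by rewrite Qd SdS mulmx1.
by rewrite -Qd' !mulmxA.
Qed.

End Spectral.

(** * The Weyl tensor of a hypersurface *)

Section WeylFormula.
Context {R : realType} {n : nat}.
Implicit Types (P Q S : 'M[R]_n).

(** Half of a Kulkarni-Nomizu product: symmetrizing in [P] and [Q] gives [kn], and [wedge A A] is
    the Gauss term. This half contracts to a matrix product and acts on two-forms as one. *)
Definition wedge P Q (i j k l : 'I_n) : R := P i k * Q j l - P i l * Q j k.

Lemma contract_scal S Q a : S^T = S ->
  \sum_j \sum_l S j l * (a * Q j l) = a * \tr (S *m Q).
Proof.
move=> sS; rewrite mulr_sumr exchange_big; apply: eq_bigr => l _.
rewrite mxE mulr_sumr; apply: eq_bigr => j _.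
by rewrite -{1}sS mxE mulrCA.
Qed.

Lemma contract_mx S P Q i k : S^T = S ->
  \sum_j \sum_l S j l * (P i l * Q j k) = (P *m S *m Q) i k.
Proof.
move=> sS; rewrite mxE; apply: eq_bigr => j _.
rewrite mxE mulr_suml; apply: eq_bigr => l _.
by rewrite -{1}sS mxE; ring.
Qed.

Lemma contract_wedge S P Q i k : S^T = S ->
  \sum_j \sum_l S j l * wedge P Q i j k l = \tr (S *m Q) * P i k - (P *m S *m Q) i k.
Proof.
move=> sS; rewrite -contract_mx // mulrC -contract_scal // -sumrB.
apply: eq_bigr => j _; rewrite -sumrB; apply: eq_bigr => l _.
by rewrite mulrBr.
Qed.

Lemma contract_trace S P : S^T = S ->
  \sum_i \sum_k S i k * P i k = \tr (S *m P).
Proof.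
by move=> sS; rewrite -[RHS]mul1r -contract_scal //; under [RHS]eq_bigr do under eq_bigr do rewrite mul1r.
Qed.

End WeylFormula.

(** With indices raised by [g], this is H A - A^2, the Ricci contraction of the Gauss term;
    [sff_scalar] is its trace, H^2 - |A|^2. *)
Definition sff_ricci {R : realType} (g A : 'M[R]_4) : 'M[R]_4 :=
  \tr (invmx g *m A) *: A - A *m invmx g *m A.

Definition sff_scalar {R : realType} (g A : 'M[R]_4) : R :=
  \tr (invmx g *m A) ^+ 2 - \tr (invmx g *m A *m invmx g *m A).

Section Weyl4.
Context {R : realType}.
Variables (G : 'rV[R]_4 -> 'M[R]_4) (x : 'rV[R]_4) (T A : 'M[R]_4).
Let g := G x.
Let S := invmx g.
Hypotheses (sg : g^T = g) (ug : g \in unitmx).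
Hypothesis riemTA : forall i j k l,
  riem G i j k l x = kn T g i j k l + wedge A A i j k l.

Let sS : S^T = S. Proof. by rewrite trmx_inv sg. Qed.

Lemma knE (P Q : 'M[R]_4) i j k l : kn P Q i j k l = wedge P Q i j k l + wedge Q P i j k l.
Proof. by rewrite /kn /wedge; ring. Qed.

Lemma ricciE i k :
  ricci G i k x = 2 * T i k + \tr (S *m T) * g i k + sff_ricci g A i k.
Proof.
rewrite /ricci -[ginv G x]/S.
transitivity (\sum_j \sum_l S j l * wedge T g i j k l +
  \sum_j \sum_l S j l * wedge g T i j k l + \sum_j \sum_l S j l * wedge A A i j k l).
  rewrite -!big_split; apply: eq_bigr => j _; rewrite -!big_split; apply: eq_bigr => l _ /=.
  by rewrite -!mulrDr -knE -riemTA.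
rewrite !contract_wedge //.
rewrite -mulmxA mulVmx // mulmxV // mulmx1 mul1mx mxtrace1 !mxE -/S.
by ring.
Qed.

Lemma scalarE : Defs.scalar G x = 6 * \tr (S *m T) + sff_scalar g A.
Proof.
rewrite /Defs.scalar -[ginv G x]/S.
transitivity (\sum_i \sum_k S i k * (2 * T i k) +
  \sum_i \sum_k S i k * (\tr (S *m T) * g i k) + \sum_i \sum_k S i k * sff_ricci g A i k).
  rewrite -!big_split; apply: eq_bigr => j _; rewrite -!big_split; apply: eq_bigr => l _ /=.
  by rewrite -!mulrDr -ricciE.
rewrite !contract_scal // contract_trace //.
rewrite mulVmx // mxtrace1 /sff_ricci -/S mulmxBr -scalemxAr linearB linearZ /=.
by rewrite /sff_scalar -/S !mulmxA expr2 /GRing.scale /=; ring.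
Qed.

(** [T] disappears: its contractions are 2 T + tr(T) g and 6 tr(T), and in dimension four the Weyl
    corrections, with factors 1/2 and 1/6, remove exactly [kn T g]. *)
Lemma weylE i j k l : weyl G i j k l x =
  wedge A A i j k l - 2^-1 * kn (sff_ricci g A) g i j k l + 6^-1 * sff_scalar g A * wedge g g i j k l.
Proof.
rewrite /weyl riemTA !ricciE scalarE /kn /wedge.
move: (sff_ricci g A) (sff_scalar g A) => B s.
by field.
Qed.

End Weyl4.

(** * The volume form and the Hodge star in a frame *)

Definition o0 : 'I_4 := @Ordinal 4 0 isT.
Definition o1 : 'I_4 := @Ordinal 4 1 isT.
Definition o2 : 'I_4 := @Ordinal 4 2 isT.
Definition o3 : 'I_4 := @Ordinal 4 3 isT.

Lemma ord4P (P : 'I_4 -> Prop) : P o0 -> P o1 -> P o2 -> P o3 -> forall i, P i.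
Proof.
move=> P0 P1 P2 P3 [[|[|[|[|//]]]] Hi].
- by rewrite (_ : Ordinal Hi = o0) //; apply/val_inj.
- by rewrite (_ : Ordinal Hi = o1) //; apply/val_inj.
- by rewrite (_ : Ordinal Hi = o2) //; apply/val_inj.
- by rewrite (_ : Ordinal Hi = o3) //; apply/val_inj.
Qed.

Lemma sum4E {V : nmodType} (F : 'I_4 -> V) : \sum_i F i = F o0 + F o1 + F o2 + F o3.
Proof.
rewrite !big_ord_recl big_ord0 addr0 !addrA.
by congr (F _ + F _ + F _ + F _); apply/val_inj.
Qed.

(* The pairs [o0], [qa r] and [qc r], [qd r] are complementary, numbered so that
   [o0], [qa r], [qc r], [qd r] is an even permutation. *)
Definition qa (r : 'I_3) : 'I_4 := tnth [tuple o1; o2; o3] r.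
Definition qc (r : 'I_3) : 'I_4 := tnth [tuple o2; o3; o1] r.
Definition qd (r : 'I_3) : 'I_4 := tnth [tuple o3; o1; o2] r.

Section Epsilon.
Context {R : fieldType}.

Definition rows4 (u v w z : 'rV[R]_4) : 'M[R]_4 :=
  \matrix_(a, b) (tnth [tuple u; v; w; z] a) 0 b.

Definition det4 u v w z : R := \det (rows4 u v w z).

Definition eps (i j k l : 'I_4) : R :=
  \det (\matrix_(a < 4, b < 4) (tnth [tuple i; j; k; l] a == b)%:R : 'M[R]_4).

Lemma eps_det4 i j k l :
  eps i j k l = det4 (delta_mx 0 i) (delta_mx 0 j) (delta_mx 0 k) (delta_mx 0 l).
Proof.
rewrite /eps /det4; congr (\det _); apply/matrixP => a b; rewrite !mxE.
by elim/ord4P: a => /=; rewrite /tnth /= !mxE eqxx eq_sym.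
Qed.

Lemma det4_lin (t : 'I_4) (u : 'I_4 -> 'rV[R]_4) a (v1 v2 : 'rV[R]_4) :
  let M v := \matrix_(i, j) (if i == t then v 0 j else u i 0 j) : 'M[R]_4 in
  \det (M (a *: v1 + v2)) = a * \det (M v1) + \det (M v2).
Proof.
move=> M; rewrite -[\det (M v2)]mul1r; apply: (determinant_multilinear (i0 := t)).
- by apply/rowP => j; rewrite !mxE eqxx mul1r.
- by apply/matrixP => i j; rewrite !mxE eq_sym (negPf (neq_lift _ _)).
- by apply/matrixP => i j; rewrite !mxE eq_sym (negPf (neq_lift _ _)).
Qed.

Lemma det4_lin_at (t : 'I_4) (f : 'rV[R]_4 -> 'M[R]_4) (u : 'I_4 -> 'rV[R]_4) :
  (forall v, f v = \matrix_(i, j) (if i == t then v 0 j else u i 0 j)) ->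
  lin1 (fun v => \det (f v)).
Proof. by move=> fE a v1 v2; rewrite !fE; exact: det4_lin. Qed.

Lemma det4_sum (u v w z : 'rV[R]_4) :
  \sum_i \sum_j \sum_k \sum_l eps i j k l * u 0 i * v 0 j * w 0 k * z 0 l =
  det4 u v w z.
Proof.
rewrite -(multilinear4 (T := det4)).
- apply: eq_bigr => i _; apply: eq_bigr => j _; apply: eq_bigr => k _.
  by apply: eq_bigr => l _; rewrite eps_det4.
- move=> v' w' z'; apply: (det4_lin_at (t := o0) (u := tnth [tuple 0; v'; w'; z'])).
  by move=> x; apply/matrixP => i j; rewrite !mxE; elim/ord4P: i.
- move=> v' w' z'; apply: (det4_lin_at (t := o1) (u := tnth [tuple v'; 0; w'; z'])).
  by move=> x; apply/matrixP => i j; rewrite !mxE; elim/ord4P: i.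
- move=> v' w' z'; apply: (det4_lin_at (t := o2) (u := tnth [tuple v'; w'; 0; z'])).
  by move=> x; apply/matrixP => i j; rewrite !mxE; elim/ord4P: i.
- move=> v' w' z'; apply: (det4_lin_at (t := o3) (u := tnth [tuple v'; w'; z'; 0])).
  by move=> x; apply/matrixP => i j; rewrite !mxE; elim/ord4P: i.
Qed.

(** Both sides are the determinant of the matrix formed by the rows a, b, c, d of [E]. *)
Lemma eps_frame (E : 'M[R]_4) a b c d :
  \sum_i \sum_j \sum_k \sum_l eps i j k l * E a i * E b j * E c k * E d l =
  \det E * eps a b c d.
Proof.
transitivity (det4 (row a E) (row b E) (row c E) (row d E)).
  rewrite -det4_sum; apply: eq_bigr => i _; apply: eq_bigr => j _.
  by apply: eq_bigr => k _; apply: eq_bigr => l _; rewrite !mxE.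
rewrite /eps mulrC -det_mulmx; congr (\det _); apply/matrixP => s t.
rewrite !mxE (bigD1 (tnth [tuple a; b; c; d] s)) //= big1 => [|k /negPf kn].
  by rewrite mxE addr0; elim/ord4P: s; rewrite /tnth /= mxE eqxx mul1r.
by rewrite mxE eq_sym kn mul0r.
Qed.

Lemma eps_swap (s t : 'I_4) i j k l i' j' k' l' : s != t ->
  (forall a, tnth [tuple i'; j'; k'; l'] a = tnth [tuple i; j; k; l] (tperm s t a)) ->
  eps i' j' k' l' = - eps i j k l.
Proof.
move=> st H; rewrite /eps -mulN1r -[-1]expr1 -[X in _ ^+ X]/(nat_of_bool true) -st.
rewrite -odd_tperm -det_perm -det_mulmx -row_permE; congr (\det _).
by apply/matrixP => a b; rewrite !mxE H.
Qed.

Lemma eps_alt (s t : 'I_4) i j k l : s != t ->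
  tnth [tuple i; j; k; l] s = tnth [tuple i; j; k; l] t -> eps i j k l = 0.
Proof.
by move=> st H; apply: (determinant_alternate st) => b; rewrite !mxE H.
Qed.

Lemma eps_id : eps o0 o1 o2 o3 = 1.
Proof.
rewrite -(det1 R 4) /eps; congr (\det _); apply/matrixP => a b; rewrite !mxE.
by elim/ord4P: a.
Qed.

Lemma eps_swap23 i j k l : eps i j l k = - eps i j k l.
Proof.
apply: (@eps_swap o2 o3) => //; apply: ord4P; rewrite ?tpermL ?tpermR //.
  by rewrite tpermD.
by rewrite tpermD.
Qed.

Lemma eps_swap12 i j k l : eps i k j l = - eps i j k l.
Proof.
apply: (@eps_swap o1 o2) => //; apply: ord4P; rewrite ?tpermL ?tpermR //.
  by rewrite tpermD.
by rewrite tpermD.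
Qed.

Lemma eps_swap01 i j k l : eps j i k l = - eps i j k l.
Proof.
apply: (@eps_swap o0 o1) => //; apply: ord4P; rewrite ?tpermL ?tpermR //.
  by rewrite tpermD.
by rewrite tpermD.
Qed.

(** The Hodge star in an orthonormal frame, up to the orientation sign of that frame; the sign is
    accounted for in [form_act_vol]. *)
Definition star (w : 'M[R]_4) : 'M[R]_4 :=
  \matrix_(a, b) (2^-1 * \sum_c \sum_d eps a b c d * w c d).

End Epsilon.

(** * Self-dual and anti-self-dual two-forms of an orthonormal frame *)

Section Star.
Context {R : realFieldType}.
Implicit Types (w : 'M[R]_4).

Definition wdg (i j : 'I_4) : 'M[R]_4 := delta_mx i j - delta_mx j i.

(** For [tau] equal to 1 or -1, the standard basis of the eigenspace of [star] for [tau]. The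
    numbering by [qa], [qc], [qd] makes the sign the same for all three forms. *)
Definition sdbasis (tau : R) (r : 'I_3) : 'M[R]_4 :=
  wdg o0 (qa r) + tau *: wdg (qc r) (qd r).

Definition t0 : 'I_3 := @Ordinal 3 0 isT.
Definition t1 : 'I_3 := @Ordinal 3 1 isT.
Definition t2 : 'I_3 := @Ordinal 3 2 isT.

Lemma ord3P (P : 'I_3 -> Prop) : P t0 -> P t1 -> P t2 -> forall i, P i.
Proof.
move=> P0 P1 P2 [[|[|[|//]]] Hi].
- by rewrite (_ : Ordinal Hi = t0) //; apply/val_inj.
- by rewrite (_ : Ordinal Hi = t1) //; apply/val_inj.
- by rewrite (_ : Ordinal Hi = t2) //; apply/val_inj.
Qed.

Lemma sum3E {V : nmodType} (F : 'I_3 -> V) : \sum_i F i = F t0 + F t1 + F t2.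
Proof.
rewrite !big_ord_recl big_ord0 addr0 !addrA.
by congr (F _ + F _ + F _); apply/val_inj.
Qed.

Lemma star_pair w r : w^T = - w ->
  star w o0 (qa r) = w (qc r) (qd r) /\ star w (qc r) (qd r) = w o0 (qa r).
Proof.
move=> aw; have aij i j : w i j = - w j i.
  by have /matrixP/(_ j i) := aw; rewrite !mxE.
have e0 := @eps_id R.
have e1 : eps o0 o2 o3 o1 = 1 :> R.
  by rewrite eps_swap23 eps_swap12 eps_id opprK.
have e2 : eps o0 o3 o1 o2 = 1 :> R.
  by rewrite eps_swap12 eps_swap23 eps_id opprK.
(* The second premise says that a, b, c, d exhaust the indices. Only the terms (c, d) and (d, c)
   survive in the double sum; they are equal by antisymmetry and absorb the factor 1/2. *)
have key a b c d : eps a b c d = 1 :> R ->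
    (forall F : 'I_4 -> R, \sum_i F i = F a + F b + F c + F d) ->
    star w a b = w c d /\ star w c d = w a b.
  move=> e S.
  have alt01 i j k : eps i i j k = 0 :> R by apply: (eps_alt (s := o0) (t := o1)).
  have alt02 i j k : eps i j i k = 0 :> R by apply: (eps_alt (s := o0) (t := o2)).
  have alt03 i j k : eps i j k i = 0 :> R by apply: (eps_alt (s := o0) (t := o3)).
  have alt12 i j k : eps i j j k = 0 :> R by apply: (eps_alt (s := o1) (t := o2)).
  have alt13 i j k : eps i j k j = 0 :> R by apply: (eps_alt (s := o1) (t := o3)).
  have alt23 i j k : eps i j k k = 0 :> R by apply: (eps_alt (s := o2) (t := o3)).
  have edc : eps a b d c = -1 :> R by rewrite eps_swap23 e.
  have ecd : eps c d a b = 1 :> R.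
    rewrite eps_swap12 eps_swap01 opprK eps_swap23 eps_swap12 opprK.
    by [].
  have ecd' : eps c d b a = -1 :> R by rewrite eps_swap23 ecd.
  split; rewrite mxE !S !(alt01, alt02, alt03, alt12, alt13, alt23).
    by rewrite e edc (aij d c); field.
  by rewrite ecd ecd' (aij b a); field.
elim/ord3P: r; rewrite /qa /qc /qd /tnth /=.
- by apply: key => // F; rewrite sum4E.
- by apply: key => // F; rewrite sum4E; ring.
- by apply: key => // F; rewrite sum4E; ring.
Qed.

Lemma selfdual_decomp tau w : tau * tau = 1 -> w^T = - w -> star w = tau *: w ->
  w = \sum_r w o0 (qa r) *: sdbasis tau r.
Proof.
move=> tt aw sw; have aij i j : w i j = - w j i.
  by have /matrixP/(_ j i) := aw; rewrite !mxE.
have aii i : w i i = 0.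
  by have := aij i i => /eqP; rewrite -subr_eq0 opprK -mulr2n mulrn_eq0 => /eqP.
have cd r : w (qc r) (qd r) = tau * w o0 (qa r).
  by have [<- _] := star_pair r aw; rewrite sw mxE.
have c0 := cd t0; have c1 := cd t1; have c2 := cd t2.
move: c0 c1 c2; rewrite /qa /qc /qd /tnth /= => c0 c1 c2.
apply/matrixP => i j; rewrite sum3E /sdbasis /wdg /qa /qc /qd /tnth /= !mxE.
move: i j; apply: ord4P; apply: ord4P; rewrite /= ?aii;
  rewrite ?(aij o1 o0) ?(aij o2 o0) ?(aij o3 o0) ?c0 ?c1 ?c2
   ?(aij o2 o1) ?(aij o3 o2) ?(aij o1 o3) ?c0 ?c1 ?c2; ring.
Qed.

End Star.

Section SdBasis.
Context {R : realFieldType}.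
Variable tau : R.

Lemma sdbasis_anti r : (sdbasis tau r)^T = - sdbasis tau r.
Proof.
have W i j : (wdg i j : 'M[R]_4)^T = - wdg i j.
  by rewrite /wdg linearB /= !trmx_delta opprB.
apply/matrixP => i j; have Wij (a b : 'I_4) : wdg a b j i = - wdg a b i j :> R.
  by have /matrixP/(_ i j) := W a b; rewrite [LHS]mxE [in RHS]mxE.
rewrite mxE /sdbasis [LHS]mxE [in RHS]mxE [in RHS]mxE ![((_ *: _ : 'M[R]_4) _ _)]mxE.
rewrite !Wij; ring.
Qed.

Lemma sdbasis_coord r s : sdbasis tau r o0 (qa s) = (s == r)%:R.
Proof.
rewrite /sdbasis /wdg !mxE; elim/ord3P: r; elim/ord3P: s;
  rewrite /qa /qc /qd /tnth /=; ring.
Qed.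

Lemma sdbasis_coord' r s : sdbasis tau r (qc s) (qd s) = tau * (s == r)%:R.
Proof.
rewrite /sdbasis /wdg !mxE; elim/ord3P: r; elim/ord3P: s;
  rewrite /qa /qc /qd /tnth /=; ring.
Qed.

(** The three complementary pairs account for all six independent entries of an antisymmetric matrix
    of size four. *)
Lemma anti_ext (v w : 'M[R]_4) : v^T = - v -> w^T = - w ->
  (forall r, v o0 (qa r) = w o0 (qa r)) ->
  (forall r, v (qc r) (qd r) = w (qc r) (qd r)) -> v = w.
Proof.
move=> av aw H0 H1.
have vij i j : v i j = - v j i by have /matrixP/(_ j i) := av; rewrite !mxE.
have wij i j : w i j = - w j i by have /matrixP/(_ j i) := aw; rewrite !mxE.
have ii (u : 'M[R]_4) i : u i i = - u i i -> u i i = 0.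
  by move=> /eqP; rewrite -subr_eq0 opprK -mulr2n mulrn_eq0 => /eqP.
have := H0 t0; have := H0 t1; have := H0 t2; have := H1 t0; have := H1 t1; have := H1 t2.
rewrite /qa /qc /qd /tnth /= => h1 h2 h3 h4 h5 h6.
apply/matrixP; apply: ord4P; apply: ord4P;
  rewrite ?(ii _ _ (vij _ _)) ?(ii _ _ (wij _ _)) //;
  by rewrite vij wij; congr (- _).
Qed.

Lemma star_anti (w : 'M[R]_4) : (star w)^T = - star w.
Proof.
apply/matrixP => i j; rewrite !mxE -mulrN -sumrN; congr (_ * _).
apply: eq_bigr => k _; rewrite -sumrN; apply: eq_bigr => l _.
by rewrite eps_swap01 mulNr.
Qed.

Lemma star_sdbasis r : tau * tau = 1 -> star (sdbasis tau r) = tau *: sdbasis tau r.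
Proof.
move=> tt; have a := sdbasis_anti r.
apply: anti_ext; first exact: star_anti.
- by rewrite linearZ /= a scalerN.
- move=> s; have [-> _] := star_pair s a.
  by rewrite [RHS]mxE sdbasis_coord sdbasis_coord'.
- move=> s; have [_ ->] := star_pair s a.
  by rewrite [RHS]mxE sdbasis_coord sdbasis_coord' mulrA tt mul1r.
Qed.

End SdBasis.

(** * Passage from chart components to frame components *)

Lemma exchange_inner {V : nmodType} {I J K : finType} (F : I -> J -> K -> V) :
  \sum_i \sum_j \sum_k F i j k = \sum_k \sum_i \sum_j F i j k.
Proof. by under eq_bigr do rewrite exchange_big; rewrite exchange_big. Qed.

Section Frame.
Context {R : realType}.
Variables (g E A : 'M[R]_4) (d : 'rV[R]_4).
Hypotheses (sg : g^T = g) (EgE : E *m g *m E^T = 1%:M) (EAE : E *m A *m E^T = diag_mx d).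

(** The rows of [E] are the frame vectors, so this evaluates a two-form on pairs of them. Since [E]
    has inverse [g *m E^T], [offr] is the inverse change of components. *)
Definition tofr (w : 'M[R]_4) := E *m w *m E^T.
Definition offr (w : 'M[R]_4) := g *m E^T *m w *m E *m g.

Let ED : E *m (g *m E^T) = 1%:M. Proof. by rewrite mulmxA. Qed.
Let DE : g *m E^T *m E = 1%:M. Proof. exact: mulmx1C ED. Qed.
Let DE' : E^T *m E *m g = 1%:M. Proof. by apply: mulmx1C; rewrite mulmxA. Qed.

Lemma frame_inv : invmx g = E^T *m E.
Proof.
have gu : g \in unitmx by case/mulmx1_unit: DE'.
by rewrite -[RHS]mulmx1 -(mulmxV gu) mulmxA DE' mul1mx.
Qed.

Lemma offrK w : tofr (offr w) = w.
Proof.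
have -> : tofr (offr w) = (E *m g *m E^T) *m w *m (E *m g *m E^T).
  by rewrite /tofr /offr !mulmxA.
by rewrite EgE mul1mx mulmx1.
Qed.

Lemma tofrK w : offr (tofr w) = w.
Proof.
have -> : offr (tofr w) = (g *m E^T *m E) *m w *m (E^T *m E *m g).
  by rewrite /tofr /offr !mulmxA.
by rewrite DE DE' mul1mx mulmx1.
Qed.

Lemma tofr_inj : injective tofr.
Proof. exact: can_inj tofrK. Qed.

Lemma tofr_tr w : tofr w^T = (tofr w)^T.
Proof. by rewrite /tofr !trmx_mul trmxK mulmxA. Qed.

Lemma tofrD v w : tofr (v + w) = tofr v + tofr w.
Proof. by rewrite /tofr mulmxDr mulmxDl. Qed.

Lemma tofrN w : tofr (- w) = - tofr w.
Proof. by rewrite /tofr mulmxN mulNmx. Qed.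

Lemma tofrZ a w : tofr (a *: w) = a *: tofr w.
Proof. by rewrite /tofr -scalemxAr -scalemxAl. Qed.

Lemma tofr_sum I (r : seq I) (P : pred I) (F : I -> 'M[R]_4) :
  tofr (\sum_(i <- r | P i) F i) = \sum_(i <- r | P i) tofr (F i).
Proof. by rewrite /tofr mulmx_sumr mulmx_suml. Qed.

Lemma raise_tofr w : invmx g *m w *m (invmx g)^T = E^T *m tofr w *m E.
Proof. by rewrite frame_inv trmx_mul trmxK /tofr !mulmxA. Qed.

(** For antisymmetric [w] the two terms of [wedge] contribute equally, which absorbs the factor 1/2;
    raising indices is trivial in an orthonormal frame. *)
Lemma form_act_wedge (P Q w : 'M[R]_4) : P^T = P -> Q^T = Q -> w^T = - w ->
  tofr (form_act g (wedge P Q) w) = tofr P *m tofr w *m tofr Q.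
Proof.
move=> sP sQ aw.
have -> : form_act g (wedge P Q) w = P *m (E^T *m tofr w *m E) *m Q.
  rewrite -raise_tofr; set W := invmx g *m w *m (invmx g)^T.
  have aW : W^T = - W.
    by rewrite /W !trmx_mul trmxK aw mulNmx mulmxN mulmxA.
  have sQe a b : Q a b = Q b a by rewrite -{1}sQ mxE.
  apply/matrixP => i j.
  have PWQ : \sum_k \sum_l P i k * Q j l * W k l = (P *m W *m Q) i j.
    rewrite mxE exchange_big; apply: eq_bigr => l _ /=.
    rewrite mxE mulr_suml; apply: eq_bigr => k _.
    by rewrite (sQe j l); ring.
  have PWQ' : \sum_k \sum_l P i l * Q j k * W k l = - (P *m W *m Q) i j.
    rewrite -PWQ -sumrN exchange_big; apply: eq_bigr => l _ /=.
    rewrite -sumrN; apply: eq_bigr => k _.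
    by have /matrixP/(_ l k) := aW; rewrite !mxE => ->; rewrite mulrN.
  rewrite mxE; under eq_bigr do under eq_bigr do rewrite /wedge mulrBl.
  under eq_bigr do rewrite sumrB.
  by rewrite sumrB PWQ PWQ'; field.
by rewrite /tofr !mulmxA.
Qed.

Lemma form_act_lin (a b : R) (S T : 'I_4 -> 'I_4 -> 'I_4 -> 'I_4 -> R) w :
  form_act g (fun i j k l => a * S i j k l + b * T i j k l) w =
  a *: form_act g S w + b *: form_act g T w.
Proof.
apply/matrixP => i j; rewrite !mxE !(mulrCA _ 2^-1) -mulrDr; congr (_ * _).
rewrite !mulr_sumr -big_split; apply: eq_bigr => k _ /=.
rewrite !mulr_sumr -big_split; apply: eq_bigr => l _ /=.
by rewrite mulrDl !mulrA.
Qed.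

Lemma eq_form_act S T w : (forall i j k l, S i j k l = T i j k l) ->
  form_act g S w = form_act g T w.
Proof.
move=> H; apply/matrixP => i j; rewrite !mxE; congr (_ * _).
by apply: eq_bigr => k _; apply: eq_bigr => l _; rewrite H.
Qed.

(** The scalar is the orientation sign of the frame: its square is 1 because det(E)^2 det(g) = 1.
    The proof expands everything into a sixfold sum in which [eps_frame] can be recognized. *)
Lemma form_act_vol (o : bool) w :
  tofr (form_act g (volume_form g o) w) =
  ((-1) ^+ (~~ o) * Num.sqrt (\det g) * \det E) *: star (tofr w).
Proof.
set c := (-1) ^+ (~~ o) * _.
apply/matrixP => a b; rewrite {1}/tofr.
have raise k l : (invmx g *m w *m (invmx g)^T) k l =
    \sum_p \sum_q E p k * tofr w p q * E q l.
  rewrite raise_tofr mxE exchange_big; apply: eq_bigr => q _ /=.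
  by rewrite mxE mulr_suml; apply: eq_bigr => p _; rewrite mxE.
transitivity (\sum_i \sum_j E a i * form_act g (volume_form g o) w i j * E b j).
  rewrite exchange_big mxE; apply: eq_bigr => j _ /=.
  by rewrite mxE mulr_suml; apply: eq_bigr => i _; rewrite [E^T _ _]mxE.
transitivity (c * 2^-1 * \sum_p \sum_q (\sum_i \sum_j \sum_k \sum_l
    eps i j k l * E a i * E b j * E p k * E q l) * tofr w p q); last first.
  under eq_bigr do under eq_bigr do rewrite eps_frame.
  rewrite [RHS]mxE [star _ _ _]mxE; move: (\det E) => dE; rewrite !mulr_sumr; apply: eq_bigr => p _.
  by rewrite !mulr_sumr; apply: eq_bigr => q _; ring.
transitivity (\sum_p \sum_q \sum_i \sum_j \sum_k \sum_l
    (c * 2^-1 * (eps i j k l * E a i * E b j * E p k * E q l * tofr w p q))); last first.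
  rewrite mulr_sumr; apply: eq_bigr => p _; rewrite mulr_sumr; apply: eq_bigr => q _.
  rewrite mulr_suml mulr_sumr; apply: eq_bigr => i _.
  rewrite mulr_suml mulr_sumr; apply: eq_bigr => j _.
  rewrite mulr_suml mulr_sumr; apply: eq_bigr => k _.
  by rewrite mulr_suml mulr_sumr.
rewrite exchange_inner; apply: eq_bigr => i _; rewrite exchange_inner.
apply: eq_bigr => j _; rewrite mxE [_ * (_ * _)]mulrA mulr_sumr mulr_suml.
rewrite exchange_inner; apply: eq_bigr => k _; rewrite mulr_sumr mulr_suml.
rewrite exchange_inner; apply: eq_bigr => l _; rewrite raise !mulr_sumr mulr_suml.
apply: eq_bigr => p _; rewrite !mulr_sumr mulr_suml; apply: eq_bigr => q _.
by rewrite /volume_form -/(eps i j k l) -/c; ring.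
Qed.

End Frame.

(** * Spectrum of the Weyl operator *)

Section WeylEigenvalues.
Context {R : realFieldType}.

(** The component W_abab of the Weyl tensor in a principal frame: the Gauss term with its Ricci and
    scalar corrections. On the pair [o0], [qa r] it equals a_r / 2 - e_2 / 6. *)
Definition wcoef (d : 'I_4 -> R) (a b : 'I_4) : R :=
  d a * d b - 2^-1 * (((\sum_i d i) * d a - d a ^+ 2) + ((\sum_i d i) * d b - d b ^+ 2))
  + 6^-1 * ((\sum_i d i) ^+ 2 - \sum_i d i ^+ 2).

Definition weig (d : 'I_4 -> R) (r : 'I_3) : R := wcoef d o0 (qa r).

(** The reason why the Weyl operator commutes with [star], so that both W^+ and W^- have the
    eigenvalues [weig d r]. *)
Lemma wcoef_dual d r : wcoef d (qc r) (qd r) = weig d r.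
Proof.
rewrite /weig /wcoef !sum4E /qa /qc /qd /tnth.
by elim/ord3P: r => /=; field.
Qed.

Lemma wcoefC d a b : wcoef d a b = wcoef d b a.
Proof. by rewrite /wcoef; ring. Qed.

End WeylEigenvalues.

Section WeylOperator.
Context {R : realType}.
Variables (g E A : 'M[R]_4) (d : 'rV[R]_4).
Hypotheses (sg : g^T = g) (sA : A^T = A)
  (EgE : E *m g *m E^T = 1%:M) (EAE : E *m A *m E^T = diag_mx d).
Variable W : 'I_4 -> 'I_4 -> 'I_4 -> 'I_4 -> R.
Hypothesis WE : forall i j k l, W i j k l =
  wedge A A i j k l - 2^-1 * kn (sff_ricci g A) g i j k l
  + 6^-1 * sff_scalar g A * wedge g g i j k l.

Lemma raise_diag (B : 'M[R]_4) : E *m (B *m invmx g *m A) *m E^T =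
  (E *m B *m E^T) *m diag_mx d.
Proof. by rewrite (frame_inv EgE) -EAE !mulmxA. Qed.

Lemma trace_shape : \tr (invmx g *m A) = \sum_i d 0 i.
Proof.
rewrite (frame_inv EgE) -mulmxA mxtrace_mulC.
have -> : E *m A *m E^T = diag_mx d by [].
by rewrite mxtrace_diag.
Qed.

Lemma trace_shape2 : \tr (invmx g *m A *m invmx g *m A) = \sum_i d 0 i ^+ 2.
Proof.
rewrite (frame_inv EgE).
have -> : E^T *m E *m A *m (E^T *m E) *m A = E^T *m ((E *m A *m E^T) *m (E *m A)).
  by rewrite !mulmxA.
rewrite mxtrace_mulC -[_ *m (E *m A) *m E^T]mulmxA EAE mulmx_diag mxtrace_diag.
by apply: eq_bigr => i _; rewrite mxE expr2.
Qed.

Lemma sff_scalarE : sff_scalar g A = (\sum_i d 0 i) ^+ 2 - \sum_i d 0 i ^+ 2.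
Proof. by rewrite /sff_scalar trace_shape trace_shape2. Qed.

Lemma sff_ricci_sym : (sff_ricci g A)^T = sff_ricci g A.
Proof.
by rewrite /sff_ricci linearB linearZ /= !trmx_mul trmx_inv sg sA mulmxA.
Qed.

Lemma tofr_ricci : tofr E (sff_ricci g A) =
  diag_mx (\row_i ((\sum_i d 0 i) * d 0 i - d 0 i ^+ 2)).
Proof.
rewrite /tofr /sff_ricci mulmxBr mulmxBl -scalemxAr -scalemxAl raise_diag EAE.
rewrite trace_shape mulmx_diag; apply/matrixP => i j; rewrite !mxE.
by case: eqP => _; rewrite ?mulr1n ?mulr0n ?mulr0 ?subr0 // expr2.
Qed.

Lemma fr_weyl w a b : w^T = - w ->
  tofr E (form_act g W w) a b = wcoef (d 0) a b * tofr E w a b.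
Proof.
move=> aw.
rewrite (@eq_form_act _ g W (fun i j k l => 1 * wedge A A i j k l + 1 *
  (- 2^-1 * (1 * wedge (sff_ricci g A) g i j k l + 1 * wedge g (sff_ricci g A) i j k l)
   + 6^-1 * sff_scalar g A * wedge g g i j k l))); last first.
  by move=> i j k l; rewrite WE knE; ring.
rewrite !form_act_lin !scale1r !tofrD !tofrZ !tofrD.
rewrite !(form_act_wedge EgE) // ?sff_ricci_sym //.
have -> : tofr E g = 1%:M by [].
have -> : tofr E A = diag_mx d by [].
rewrite tofr_ricci !mulmx1 !mul1mx mul_diag_mx mul_mx_diag mul_diag_mx mul_mx_diag.
rewrite sff_scalarE /wcoef !mxE; move: (tofr E w a b) (\sum_i _) (\sum_i _) => *.
by ring.
Qed.

Definition wpm (o : bool) (sgn : R) (i j k l : 'I_4) : R :=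
  2^-1 * (W i j k l + sgn * hodge g o (\matrix_(r, s) W r s k l) i j).

(** The star in [wpm] acts on the first index pair and the form is contracted with the second, so
    star and contraction can be exchanged by linearity. *)
Lemma form_act_wpm o sgn w : form_act g (wpm o sgn) w =
  2^-1 *: (form_act g W w + sgn *: hodge g o (form_act g W w)).
Proof.
set Om := invmx g *m w *m (invmx g)^T.
have FE : form_act g W w = \sum_k \sum_l (2^-1 * Om k l) *: (\matrix_(r, s) W r s k l).
  apply/matrixP => i j; rewrite mxE -/Om summxE mulr_sumr; apply: eq_bigr => k _.
  rewrite summxE mulr_sumr; apply: eq_bigr => l _; rewrite !mxE; ring.
have HE : hodge g o (form_act g W w) =
    \sum_k \sum_l (2^-1 * Om k l) *: hodge g o (\matrix_(r, s) W r s k l).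
  rewrite {1}FE /hodge linear_sum; apply: eq_bigr => k _.
  by rewrite linear_sum; apply: eq_bigr => l _; rewrite linearZ.
rewrite HE {HE}; apply/matrixP => i j.
have -> (X Y : 'M[R]_4) : (2^-1 *: (X + sgn *: Y)) i j = 2^-1 * (X i j + sgn * Y i j).
  by rewrite !mxE.
rewrite [form_act g W w i j]mxE [LHS]mxE -/Om; congr (_ * _).
rewrite summxE !mulr_sumr -big_split; apply: eq_bigr => k _ /=.
rewrite summxE !mulr_sumr -big_split; apply: eq_bigr => l _ /=.
by rewrite [X in _ = _ + sgn * X]mxE /wpm; ring.
Qed.

Lemma mem_leigenspace {V : vectType R} (f : {linear V -> V}) a v :
  (v \in passmx.leigenspace (linfun f) a) = (f v == a *: v).
Proof.
by rewrite /passmx.leigenspace memv_ker add_lfunE opp_lfunE scale_lfunE id_lfunE lfunE subr_eq0.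
Qed.

Variables (o b : bool).
Let sgn : R := (-1) ^+ b.
(** [vol] is 1 or -1 according to the orientation of the frame. In frame components [Lambda g o b]
    is the eigenspace of [star] for [tau], whichever orientation [E] has. *)
Let vol : R := (-1) ^+ (~~ o) * Num.sqrt (\det g) * \det E.
Let tau : R := vol * sgn.

Let vol2 : vol * vol = 1.
Proof.
have detE : \det E * \det g * \det E = 1 by rewrite -{2}(det_tr E) -!det_mulmx EgE det1.
have E0 : \det E != 0.
  by apply/eqP => E0; move: detE; rewrite E0 mulr0 => /esym/eqP; rewrite oner_eq0.
have g0 : 0 <= \det g.
  have -> : \det g = (\det E ^+ 2)^-1 by apply: (mulfI E0); apply: (mulIf E0); rewrite detE; field.
  by rewrite invr_ge0 sqr_ge0.
have -> : vol * vol = ((-1) ^+ (~~ o)) ^+ 2 * Num.sqrt (\det g) ^+ 2 * \det E ^+ 2.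
  by rewrite /vol; ring.
rewrite sqr_sqrtr // sqrr_sign mul1r -detE; ring.
Qed.

Let sgn2 : sgn * sgn = 1. Proof. by rewrite -expr2 sqrr_sign. Qed.

Let tau2 : tau * tau = 1.
Proof. by rewrite /tau mulrACA vol2 sgn2 mulr1. Qed.

Lemma mem_Lambda w : (w \in Lambda g o b) =
  (w^T == - w) && (star (tofr E w) == tau *: tofr E w).
Proof.
rewrite /Lambda memv_cap; congr (_ && _).
  by apply: etrans (mem_leigenspace _ _ _) _; rewrite scaleN1r.
apply: etrans (mem_leigenspace _ _ _) _.
rewrite -(inj_eq (tofr_inj EgE)) (form_act_vol EgE) tofrZ -/vol -/sgn.
apply/eqP/eqP => [H|->].
  by rewrite /tau -scalerA -H scalerA vol2 scale1r.
by rewrite scalerA /tau mulrA vol2 mul1r.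
Qed.

Let basisL r := offr g E (sdbasis tau r).

Lemma basisL_anti r : (basisL r)^T = - basisL r.
Proof.
apply: (tofr_inj EgE); rewrite tofr_tr tofrN (offrK EgE).
exact: sdbasis_anti.
Qed.

Definition weyl_space a := (Lambda g o b :&:
  passmx.leigenspace (linfun (form_act g (wpm o sgn))) a)%VS.

(** By [wcoef_dual] the image of [w] under the Weyl operator stays in the same eigenspace of the
    Hodge star, so the averaging in W^+ or W^- leaves it unchanged. *)
Lemma tofr_act w : w \in Lambda g o b ->
  tofr E (form_act g (wpm o sgn) w) =
  \matrix_(i, j) (wcoef (d 0) i j * tofr E w i j).
Proof.
rewrite mem_Lambda => /andP[/eqP aw /eqP sw].
have aw' : (tofr E w)^T = - tofr E w by rewrite -tofr_tr aw tofrN.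
set w' := tofr E w in sw aw' *; set X := \matrix_(i, j) _.
have XE : tofr E (form_act g W w) = X.
  by apply/matrixP => i j; rewrite fr_weyl // [RHS]mxE.
have aX : X^T = - X.
  by apply/matrixP => i j; have /matrixP/(_ i j) := aw'; rewrite !mxE => ->; rewrite wcoefC mulrN.
have sX : star X = tau *: X.
  apply: anti_ext; first exact: star_anti.
  - by rewrite linearZ /= aX scalerN.
  - move=> r; have [-> _] := star_pair r aX; have [] := star_pair r aw'; rewrite sw.
    by rewrite !mxE wcoef_dual => <- _; rewrite /weig; ring.
  - move=> r; have [_ ->] := star_pair r aX; have [_] := star_pair r aw'; rewrite sw.
    by rewrite !mxE wcoef_dual => <-; rewrite /weig; ring.
rewrite form_act_wpm tofrZ tofrD tofrZ (form_act_vol EgE) XE sX -/vol !scalerA.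
rewrite (_ : sgn * vol * tau = 1); last by rewrite /tau -mulrA [vol * (_ * _)]mulrA vol2 mul1r sgn2.
rewrite scale1r; have half (Y : 'M[R]_4) : 2^-1 *: (Y + Y) = Y.
  by apply/matrixP => i j; rewrite !mxE; field.
exact: half.
Qed.

Lemma basisL_mem r : basisL r \in weyl_space (weig (d 0) r).
Proof.
have memL : basisL r \in Lambda g o b.
  by rewrite mem_Lambda basisL_anti eqxx (offrK EgE) star_sdbasis /=.
rewrite memv_cap memL mem_leigenspace /=; apply/eqP/(tofr_inj EgE).
rewrite tofr_act // (offrK EgE) tofrZ (offrK EgE).
have as_ := sdbasis_anti tau r.
apply: anti_ext.
- by apply/matrixP => i j; have /matrixP/(_ i j) := as_; rewrite !mxE => ->; rewrite wcoefC mulrN.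
- by rewrite linearZ /= as_ scalerN.
- move=> s; rewrite [LHS]mxE [RHS]mxE sdbasis_coord -/(weig _ s).
  by case: eqP => [->|_] //; rewrite !mulr0.
- move=> s; rewrite [LHS]mxE [RHS]mxE sdbasis_coord' wcoef_dual.
  by case: eqP => [->|_] //; rewrite !mulr0.
Qed.

Lemma weyl_space_decomp a w : w \in weyl_space a ->
  w = \sum_(r | weig (d 0) r == a) tofr E w o0 (qa r) *: basisL r.
Proof.
rewrite memv_cap mem_leigenspace => /andP[wL /eqP wa].
have := wL; rewrite mem_Lambda => /andP[/eqP aw /eqP sw].
have aw' : (tofr E w)^T = - tofr E w by rewrite -tofr_tr aw tofrN.
have coef r : weig (d 0) r != a -> tofr E w o0 (qa r) = 0.
  move=> ra; have := tofr_act wL; rewrite wa tofrZ => /matrixP/(_ o0 (qa r)).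
  rewrite [LHS]mxE [RHS]mxE -/(weig _ r) => /eqP; rewrite -subr_eq0 -mulrBl mulf_eq0.
  by rewrite subr_eq0 eq_sym (negPf ra) => /eqP.
apply: (tofr_inj EgE); rewrite tofr_sum [LHS](selfdual_decomp tau2 aw' sw).
rewrite [RHS]big_mkcond; apply: eq_bigr => r _.
case: ifPn => [_|/coef ->]; last by rewrite scale0r.
by rewrite tofrZ (offrK EgE).
Qed.

(** The three forms [basisL r] are independent eigenvectors, and an eigenvector for [a] involves
    only those with [weig (d 0) r = a]. Independence is tested on the entries at [o0], [qa r]. *)
Lemma dim_weyl_space a :
  \dim (weyl_space a) = count_mem a [seq weig (d 0) r | r <- enum 'I_3].
Proof.
pose X := [seq basisL r | r <- enum 'I_3 & weig (d 0) r == a].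
have freeY : free [tuple basisL r | r < 3].
  apply/freeP => k kY i.
  have kY' : \sum_(i < 3) k i *: basisL i = 0.
    by rewrite -[RHS]kY; apply: eq_bigr => j _; rewrite -tnth_nth tnth_mktuple.
  have : tofr E (\sum_(i < 3) k i *: basisL i) o0 (qa i) = k i.
    rewrite tofr_sum summxE (bigD1 i) //= big1 => [|j ji].
      by rewrite tofrZ (offrK EgE) mxE sdbasis_coord eqxx mulr1 addr0.
    by rewrite tofrZ (offrK EgE) mxE sdbasis_coord eq_sym (negPf ji) mulr0.
  by move=> <-; rewrite kY' /tofr mulmx0 mul0mx mxE.
have freeX : free X.
  have XY : perm_eq (X ++ [seq basisL r | r <- enum 'I_3 & ~~ (weig (d 0) r == a)])
      [tuple basisL r | r < 3].
    by rewrite -map_cat; apply: perm_map; rewrite perm_filterC.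
  by have := freeY; rewrite -(perm_free XY) => /catl_free.
have -> : weyl_space a = <<X>>%VS.
  apply/vspaceP => w; apply/idP/idP => [/weyl_space_decomp ->|].
    apply: memv_suml => r ra; apply/memvZ/memv_span/map_f.
    by rewrite mem_filter ra mem_enum.
  move=> wX; apply: (subvP _ _ wX); apply/span_subvP => v /mapP[r].
  by rewrite mem_filter => /andP[/eqP <- _] ->; exact: basisL_mem.
rewrite (eqP freeX) size_map size_filter [RHS]count_map.
by apply: eq_count => r /=.
Qed.

End WeylOperator.

(** * Multiplicities *)

Lemma distinct_eigenvalues_count {R : realType} (mult : R -> nat) (s : seq R) k :
  (forall a, mult a = count_mem a s) ->
  distinct_eigenvalues mult k <-> size (undup s) = k.
Proof.
move=> multE; rewrite /distinct_eigenvalues.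
have -> : [set a | (0 < mult a)%N] = [set` [fset a | a in s]%fset].
  by apply/seteqP; split=> a /=; rewrite multE -has_count has_pred1 !inE.
have cE : #|` [fset a | a in s]%fset| = size (undup s).
  by rewrite card_fseq.
by split=> [/card_eq_fsetP|] H; [rewrite -cE H|apply/card_eq_fsetP; rewrite cE].
Qed.

Lemma rank_diag {F : fieldType} n (d : 'rV[F]_n) :
  \rank (diag_mx d) = (\sum_i (d 0%R i != 0%R))%N.
Proof.
elim: n d => [|n IH] d; first by rewrite big_ord0 thinmx0 mxrank0.
pose dl := lsubmx (d : 'rV_(1 + n)); pose dr := rsubmx (d : 'rV_(1 + n)).
have -> : \rank (diag_mx d) = (\rank (diag_mx dl) + \rank (diag_mx dr))%N.
  by rewrite -rank_diag_block_mx -diag_mx_row hsubmxK.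
rewrite IH big_ord_recl; congr (_ + _)%N.
  have -> : diag_mx dl = (d 0 0)%:M.
    by apply/matrixP => i j; rewrite !ord1 !mxE; congr (d _ _ *+ _); apply/val_inj.
  have [->|c0] := eqVneq (d 0 0) 0; first by rewrite raddf0 mxrank0.
  by rewrite -scalemx1 mxrank_scale_nz // mxrank1.
apply: eq_bigr => i _; rewrite mxE; congr (nat_of_bool (d _ _ != _)).
exact/val_inj.
Qed.

(** Conjugation preserves the rank of [S - a%:M], and the nullity of a diagonal matrix counts its
    zero entries. *)
Lemma mult_diag {F : fieldType} n (S P : 'M[F]_n) (d : 'rV[F]_n) a :
  P *m S *m invmx P = diag_mx d -> P \in unitmx ->
  \rank (eigenspace S a) = count_mem a [seq d 0 i | i <- enum 'I_n].
Proof.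
move=> SE uP; rewrite /eigenspace mxrank_ker.
have -> : \rank (S - a%:M) = \rank (diag_mx (\row_i (d 0 i - a))).
  have -> : diag_mx (\row_i (d 0 i - a)) = P *m (S - a%:M) *m invmx P.
    rewrite mulmxBr mulmxBl SE mul_mx_scalar -scalemxAl mulmxV // scalemx1.
    by apply/matrixP => i j; rewrite !mxE mulrnBl.
  rewrite mxrankMfree ?row_free_unit ?unitmx_inv //.
  by rewrite (eqmxMfull _ (_ : row_full P)) // row_full_unit.
rewrite rank_diag.
have -> : (count_mem a [seq d 0%R i | i <- enum 'I_n] = \sum_(i < n) (d 0%R i == a))%N.
  by rewrite count_map -sum1_count big_mkcond /= -big_enum.
rewrite -[X in (X - _)%N](card_ord n) -sum1_card -sumnB => [|i _]; last exact: leq_b1.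
by apply: eq_bigr => i _; rewrite mxE subr_eq0; case: eqP.
Qed.

Section Combinatorics.
Context {R : realFieldType}.
Implicit Types d : 'I_4 -> R.

Lemma weig01 d : weig d t0 - weig d t1 = 2^-1 * ((d o0 - d o3) * (d o1 - d o2)).
Proof. by rewrite /weig /wcoef !sum4E /qa /tnth /=; field. Qed.

Lemma weig02 d : weig d t0 - weig d t2 = 2^-1 * ((d o0 - d o2) * (d o1 - d o3)).
Proof. by rewrite /weig /wcoef !sum4E /qa /tnth /=; field. Qed.

Lemma weig12 d : weig d t1 - weig d t2 = 2^-1 * ((d o0 - d o1) * (d o2 - d o3)).
Proof. by rewrite /weig /wcoef !sum4E /qa /tnth /=; field. Qed.

Lemma weig_sum d : weig d t0 + weig d t1 + weig d t2 = 0.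
Proof. by rewrite /weig /wcoef !sum4E /qa /tnth /=; field. Qed.

Lemma half_mul_eq0 (x y : R) : (2^-1 * (x * y) == 0) = (x == 0) || (y == 0).
Proof. by rewrite !mulf_eq0 invr_eq0 pnatr_eq0. Qed.

Lemma weig01_eq d : (weig d t0 == weig d t1) = (d o0 == d o3) || (d o1 == d o2).
Proof. by rewrite -subr_eq0 weig01 half_mul_eq0 !subr_eq0. Qed.

Lemma weig02_eq d : (weig d t0 == weig d t2) = (d o0 == d o2) || (d o1 == d o3).
Proof. by rewrite -subr_eq0 weig02 half_mul_eq0 !subr_eq0. Qed.

Lemma weig12_eq d : (weig d t1 == weig d t2) = (d o0 == d o1) || (d o2 == d o3).
Proof. by rewrite -subr_eq0 weig12 half_mul_eq0 !subr_eq0. Qed.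

Lemma enum3E {T : Type} (f : 'I_3 -> T) :
  [seq f r | r <- enum 'I_3] = [:: f t0; f t1; f t2].
Proof.
rewrite !enum_ordSl enum_ord0 /=.
by congr [:: f _; f _; f _]; apply/val_inj.
Qed.

Lemma enum4E {T : Type} (f : 'I_4 -> T) :
  [seq f r | r <- enum 'I_4] = [:: f o0; f o1; f o2; f o3].
Proof.
rewrite !enum_ordSl enum_ord0 /=.
by congr [:: f _; f _; f _; f _]; apply/val_inj.
Qed.

Lemma size_undup_cons {T : eqType} (x : T) s :
  size (undup (x :: s)) = ((x \notin s) + size (undup s))%N.
Proof. by rewrite /=; case: (x \in s). Qed.

Lemma exists_count {T : eqType} (s : seq T) k :
  (exists a, (k < count_mem a s)%N) <-> has (fun a => (k < count_mem a s)%N) s.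
Proof.
split=> [[a ka]|/hasP[a _ ka]]; last by exists a.
apply/hasP; exists a => //; rewrite -has_pred1 has_count; exact: leq_ltn_trans ka.
Qed.

Lemma forall_count {T : eqType} (s : seq T) k :
  (forall a, (0 < count_mem a s)%N -> count_mem a s = k) <->
  all (fun a => count_mem a s == k) s.
Proof.
split=> [H|/allP H a a0]; first by apply/allP => a as_; rewrite H // -has_count has_pred1.
by apply/eqP/H; rewrite -has_pred1 has_count.
Qed.

(** [k] is the number of distinct values among the three [weig], in the form produced by
    [size_undup_cons] after each equality is replaced by the vanishing of a factor in [weig01],
    [weig02] or [weig12]. The rest is a finite check over the equality patterns of x, y, z, u. *)
Lemma multiplicity_cases (x y z u : R) (s := [:: x; y; z; u])
    (k := ((~~ (((x == u) || (y == z)) || ((x == z) || (y == u)))) +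
           ((~~ ((x == y) || (z == u))) + 1))%N) :
  [&& (k == 3%N) == (size (undup s) == 4%N),
      (k == 2%N) == (size (undup s) == 3%N) ||
         (size (undup s) == 2%N) && all (fun a => count_mem a s == 2%N) s,
      (k == 1%N) == has (fun a => 2 < count_mem a s)%N s &
      has (fun a => 2 < count_mem a s)%N s ==> (size (undup s) <= 2)%N].
Proof.
rewrite /k /s !size_undup_cons !inE /= !eqxx.
rewrite !(eq_sym y x) !(eq_sym z x) !(eq_sym u x) !(eq_sym z y) !(eq_sym u y) !(eq_sym u z).
have [xy|] := eqVneq x y; first subst y; have [xz|] := eqVneq x z; try subst z;
  have [xu|] := eqVneq x u; try subst u; rewrite ?eqxx //=;
  try (have [yz|] := eqVneq y z; try subst z; rewrite ?eqxx //=);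
  try (have [yu|] := eqVneq y u; try subst u; rewrite ?eqxx //=);
  try (have [zu|] := eqVneq z u; try subst u; rewrite ?eqxx //=).
all: do ?[move=> /[dup] /negPf ? ; rewrite eq_sym => /negPf ?].
all: by do ?[match goal with H : (_ == _) = false |- _ => rewrite ?H; clear H end].
Qed.

End Combinatorics.

(** * Hypersurfaces of conformally flat manifolds *)

Lemma open_chart_image {R : realType} n (T : topologicalType) (c : chart R n T) (V : set T) :
  open V -> open (fwd c @` (dom c `&` V)).
Proof.
move=> oV; rewrite openE => _ [q [cq Vq] <-].
have H1 : nbhs (fwd c q) (fwd c @` dom c).
  by apply: open_nbhs_nbhs; split; [exact: img_open|exists q].
have H2 : nbhs (fwd c q) (bwd c @^-1` V).
  by apply: (bwd_cont cq); apply: open_nbhs_nbhs; rewrite fwdK.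
near=> z; have [q' cq' zE] : (fwd c @` dom c) z by near: z.
exists q' => //; split=> //; rewrite -(fwdK cq') zE.
by near: z.
Unshelve. all: by end_near. Qed.

Lemma Ck_subset {R : realType} {V W : normedModType R} k (D D' : set V) (f : V -> W) :
  D' `<=` D -> Ck k D f -> Ck k D' f.
Proof.
move=> DD; elim: k f => [|k IH] f /=; first by move=> H x /DD; exact: H.
by move=> [H1 H2]; split=> [x /DD|v]; [exact: H1|exact: IH].
Qed.

Section ImmersionLocal.
Context {R : realType} {m n : nat} {M : manifold R m} {N : manifold R n}.
Variables (g : metric M) (gN : metric N) (f : M -> N).
Hypothesis iso : isometric_immersion g gN f.
Variables (c : chart R m M) (d : chart R n N).
Hypotheses (ac : atlas c) (ad : atlas d).
Let F := local_expr f c d.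

Lemma open_overlap (U : set N) : open U -> open (overlap f c d `&` f @^-1` U).
Proof.
move=> oU; have [[[cf _] _] _] := iso.
rewrite /overlap; apply: openI; last by move/continuousP: cf; apply.
apply: openI; first exact: dom_open.
by move/continuousP: cf; apply; exact: dom_open.
Qed.

Lemma open_overlap_image (U : set N) : open U ->
  open (fwd c @` (overlap f c d `&` f @^-1` U)).
Proof.
move=> oU; have -> : overlap f c d `&` f @^-1` U =
    dom c `&` (overlap f c d `&` f @^-1` U).
  by apply/seteqP; split=> [q [[cq dq] Uq]|q [_]].
exact/open_chart_image/open_overlap.
Qed.

Lemma Ck_local_expr k (U : set N) :
  Ck k (fwd c @` (overlap f c d `&` f @^-1` U)) F.
Proof.
have [[[_ sf] _] _] := iso; apply: Ck_subset (sf c d ac ad k).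
by move=> _ [q [oq _] <-]; exists q.
Qed.

Lemma local_exprE q : dom c q -> F (fwd c q) = fwd d (f q).
Proof. by move=> cq; rewrite /F /local_expr /= fwdK. Qed.

Lemma metric_pull (U : set N) y :
  (fwd c @` (overlap f c d `&` f @^-1` U)) y -> g c y = pull F (gN d) y.
Proof.
move=> [q [oq Uq] <-]; have [_ /(_ c d q ac ad oq) ->] := iso.
have dFq : differentiable F (fwd c q).
  by have [+ _] := Ck_local_expr 1 U; apply; exists q.
apply/matrixP => i j; rewrite [RHS]mxE -[LHS]dot_delta local_exprE; last by case: oq.
rewrite /dF /partial !(deriveEjacobian _ dFq) /jac_at -/F.
by rewrite /dot !trmx_mul !mulmxA.
Qed.

Lemma jac_rows q : overlap f c d q ->
  \matrix_i dF F (fwd c q) i = jac_at f c d q.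
Proof.
move=> oq; have dFq : differentiable F (fwd c q).
  by have [+ _] := Ck_local_expr 1 setT; apply; exists q.
apply/row_matrixP => i; rewrite rowK /dF /partial (deriveEjacobian _ dFq).
by rewrite rowE.
Qed.

End ImmersionLocal.

Lemma metric_unit {R : realType} n (M : manifold R n) (g : metric M) c p :
  atlas c -> dom c p -> g c (fwd c p) \in unitmx.
Proof.
move=> ac cp; rewrite -row_free_unit -kermx_eq0; apply/rowV0P => v /sub_kermxP vg.
apply/eqP/negPn/negP => v0; have := gcoef_pos g ac cp v0.
by rewrite vg mul0mx mxE ltxx.
Qed.

Lemma kn_contract {R : comNzRingType} n (P Q : 'M[R]_n) (u v w z : 'rV[R]_n) :
  \sum_i \sum_j \sum_k \sum_l kn P Q i j k l * u 0 i * v 0 j * w 0 k * z 0 l =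
  dot P u w * dot Q v z + dot P v z * dot Q u w
  - dot P u z * dot Q v w - dot P v w * dot Q u z.
Proof.
pose T u v w z := dot P u w * dot Q v z + dot P v z * dot Q u w
  - dot P u z * dot Q v w - dot P v w * dot Q u z.
have lin := (@dotDl R n, @dotDr R n, @dotZl R n, @dotZr R n).
rewrite -/(T u v w z) -(multilinear4 (T := T)).
- apply: eq_bigr => i _; apply: eq_bigr => j _; apply: eq_bigr => k _.
  by apply: eq_bigr => l _; rewrite /T !dot_delta.
- by move=> v' w' z' a u1 u2; rewrite /T !lin; ring.
- by move=> v' w' z' a u1 u2; rewrite /T !lin; ring.
- by move=> v' w' z' a u1 u2; rewrite /T !lin; ring.
- by move=> v' w' z' a u1 u2; rewrite /T !lin; ring.
Qed.

Section GaussAtPoint.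
Context {R : realType} {M : manifold R 4} {N : manifold R 5}.
Variables (g : metric M) (gN : metric N) (f : M -> N).
Hypotheses (iso : isometric_immersion g gN f) (lcf : locally_conformally_flat gN).
Variables (p : M) (nu : 'rV[R]_5).
Let c := chart_at p.
Let d := chart_at (f p).
Hypothesis un : unit_normal gN f d p nu.
Let h := gN d (fwd d (f p)).
Let J := jac_at f c d p.

Lemma ambient_schouten : exists2 P : 'M[R]_5, P^T = P &
  forall i j k l, riem (gN d) i j k l (fwd d (f p)) = kn P h i j k l.
Proof.
have [U [u [oU Uq Cu flat]]] := lcf (f p).
have ad : atlas d by exact: chart_at_atlas.
have dq : dom d (f p) by exact: chart_at_dom.
pose D := fwd d @` (dom d `&` U).
have DD : D `<=` fwd d @` dom d by move=> _ [q [Dq _] <-]; exists q.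
have Dx : D (fwd d (f p)) by exists (f p).
apply: (@conformally_flat_riem _ _ (gN d) (u \o bwd d) D).
- exact: open_chart_image.
- exact: Ck_subset DD (gcoef_smooth gN ad 2).
- exact: (Cu d ad 2).
- by move=> _ [q [Dq _] <-]; exact: gcoef_sym.
- by move=> _ [q [Dq _] <-]; exact: metric_unit.
- by [].
- exact: flat.
Qed.

Let A := sff gN f c d p nu.

(** The Kulkarni-Nomizu product is natural: since [g = J *m h *m J^T], evaluating [kn P h] on the
    rows of [J] gives [kn (J *m P *m J^T) g], which is the tensor T removed by [weylE]. *)
Lemma gauss_at_point : A^T = A /\ forall P : 'M[R]_5,
  (forall i j k l, riem (gN d) i j k l (fwd d (f p)) = kn P h i j k l) ->
  forall i j k l, riem (g c) i j k l (fwd c p) =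
    kn (J *m P *m J^T) (g c (fwd c p)) i j k l + wedge A A i j k l.
Proof.
have ac : atlas c by exact: chart_at_atlas.
have ad : atlas d by exact: chart_at_atlas.
have cp : dom c p by exact: chart_at_dom.
have dq : dom d (f p) by exact: chart_at_dom.
pose F := local_expr f c d.
pose D := fwd c @` (overlap f c d `&` f @^-1` setT).
pose E := fwd d @` dom d.
have oD : open D by apply: (open_overlap_image iso); exact: openT.
have oE : open E by exact: img_open.
have FDE y : D y -> E (F y).
  by move=> [q [[cq fq] _] <-]; rewrite /F local_exprE //; exists (f q).
have CF : Ck 3 D F by exact: (Ck_local_expr iso).
have CG : Ck 2 E (gN d) by exact: gcoef_smooth.
have sG z : E z -> (gN d z)^T = gN d z by move=> [q Dq <-]; exact: gcoef_sym.
have uG z : E z -> gN d z \in unitmx by move=> [q Dq <-]; exact: metric_unit.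
have Dx : D (fwd c p) by exists p.
have GE y : D y -> g c y = pull F (gN d) y by exact: metric_pull.
have Fx : F (fwd c p) = fwd d (f p) by exact: local_exprE.
have AE i j : A i j = dot h (accel F (gN d) (fwd c p) i j) nu.
  by rewrite /A /sff mxE (accelE oD FDE CF CG sG) // -/F Fx.
have rJ i : dF F (fwd c p) i = row i J.
  by rewrite /J -(jac_rows iso ac ad) // rowK.
have aC i j : accel F (gN d) (fwd c p) i j = accel F (gN d) (fwd c p) j i.
  apply: bvec_sym.
  - by move=> k; apply: (dG_sym oE CG sG); exact: FDE.
  - by move=> k l; exact: (dF_sym oD CF).
split.
  apply/matrixP => i j; rewrite [LHS]mxE.
  by apply: etrans (AE j i) _; rewrite aC; exact: esym (AE i j).
move=> P RP i j k l.
have sub : D `<=` fwd c @` dom c by move=> _ [q [[cq _] _] <-]; exists q.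
have jG : jet2 (g c) (fwd c p).
  apply: (@Ck_jet2 _ _ _ _ _ D) => //; exact: Ck_subset sub (gcoef_smooth g ac 2).
have unG z : D z -> g c z \in unitmx by move=> [q [[cq _] _] <-]; exact: metric_unit.
have [un1 un2] := un.
have gE : g c (fwd c p) = J *m h *m J^T.
  by have [_ /(_ c d p ac ad)] := iso; apply.
have cpl : gN d (F (fwd c p)) *m (\matrix_i dF F (fwd c p) i)^T *m
    ginv (g c) (fwd c p) *m (\matrix_i dF F (fwd c p) i) *m gN d (F (fwd c p)) +
    gN d (F (fwd c p)) *m nu^T *m (nu *m gN d (F (fwd c p))) = gN d (F (fwd c p)).
  rewrite (jac_rows iso ac ad) // Fx /ginv gE.
  apply: (@completeness_relation R 4 J h nu) => //.
  - exact: gcoef_sym.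
  - by rewrite -gE; exact: metric_unit.
rewrite (gauss_equation oD oE FDE CF CG sG uG GE i j k l Dx jG unG cpl).
have -> : \sum_a \sum_b \sum_c0 \sum_d0 riem (gN d) a b c0 d0 (F (fwd c p))
     * dF F (fwd c p) i 0 a * dF F (fwd c p) j 0 b * dF F (fwd c p) k 0 c0
     * dF F (fwd c p) l 0 d0 = kn (J *m P *m J^T) (g c (fwd c p)) i j k l.
  transitivity (\sum_a \sum_b \sum_c0 \sum_d0 kn P h a b c0 d0
     * row i J 0 a * row j J 0 b * row k J 0 c0 * row l J 0 d0).
    apply: eq_bigr => a _; apply: eq_bigr => b _; apply: eq_bigr => a' _.
    by apply: eq_bigr => b' _; rewrite !rJ Fx RP.
  rewrite kn_contract /kn gE.
  have dJ (Q : 'M[R]_5) a b : dot Q (row a J) (row b J) = (J *m Q *m J^T) a b.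
    by rewrite -dot_delta /dot !rowE !trmx_mul !mulmxA.
  by rewrite !dJ.
have AE' a b : dot (gN d (F (fwd c p))) (accel F (gN d) (fwd c p) a b) nu = A a b.
  by rewrite Fx; exact: esym (AE a b).
rewrite -addrA; congr (_ + _); rewrite [X in _ - X]mulrC.
exact: (congr2 (fun s t => s - t) (congr2 *%R (AE' i k) (AE' j l))
  (congr2 *%R (AE' i l) (AE' j k))).
Qed.

End GaussAtPoint.

Section WeylVanishing.
Context {R : realType}.
Variables (g E A : 'M[R]_4) (d : 'rV[R]_4).
Hypotheses (sg : g^T = g) (sA : A^T = A)
  (EgE : E *m g *m E^T = 1%:M) (EAE : E *m A *m E^T = diag_mx d).
Variable W : 'I_4 -> 'I_4 -> 'I_4 -> 'I_4 -> R.
Hypothesis WE : forall i j k l, W i j k l =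
  wedge A A i j k l - 2^-1 * kn (sff_ricci g A) g i j k l
  + 6^-1 * sff_scalar g A * wedge g g i j k l.

Lemma wcoef_eq0 (x : 'I_4 -> R) : (forall r, weig x r = 0) ->
  forall a b, a != b -> wcoef x a b = 0.
Proof.
move=> w0; have a0 := w0 t0; have a1 := w0 t1; have a2 := w0 t2.
have c0 := wcoef_dual x t0; have c1 := wcoef_dual x t1; have c2 := wcoef_dual x t2.
move: a0 a1 a2 c0 c1 c2; rewrite /weig /qa /qc /qd /tnth /= => a0 a1 a2.
rewrite a0 a1 a2 => c0 c1 c2.
by apply: ord4P; apply: ord4P => //; rewrite ?a0 ?a1 ?a2 ?c0 ?c1 ?c2 // wcoefC.
Qed.

(** The vanishing of W^+ or W^- is obtained from that of the whole Weyl tensor: all six frame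
    coefficients vanish by [wcoef_eq0], so the operator kills every two-form. *)
Lemma weyl_eq0 : (forall r, weig (d 0) r = 0) -> forall i j k l, W i j k l = 0.
Proof.
move=> w0 i j k l; pose Om : 'M[R]_4 := delta_mx k l - delta_mx l k.
(* Lowering the indices of [Om] beforehand makes the raised form equal to [Om], whose action singles
   out (W_ijkl - W_ijlk) / 2 = W_ijkl. *)
pose w := g *m Om *m g.
have aOm : Om^T = - Om by rewrite /Om linearB /= !trmx_delta opprB.
have aw : w^T = - w by rewrite /w !trmx_mul sg aOm mulNmx mulmxN mulmxA.
have ug : g \in unitmx by case: (mulmx1_unit EgE) => /[dup]; rewrite unitmx_mul => /andP[].
have OmE : invmx g *m w *m (invmx g)^T = Om.
  by rewrite trmx_inv sg /w !mulmxA mulVmx // mul1mx -mulmxA mulmxV // mulmx1.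
have act0 : form_act g W w = 0.
  apply: (tofr_inj EgE); rewrite [in RHS]/tofr mulmx0 mul0mx.
  have aw' : (tofr E w)^T = - tofr E w by rewrite -tofr_tr aw tofrN.
  apply/matrixP => a b; rewrite (fr_weyl sg sA EgE EAE WE) // [RHS]mxE.
  have [->|ab] := eqVneq a b; last by rewrite wcoef_eq0 // mul0r.
  have /matrixP/(_ b b) := aw'; rewrite !mxE => /eqP.
  by rewrite -subr_eq0 opprK -mulr2n mulrn_eq0 => /eqP ->; rewrite mulr0.
have antiW i' j' k' l' : W i' j' l' k' = - W i' j' k' l'.
  by rewrite !WE /kn /wedge; ring.
have /matrixP/(_ i j) := act0; rewrite mxE OmE [in RHS]mxE.
have -> : \sum_k0 \sum_l0 W i j k0 l0 * Om k0 l0 = W i j k l - W i j l k.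
  have S1 a b : \sum_k0 \sum_l0 W i j k0 l0 * (delta_mx a b : 'M[R]_4) k0 l0 = W i j a b.
    rewrite (bigD1 a) //= [X in _ + X]big1 ?addr0 => [|k' ka]; last first.
      by rewrite big1 // => l' _; rewrite mxE (negPf ka) mulr0.
    rewrite (bigD1 b) //= [X in _ + X]big1 ?addr0 => [|l' lb]; last first.
      by rewrite mxE (negPf lb) andbF mulr0.
    by rewrite mxE !eqxx mulr1.
  rewrite -(S1 k l) -(S1 l k) -sumrB; apply: eq_bigr => k' _; rewrite -sumrB.
  by apply: eq_bigr => l' _; rewrite -mulrBr /Om !mxE.
rewrite (antiW i j k l) => /eqP; rewrite opprK mulf_eq0 invr_eq0 pnatr_eq0 /=.
by rewrite -mulr2n mulrn_eq0 => /eqP.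
Qed.

End WeylVanishing.

Section PointStructure.
Context {R : realType} {M : manifold R 4} {N : manifold R 5}.
Variables (g : metric M) (gN : metric N) (f : M -> N).
Hypotheses (iso : isometric_immersion g gN f) (lcf : locally_conformally_flat gN).

(** The interface between geometry and algebra: everything used later about the point [p] is
    expressed by its principal curvatures [x]. The traces are recorded because they survive a change
    of charts; the first and third, with the scalar curvature, give e_1, e_2 and e_3. *)
Theorem point_structure (p : M) (nu : 'rV[R]_5) :
  unit_normal gN f (chart_at (f p)) p nu ->
  exists x : 'I_4 -> R,
  [/\ forall a, principal_mult g gN f p nu a = count_mem a [seq x i | i <- enum 'I_4],
      forall (o : orientation M) b a,
        weyl_mult g o b p a = count_mem a [seq weig x r | r <- enum 'I_3],
      (forall r, weig x r = 0) -> forall (o : orientation M) b i j k l,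
        weyl_pm g o b p i j k l = 0,
      \tr (Defs.shape g gN f p nu) = \sum_i x i /\
      \tr (Defs.shape g gN f p nu *m Defs.shape g gN f p nu *m Defs.shape g gN f p nu)
        = \sum_i x i ^+ 3 &
      forall c, constant_sectional_curvature gN c ->
        scalar_at g p = 12 * c + ((\sum_i x i) ^+ 2 - \sum_i x i ^+ 2)].
Proof.
move=> un; set c := chart_at p; set d := chart_at (f p).
pose h := gN d (fwd d (f p)); pose J := jac_at f c d p.
pose A := sff gN f c d p nu; pose G := g c (fwd c p).
have ac : atlas c by exact: chart_at_atlas.
have ad : atlas d by exact: chart_at_atlas.
have cp : dom c p by exact: chart_at_dom.
have dq : dom d (f p) by exact: chart_at_dom.
have [P sP PE] := ambient_schouten f lcf p.
have [sA0 gauss0] := gauss_at_point iso un.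
have sA : A^T = A by exact: sA0.
have gauss : forall i j k l, riem (g c) i j k l (fwd c p) =
    kn (J *m P *m J^T) G i j k l + wedge A A i j k l by exact: gauss0 P PE.
have sG : G^T = G by exact: gcoef_sym.
have uG : G \in unitmx by exact: metric_unit.
have [E [x [EgE EAE]]] := simultaneous_diagonalization sG
  (fun v v0 => gcoef_pos g ac cp v0) sA.
have WE := weylE sG uG gauss.
have shE : Defs.shape g gN f p nu = A *m invmx G by [].
have uE : E \in unitmx.
  by case: (mulmx1_unit EgE) => /[dup]; rewrite unitmx_mul => /andP[].
have shD : E *m (A *m invmx G) *m invmx E = diag_mx x.
  rewrite (frame_inv EgE) -EAE -!mulmxA; congr (_ *m (_ *m _)).
  by rewrite mulmxV // mulmx1.
exists (x 0); split.
- by move=> a; rewrite /principal_mult shE; exact: mult_diag shD uE.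
- by move=> o b a; exact: (dim_weyl_space sG sA EgE EAE WE (osign_at o p) b a).
- move=> w0 o b i j k l; have W0 := weyl_eq0 sG sA EgE EAE WE w0.
  rewrite /weyl_pm [weyl_at _ _ _ _ _ _]W0 add0r.
  have -> : (\matrix_(r, s) weyl_at g p r s k l) = 0.
    by apply/matrixP => r s; rewrite mxE [RHS]mxE; exact: W0.
  by rewrite /hodge linear0 mxE !mulr0.
- have shD' : A *m invmx G = invmx E *m diag_mx x *m E.
    by rewrite -shD !mulmxA mulVmx // mul1mx mulmxKV.
  rewrite shE shD'; split.
    by rewrite mxtrace_mulC mulmxA mulmxV // mul1mx mxtrace_diag.
  have -> : invmx E *m diag_mx x *m E *m (invmx E *m diag_mx x *m E) *m
      (invmx E *m diag_mx x *m E) = invmx E *m (diag_mx x *m (E *m invmx E) *m diag_mx x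
      *m (E *m invmx E) *m diag_mx x) *m E by rewrite !mulmxA.
  rewrite mulmxV // !mulmx1 mxtrace_mulC mulmxA mulmxV // mul1mx !mulmx_diag mxtrace_diag.
  by apply: eq_bigr => i _; rewrite !mxE; ring.
- move=> c0 csc; rewrite /scalar_at (scalarE sG uG gauss) (sff_scalarE EgE EAE).
  congr (_ + _).
  have trT : \tr (invmx G *m (J *m P *m J^T)) =
      \tr (E *m (J *m P *m J^T) *m E^T).
    by rewrite (frame_inv EgE) -[E^T *m E *m _]mulmxA mxtrace_mulC.
  rewrite trT /mxtrace; pose t i := (E *m (J *m P *m J^T) *m E^T) i i.
  have gJ : G = J *m h *m J^T by have [_ /(_ c d p ac ad)] := iso; apply.
  pose u i := row i (E *m J).
  have inn i j : dot h (u i) (u j) = (i == j)%:R.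
    have -> : dot h (u i) (u j) = (E *m G *m E^T) i j.
      by rewrite gJ -dot_delta /dot /u !rowE !trmx_mul !mulmxA.
    by rewrite EgE mxE.
  have PE' i : dot P (u i) (u i) = t i.
    by rewrite /t -dot_delta /dot /u !rowE !trmx_mul !mulmxA.
  (* For the orthonormal images [u i] of the frame, the sectional curvature of the plane of [u i]
     and [u j] is [t i + t j]. The disjoint pairs (0, 1) and (2, 3) then give total trace 2 c, hence
     the term 12 c. *)
  have tt i j : i != j -> t i + t j = c0.
    move=> ij; have := csc d (f p) ad dq (u i) (u j).
    have free : row_free (col_mx (u i) (u j)).
      apply/row_freeP; exists (h *m (row_mx (u i)^T (u j)^T)).
      have e a b : u a *m h *m (u b)^T = (a == b)%:R%:M.
        by apply/matrixP => a' b'; rewrite !ord1 [RHS]mxE -inn /dot mulr1n.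
      rewrite mulmxA mul_col_mx mul_col_row !e !eqxx (negPf ij) eq_sym (negPf ij).
      by rewrite raddf0 -scalar_mx_block.
    move=> /(_ free); rewrite /sectional.
    have -> : inner (gN d) (fwd d (f p)) (u i) (u i) = 1.
      by rewrite -[LHS]/(dot h (u i) (u i)) inn eqxx.
    have -> : inner (gN d) (fwd d (f p)) (u j) (u j) = 1.
      by rewrite -[LHS]/(dot h (u j) (u j)) inn eqxx.
    have -> : inner (gN d) (fwd d (f p)) (u i) (u j) = 0.
      by rewrite -[LHS]/(dot h (u i) (u j)) inn (negPf ij).
    rewrite mulr1 expr0n subr0 divr1 => <-.
    transitivity (\sum_a \sum_b \sum_c \sum_d kn P h a b c d
      * u i 0 a * u j 0 b * u i 0 c * u j 0 d); last first.
      apply: eq_bigr => a _; apply: eq_bigr => b _; apply: eq_bigr => a' _.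
      by apply: eq_bigr => b' _; rewrite PE.
    rewrite kn_contract !inn !PE' !eqxx (negPf ij) eq_sym (negPf ij).
    by rewrite !mulr1 !mulr0 !subr0.
  rewrite -[LHS]/(6 * \sum_i t i) sum4E.
  have e1 := tt o0 o1 isT; have e2 := tt o2 o3 isT.
  by rewrite -e1 in e2 *; rewrite -addrA e2; ring.
Qed.

End PointStructure.

(** * Change of charts *)

Lemma lin1_ext {R : comNzRingType} {n} (f g : 'rV[R]_n -> R) u :
  lin1 f -> lin1 g -> (forall i, f (delta_mx 0 i) = g (delta_mx 0 i)) -> f u = g u.
Proof.
move=> lf lg fg; rewrite (lin1_sum u lf) (lin1_sum u lg).
by apply: eq_bigr => i _; rewrite fg.
Qed.

Section ChangeAlgebra.
Context {R : realFieldType} {n k : nat}.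
Variables (h : 'M[R]_n) (T : 'I_n -> 'M[R]_n).
Variables (h' hi' : 'M[R]_k) (T' : 'I_k -> 'M[R]_k).
Variables (f1 : 'I_n -> 'rV[R]_k) (f2 : 'I_n -> 'I_n -> 'rV[R]_k).

Lemma dot_con1 u w : (forall a b, h a b = dot h' (f1 a) (f1 b)) ->
  dot h u w = dot h' (con1 f1 u) (con1 f1 w).
Proof.
move=> hE.
have linn := (@dotDl R n, @dotDr R n, @dotZl R n, @dotZr R n).
have link := (@con1P R n 1 k f1, (@dotDl R k, @dotDr R k, @dotZl R k, @dotZr R k)).
apply: (@lin1_ext R n (fun u => dot h u w) (fun u => dot h' (con1 f1 u) (con1 f1 w))).
- by move=> a u1 u2; rewrite !linn.
- by move=> a u1 u2; rewrite !link.
move=> i; apply: (@lin1_ext R n (fun w => dot h (delta_mx 0 i) w)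
  (fun w => dot h' (con1 f1 (delta_mx 0 i)) (con1 f1 w))).
- by move=> a u1 u2; rewrite !linn.
- by move=> a u1 u2; rewrite !link.
by move=> j; rewrite !con1_delta dot_delta.
Qed.

(** The transformation law of Christoffel symbols, extended from basis vectors by trilinearity. *)
Lemma conc_change u v w :
  (forall a b c, chr1 T a b 0 c =
    dot h' (f2 a b + conc T' (f1 a) (f1 b) *m hi') (f1 c)) ->
  (conc T u v *m w^T) 0 0 =
  dot h' (con2 f2 v u + conc T' (con1 f1 u) (con1 f1 v) *m hi') (con1 f1 w).
Proof.
move=> TE.
have link := (@con1P R n 1 k f1, @con2Pl R n 1 k f2, @con2Pr R n 1 k f2,
  @concPl R k T', @concPr R k T',
  (@dotDl R k, @dotDr R k, @dotZl R k, @dotZr R k, @mulmxDl R 1 k k)).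
pose X (u v w : 'rV[R]_n) := (conc T u v *m w^T) 0 0.
pose Y u v w :=
  dot h' (con2 f2 v u + conc T' (con1 f1 u) (con1 f1 v) *m hi') (con1 f1 w).
have XE u' v' w' : X u' v' w' = dot 1%:M (conc T u' v') w' by rewrite /dot mulmx1.
have linn := (@concPl R n T, @concPr R n T, (@dotDl R n, @dotDr R n, @dotZl R n, @dotZr R n)).
have zl (a : R) (A : 'rV[R]_k) : (a *: A) *m hi' = a *: (A *m hi') by rewrite scalemxAl.
rewrite -/(X u v w) -/(Y u v w).
apply: (@lin1_ext R n (fun u => X u v w) (fun u => Y u v w)).
- by move=> a u1 u2; rewrite !XE !linn.
- by move=> a u1 u2; rewrite /Y !link !zl !link; ring.
move=> i; apply: (@lin1_ext R n (fun v => X (delta_mx 0 i) v w) (fun v => Y (delta_mx 0 i) v w)).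
- by move=> a u1 u2; rewrite !XE !linn.
- by move=> a u1 u2; rewrite /Y !link !zl !link; ring.
move=> j; apply: (@lin1_ext R n (X (delta_mx 0 i) (delta_mx 0 j)) (Y (delta_mx 0 i) (delta_mx 0 j))).
- by move=> a u1 u2; rewrite !XE !linn.
- by move=> a u1 u2; rewrite /Y !link; ring.
by move=> c; rewrite XE conc_delta dot_deltar mulmx1 TE /Y con2_delta !con1_delta.
Qed.

End ChangeAlgebra.

(** * Change of chart in the ambient manifold *)

Section ChangeTarget.
Context {R : realType} {m n k : nat}.
Variables (F : 'rV[R]_m -> 'rV[R]_n) (phi : 'rV[R]_n -> 'rV[R]_k)
  (F' : 'rV[R]_m -> 'rV[R]_k).
Variables (h : 'rV[R]_n -> 'M[R]_n) (h' : 'rV[R]_k -> 'M[R]_k).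
Variables (D : set 'rV[R]_m) (E : set 'rV[R]_n) (E' : set 'rV[R]_k).
Hypotheses (oD : open D) (oE : open E) (oE' : open E').
Hypotheses (FDE : forall y, D y -> E (F y)) (phiE : forall z, E z -> E' (phi z)).
Hypotheses (F'E : forall y, D y -> F' y = phi (F y)).
Hypotheses (CF : Ck 3 D F) (Cphi : Ck 3 E phi) (Ch' : Ck 2 E' h').
Hypotheses (sh' : forall z, E' z -> (h' z)^T = h' z)
  (uh : forall z, E z -> h z \in unitmx)
  (uh' : forall z, E' z -> h' z \in unitmx).
Hypothesis hE : forall z, E z -> h z = pull phi h' z.

Let dphi z c := partial c phi z.
Let ddphi z c d := partial c (partial d phi) z.

Lemma diffF y : D y -> differentiable F y. Proof. by have [+ _] := CF; apply. Qed.
Lemma diffdF y i : D y -> differentiable (partial i F) y.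
Proof. by have [_ /(_ (delta_mx 0 i)) [+ _]] := CF; apply. Qed.
Lemma diffphi z : E z -> differentiable phi z. Proof. by have [+ _] := Cphi; apply. Qed.
Lemma diffdphi z i : E z -> differentiable (partial i phi) z.
Proof. by have [_ /(_ (delta_mx 0 i)) [+ _]] := Cphi; apply. Qed.

Lemma dF_comp y i : D y -> dF F' y i = con1 (dphi (F y)) (dF F y i).
Proof.
move=> Dy; have [_ <-] := is_derive_comp i (diffF Dy) (diffphi (FDE Dy)).
apply: near_eq_derive; near=> z; rewrite F'E //; near: z; exact: open_nbhs_nbhs.
Unshelve. all: by end_near. Qed.

Lemma ddF_comp y i j : D y -> ddF F' y i j =
  con1 (dphi (F y)) (ddF F y i j) + con2 (ddphi (F y)) (dF F y j) (dF F y i).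
Proof.
move=> Dy; have [_ <-] := is_derive_comp2 i (diffF Dy) (diffdF j Dy)
  (fun c => diffdphi c (FDE Dy)).
by apply: near_eq_derive; near=> z; apply: dF_comp; near: z; exact: open_nbhs_nbhs.
Unshelve. all: by end_near. Qed.

(** The transition map is itself an isometric immersion between coordinate domains, so
    [accel_tangent] applied to [phi] relates the Christoffel symbols in both charts. They absorb the
    second derivatives of [phi] produced by the chain rule, and [accel] transforms as a vector. *)
Lemma accel_change y i j w : D y ->
  dot (h' (F' y)) (accel F' h' y i j) (w *m 'J phi (F y)) =
  dot (h (F y)) (accel F h y i j) w.
Proof.
move=> Dy; have Ez := FDE Dy; set z := F y in Ez *.
have Jw : w *m 'J phi z = con1 (dphi z) w.
  by rewrite -(deriveEjacobian _ (diffphi Ez)) derive_row //; exact: diffphi.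
have tan a b c : chr1 (dG h z) a b 0 c =
    dot (h' (phi z)) (ddphi z a b + conc (dG h' (phi z)) (dphi z a) (dphi z b)
      *m ginv h' (phi z)) (dphi z c).
  exact: (accel_tangent oE phiE Cphi Ch' sh' uh' hE a b c Ez).
have hz a b : h z a b = dot (h' (phi z)) (dphi z a) (dphi z b).
  by rewrite hE // [LHS]mxE.
rewrite Jw /accel /bvec [in RHS](@dotDl R n) (dot_con1 _ _ hz).
have -> : dot (h z) (conc (dG h z) (dF F y i) (dF F y j) *m ginv h z) w =
    (conc (dG h z) (dF F y i) (dF F y j) *m w^T) 0 0.
  by rewrite /dot /ginv mulmxKV // uh.
rewrite (conc_change _ _ _ tan) -(@dotDl R k) F'E // -/z.
by rewrite ddF_comp // !dF_comp // -/z addrA.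
Qed.

End ChangeTarget.

(** * Change of chart on the hypersurface *)

Section ChangeSource.
Context {R : realType} {l m n : nat}.
Variables (psi : 'rV[R]_l -> 'rV[R]_m) (F : 'rV[R]_m -> 'rV[R]_n)
  (F' : 'rV[R]_l -> 'rV[R]_n) (h : 'rV[R]_n -> 'M[R]_n).
Variables (D' : set 'rV[R]_l) (D : set 'rV[R]_m).
Hypotheses (oD' : open D') (psiD : forall y, D' y -> D (psi y)).
Hypotheses (Cpsi : Ck 3 D' psi) (CF : Ck 3 D F).
Hypothesis F'E : forall y, D' y -> F' y = F (psi y).

Lemma conc_con1 (T : 'I_n -> 'M[R]_n) (f1 : 'I_m -> 'rV[R]_n) (hi : 'M[R]_n) u v :
  conc T (con1 f1 u) (con1 f1 v) *m hi =
  con2 (fun d c => conc T (f1 d) (f1 c) *m hi) v u.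
Proof.
have linc := (@con1P R m 1 n f1, @concPl R n T, @concPr R n T, @mulmxDl R 1 n n).
have zl (a : R) (A : 'rV[R]_n) : (a *: A) *m hi = a *: (A *m hi) by rewrite scalemxAl.
apply/rowP => k.
pose C := fun d c => conc T (f1 d) (f1 c) *m hi.
have link := (@con2Pl R m 1 n C, @con2Pr R m 1 n C).
apply: (@lin1_ext R m (fun u => (conc T (con1 f1 u) (con1 f1 v) *m hi) 0 k)
  (fun u => (con2 C v u) 0 k)).
- by move=> a u1 u2; rewrite !linc zl [LHS]mxE [X in X + _]mxE.
- by move=> a u1 u2; rewrite !link [LHS]mxE [X in X + _]mxE.
move=> i; apply: (@lin1_ext R m
  (fun v => (conc T (con1 f1 (delta_mx 0 i)) (con1 f1 v) *m hi) 0 k)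
  (fun v => (con2 C v (delta_mx 0 i)) 0 k)).
- by move=> a u1 u2; rewrite !linc zl [LHS]mxE [X in X + _]mxE.
- by move=> a u1 u2; rewrite !link [LHS]mxE [X in X + _]mxE.
by move=> j; rewrite con2_delta !con1_delta.
Qed.

(** The second derivative of [psi] enters only through a combination of tangent vectors of the
    immersion, and [nu] annihilates these; what remains is bilinear in the Jacobian of [psi]. *)
Lemma accel_source y i j nu : D' y ->
  (forall a, dot (h (F (psi y))) (dF F (psi y) a) nu = 0) ->
  dot (h (F' y)) (accel F' h y i j) nu =
  ('J psi y *m (\matrix_(a, b) dot (h (F (psi y))) (accel F h (psi y) a b) nu)
    *m ('J psi y)^T) i j.
Proof.
move=> Dy nuN.
pose f1 c := partial c F (psi y); pose f2 c d := partial c (partial d F) (psi y).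
have dpsi : differentiable psi y by exact: (diffF Cpsi Dy).
have dFi z a : D' z -> dF F' z a = con1 (fun c => partial c F (psi z)) (dF psi z a).
  by move=> Dz; exact: (dF_comp (phi := F) oD' psiD F'E Cpsi CF a Dz).
have ddFij : ddF F' y i j = con1 f1 (ddF psi y i j) + con2 f2 (dF psi y j) (dF psi y i).
  exact: (ddF_comp (phi := F) oD' psiD F'E Cpsi CF i j Dy).
rewrite /accel /bvec F'E // !dFi // ddFij conc_con1.
set C2 := con2 (fun d c => conc _ _ _ *m _) _ _.
have -> : con1 f1 (ddF psi y i j) + con2 f2 (dF psi y j) (dF psi y i) + C2 =
    con1 f1 (ddF psi y i j) + con2 (accel F h (psi y)) (dF psi y j) (dF psi y i).
  rewrite -addrA; congr (_ + _); rewrite /C2 /con2 -big_split /=.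
  apply: eq_bigr => c _; rewrite -scalerDr; congr (_ *: _); rewrite -big_split /=.
  by apply: eq_bigr => d _; rewrite -scalerDr.
rewrite (@dotDl R n).
have -> : dot (h (F (psi y))) (con1 f1 (ddF psi y i j)) nu = 0.
  rewrite /con1 /dot !mulmx_suml summxE big1 // => c _.
  by rewrite -!scalemxAl mxE [X in _ * X](nuN c) mulr0.
rewrite add0r /con2 /dot !mulmx_suml summxE mxE; apply: eq_bigr => c _.
rewrite -!scalemxAl mxE !mulmx_suml summxE [X in _ * X = _](_ : _ =
  ('J psi y *m (\matrix_(a, b) dot (h (F (psi y))) (accel F h (psi y) a b) nu)) i c).
  by rewrite [LHS]mulrC; congr (_ * _); rewrite [RHS]mxE /dF /partial (deriveEjacobian _ dpsi) -rowE mxE.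
rewrite [RHS]mxE; apply: eq_bigr => d _.
rewrite -!scalemxAl mxE [X in _ = _ * X]mxE; congr (_ * _).
by rewrite /dF /partial (deriveEjacobian _ dpsi) -rowE mxE.
Qed.

End ChangeSource.

Section SffChange.
Context {R : realType} {m n : nat} {M : manifold R m} {N : manifold R n}.
Variables (g : metric M) (gN : metric N) (f : M -> N).
Hypothesis iso : isometric_immersion g gN f.

Lemma sff_accel c d p nu : atlas c -> atlas d -> overlap f c d p ->
  sff gN f c d p nu = \matrix_(a, b)
    dot (gN d (fwd d (f p))) (accel (local_expr f c d) (gN d) (fwd c p) a b) nu.
Proof.
move=> ac ad [cp dp]; pose F := local_expr f c d.
pose D := fwd c @` (overlap f c d `&` f @^-1` setT).
pose E := fwd d @` dom d.
have oD : open D by apply: (open_overlap_image iso); exact: openT.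
have FDE y : D y -> E (F y).
  by move=> [q [[cq fq] _] <-]; rewrite /F local_exprE //; exists (f q).
have CF : Ck 3 D F by exact: (Ck_local_expr iso).
have CG : Ck 2 E (gN d) by exact: gcoef_smooth.
have sG z : E z -> (gN d z)^T = gN d z by move=> [q Dq <-]; exact: gcoef_sym.
have Dx : D (fwd c p) by exists p.
apply/matrixP => i j; rewrite [LHS]mxE [RHS]mxE (accelE oD FDE CF CG sG) // -/F.
by rewrite /F local_exprE.
Qed.

Lemma transitionE {k} {X : manifold R k} (c d : chart R k X) q :
  dom c q -> transition c d (fwd c q) = fwd d q.
Proof. by move=> cq; rewrite /transition /= fwdK. Qed.

Lemma metric_transition {k} {X : manifold R k} (gX : metric X) (c d : chart R k X) z :
  atlas c -> atlas d -> (fwd c @` (dom c `&` dom d)) z ->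
  gX c z = pull (transition c d) (gX d) z.
Proof.
move=> ac ad [q [cq dq] <-]; rewrite (gcoef_compat gX ac ad cq dq).
have dt : differentiable (transition c d) (fwd c q).
  by have [+ _] := transition_smooth ac ad 1; apply; exists q.
apply/matrixP => i j; rewrite [RHS]mxE -[LHS]dot_delta transitionE //.
rewrite /dF /partial !(deriveEjacobian _ dt).
by rewrite /dot !trmx_mul !mulmxA.
Qed.

Lemma sff_target c d d' p nu : atlas c -> atlas d -> atlas d' ->
  overlap f c d p -> dom d' (f p) ->
  sff gN f c d' p (nu *m 'J (transition d d') (fwd d (f p))) = sff gN f c d p nu.
Proof.
move=> ac ad ad' op dp'; have [cp dp] := op.
pose F := local_expr f c d; pose F' := local_expr f c d'.
pose D := fwd c @` (overlap f c d `&` f @^-1` (dom d')).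
pose E := fwd d @` (dom d `&` dom d'); pose E' := fwd d' @` dom d'.
have oD : open D by apply: (open_overlap_image iso); exact: dom_open.
have oE : open E by apply: open_chart_image; exact: dom_open.
have FDE y : D y -> E (F y).
  by move=> [q [[cq fq] fq'] <-]; rewrite /F local_exprE //; exists (f q).
have tE z : E z -> E' (transition d d' z).
  by move=> [q [dq dq'] <-]; rewrite transitionE //; exists q.
have F'E y : D y -> F' y = transition d d' (F y).
  by move=> [q [[cq fq] fq'] <-]; rewrite /F /F' !local_exprE // transitionE.
have CF : Ck 3 D F by exact: (Ck_local_expr iso).
have Cphi : Ck 3 E (transition d d') by exact: transition_smooth.
have CG : Ck 2 E' (gN d') by exact: gcoef_smooth.
have sG z : E' z -> (gN d' z)^T = gN d' z by move=> [q Dq <-]; exact: gcoef_sym.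
have uG z : E z -> gN d z \in unitmx by move=> [q [Dq _] <-]; exact: metric_unit.
have uG' z : E' z -> gN d' z \in unitmx by move=> [q Dq <-]; exact: metric_unit.
have Dx : D (fwd c p) by exists p.
have hE z : E z -> gN d z = pull (transition d d') (gN d') z.
  exact: metric_transition.
rewrite !sff_accel //; apply/matrixP => i j; rewrite [LHS]mxE [RHS]mxE.
have := accel_change oD oE FDE tE F'E CF Cphi CG sG uG uG' hE i j nu Dx.
by rewrite /F /F' !local_exprE.
Qed.

Lemma con1_mulmx k (f1 : 'I_m -> 'rV[R]_k) (u : 'rV[R]_m) :
  con1 f1 u = u *m (\matrix_i f1 i).
Proof. by rewrite mulmx_sum_row; apply: eq_bigr => i _; rewrite rowK. Qed.

Section Source.
Variables (c c' : chart R m M) (d : chart R n N) (p : M).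
Hypotheses (ac : atlas c) (ac' : atlas c') (ad : atlas d).
Hypotheses (op : overlap f c d p) (cp' : dom c' p).
Let F := local_expr f c d.
Let F' := local_expr f c' d.
Let psi := transition c' c.
Let D := fwd c @` (overlap f c d `&` f @^-1` setT).
Let D' := fwd c' @` (dom c' `&` overlap f c d).

Let oD' : open D'.
Proof.
apply: open_chart_image.
have -> : overlap f c d = overlap f c d `&` f @^-1` setT.
  by rewrite preimage_setT setIT.
by apply: (open_overlap iso); exact: openT.
Qed.

Let psiD y : D' y -> D (psi y).
Proof.
by move=> [q [cq' [cq fq]] <-]; rewrite /psi transitionE //; exists q.
Qed.

Let F'E y : D' y -> F' y = F (psi y).
Proof.
by move=> [q [cq' [cq fq]] <-]; rewrite /F /F' local_exprE // /psi transitionE // local_exprE.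
Qed.

Let Cpsi : Ck 3 D' psi.
Proof.
apply: Ck_subset (transition_smooth ac' ac 3) => _ [q [cq' [cq _]] <-].
by exists q.
Qed.

Let CF : Ck 3 D F. Proof. exact: (Ck_local_expr iso). Qed.

Let Dp : D' (fwd c' p). Proof. by exists p. Qed.

Lemma jac_source :
  jac_at f c' d p = 'J psi (fwd c' p) *m jac_at f c d p.
Proof.
have [cp dp] := op; have dpsi : differentiable psi (fwd c' p) by exact: (diffF Cpsi Dp).
rewrite -!(jac_rows iso _ ad) //; apply/row_matrixP => i; rewrite rowK row_mul.
have := dF_comp (phi := F) oD' psiD F'E Cpsi CF i Dp => ->.
rewrite con1_mulmx /psi transitionE // -/psi /dF /partial (deriveEjacobian _ dpsi).
by rewrite rowE.
Qed.

Lemma sff_source nu : jac_at f c d p *m gN d (fwd d (f p)) *m nu^T = 0 ->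
  sff gN f c' d p nu =
  'J psi (fwd c' p) *m sff gN f c d p nu *m ('J psi (fwd c' p))^T.
Proof.
move=> nuN; have [cp dp] := op.
have pp : psi (fwd c' p) = fwd c p by rewrite /psi transitionE.
have Fp : F (fwd c p) = fwd d (f p) by exact: local_exprE.
have nuN' a : dot (gN d (F (psi (fwd c' p)))) (dF F (psi (fwd c' p)) a) nu = 0.
  rewrite pp Fp; have <- : row a (jac_at f c d p) = dF F (fwd c p) a.
    by rewrite -(jac_rows iso ac ad) // rowK.
  by rewrite /dot rowE -!mulmxA [X in _ *m X]mulmxA nuN mulmx0 mxE.
rewrite !sff_accel //; apply/matrixP => i j; rewrite [LHS]mxE.
have := accel_source oD' psiD Cpsi CF F'E i j Dp nuN'.
by rewrite pp Fp /F' local_exprE.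
Qed.

End Source.

(** With [K] the Jacobian of the source transition, A becomes K A K^T and g becomes K g K^T, so the
    shape operator changes by conjugation; the target transition only rewrites the components of the
    normal. *)
Lemma shape_change c c' d d' p nu : atlas c -> atlas c' -> atlas d -> atlas d' ->
  overlap f c d p -> dom c' p -> dom d' (f p) ->
  jac_at f c' d p *m gN d (fwd d (f p)) *m nu^T = 0 ->
  exists2 K : 'M[R]_m, K \in unitmx &
    sff gN f c' d' p (nu *m 'J (transition d d') (fwd d (f p)))
      *m invmx (g c' (fwd c' p)) *m K =
    K *m (sff gN f c d p nu *m invmx (g c (fwd c p))).
Proof.
move=> ac ac' ad ad' op cp' dp' nuN; have [cp dp] := op.
pose K := 'J (transition c' c) (fwd c' p).
have gK : g c' (fwd c' p) = K *m g c (fwd c p) *m K^T by exact: gcoef_compat.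
have uK : K \in unitmx.
  have := metric_unit g ac' cp'; rewrite gK unitmx_mul => /andP[].
  by rewrite unitmx_mul => /andP[].
have ug := metric_unit g ac cp.
exists K => //; rewrite sff_target // (sff_source ac ac' ad op cp'); last first.
  move: nuN; rewrite (jac_source ac ac' ad op cp') -!mulmxA => /(congr1 (mulmx (invmx K))).
  by rewrite mulmx0 mulKmx.
rewrite -/K; apply: (can_inj (mulmxK (_ : g c (fwd c p) *m K^T \in unitmx))).
  by rewrite unitmx_mul ug unitmx_tr.
have -> : K *m sff gN f c d p nu *m K^T *m invmx (g c' (fwd c' p)) *m K
    *m (g c (fwd c p) *m K^T) = K *m sff gN f c d p nu *m K^T
    *m (invmx (g c' (fwd c' p)) *m (K *m g c (fwd c p) *m K^T)) by rewrite !mulmxA.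
rewrite -gK mulVmx ?mulmx1; last exact: metric_unit.
by rewrite !mulmxA mulmxKV.
Qed.

End SffChange.

(** * Continuity of the shape operator *)

Section MatrixContinuity.
Context {R : realType} {T : topologicalType} (x : T).

Definition ctn (f : T -> R) : Prop := {for x, continuous f}.
Definition mctn m n (A : T -> 'M[R]_(m, n)) : Prop :=
  forall i j, ctn (fun t => A t i j).

Lemma ctn_cst a : ctn (fun=> a). Proof. exact: cst_continuous. Qed.
Lemma ctnD f g : ctn f -> ctn g -> ctn (fun t => f t + g t).
Proof. by move=> cf cg; exact: (continuousD cf cg). Qed.
Lemma ctnM f g : ctn f -> ctn g -> ctn (fun t => f t * g t).
Proof. by move=> cf cg; exact: (continuousM cf cg). Qed.

Lemma mctn_mulmx m n p (A : T -> 'M[R]_(m, n)) (B : T -> 'M[R]_(n, p)) :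
  mctn A -> mctn B -> mctn (fun t => A t *m B t).
Proof.
move=> cA cB i j; have := @closed_mulmx R T ctn ctn_cst ctnD ctnM _ _ _ A B cA cB i j.
exact.
Qed.

Lemma mctnD m n (A B : T -> 'M[R]_(m, n)) :
  mctn A -> mctn B -> mctn (fun t => A t + B t).
Proof. by move=> cA cB i j; under eq_fun do rewrite mxE; exact: ctnD. Qed.

Lemma mctn_trmx m n (A : T -> 'M[R]_(m, n)) : mctn A -> mctn (fun t => (A t)^T).
Proof. by move=> cA i j; under eq_fun do rewrite mxE; exact: cA. Qed.

Lemma mctn_scale m n (s : T -> R) (A : T -> 'M[R]_(m, n)) :
  ctn s -> mctn A -> mctn (fun t => s t *: A t).
Proof. by move=> cs cA i j; under eq_fun do rewrite mxE; exact: ctnM. Qed.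

Lemma mctn_sum I (r : seq I) m n (A : I -> T -> 'M[R]_(m, n)) :
  (forall k, mctn (A k)) -> mctn (fun t => \sum_(k <- r) A k t).
Proof.
move=> cA i j; under eq_fun do rewrite summxE.
by apply: (closed_sum ctn_cst ctnD) => k; exact: cA.
Qed.

Lemma mctn_near m n (A B : T -> 'M[R]_(m, n)) :
  {near x, A =1 B} -> mctn A -> mctn B.
Proof.
move=> AB cA i j; rewrite /ctn /prop_for /continuous_at -(nbhs_singleton AB).
apply: cvg_trans (cA i j); apply: near_eq_cvg.
by near=> t; rewrite (near AB t).
Unshelve. all: by end_near. Qed.

Lemma mctn_invmx n (A : T -> 'M[R]_n) : (\forall t \near x, A t \in unitmx) ->
  mctn A -> mctn (fun t => invmx (A t)).
Proof.
move=> uA cA; apply: (mctn_near (A := fun t => (\det (A t))^-1 *: \adj (A t))).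
  by near=> t; rewrite /invmx ifT //; near: t.
apply: mctn_scale; last exact: (closed_adj ctn_cst ctnD ctnM).
apply: continuousV; last exact: (closed_det ctn_cst ctnD ctnM).
by move: (nbhs_singleton uA); rewrite unitmxE unitfE.
Unshelve. all: by end_near. Qed.

Lemma mctn_comp {V : normedModType R} m n (A : V -> 'M[R]_(m, n)) (u : T -> V) :
  {for u x, continuous A} -> {for x, continuous u} -> mctn (A \o u).
Proof.
move=> cA cu i j.
apply: (@continuous_comp _ _ _ (A \o u) (fun B : 'M[R]_(m, n) => B i j)).
  exact: continuous_comp.
exact: coord_continuous.
Qed.

Lemma ctn_trace n (A : T -> 'M[R]_n) : mctn A -> ctn (fun t => \tr (A t)).
Proof. by move=> cA; apply: (closed_sum ctn_cst ctnD) => k; exact: cA. Qed.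

End MatrixContinuity.

Section ShapeContinuity.
Context {R : realType} {m n : nat} {M : manifold R m} {N : manifold R n}.
Variables (g : metric M) (gN : metric N) (f : M -> N).
Hypothesis iso : isometric_immersion g gN f.
Variable nu : unit_normal_field gN f.

(** The shape operator in a fixed pair of charts, whose entries vary continuously with the point, in
    contrast to [shape_at], whose charts depend on the point. *)
Definition shape_in c d p : 'M[R]_m :=
  sff gN f c d p (nu d p) *m invmx (g c (fwd c p)).

Lemma shape_in_continuous c d p : atlas c -> atlas d -> overlap f c d p ->
  mctn p (shape_in c d).
Proof.
move=> ac ad op; have [cp dp] := op.
pose F := local_expr f c d.
pose D := fwd c @` (overlap f c d `&` f @^-1` setT).
pose E := fwd d @` dom d.
have Dx : D (fwd c p) by exists p.
have FDE y : D y -> E (F y).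
  by move=> [q [[cq fq] _] <-]; rewrite /F local_exprE //; exists (f q).
have CF : Ck 3 D F by exact: (Ck_local_expr iso).
have CG : Ck 2 E (gN d) by exact: gcoef_smooth.
have oov : open (overlap f c d).
  have -> : overlap f c d = overlap f c d `&` f @^-1` setT by rewrite preimage_setT setIT.
  by apply: (open_overlap iso); exact: openT.
have nov : \forall q \near p, overlap f c d q by exact: open_nbhs_nbhs.
have cfwd : {for p, continuous (fwd c)} by exact: fwd_cont.
have on_source k l (A : 'rV[R]_m -> 'M[R]_(k, l)) : differentiable A (fwd c p) ->
    mctn p (fun q => A (fwd c q)).
  move=> dA; exact: mctn_comp (differentiable_continuous dA) cfwd.
have dF1 : differentiable F (fwd c p) by have [+ _] := CF; apply.
have cFc : {for p, continuous (F \o fwd c)}.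
  exact: continuous_comp cfwd (differentiable_continuous dF1).
have on_target k l (A : 'rV[R]_n -> 'M[R]_(k, l)) : differentiable A (F (fwd c p)) ->
    mctn p (fun q => A (F (fwd c q))).
  move=> dA; exact: (mctn_comp (u := F \o fwd c) (differentiable_continuous dA) cFc).
have ch : mctn p (fun q => gN d (F (fwd c q))).
  by apply: on_target; have [+ _] := CG; apply; exact: FDE.
have cdh a : mctn p (fun q => dG (gN d) (F (fwd c q)) a).
  by apply: on_target; have [_ /(_ (delta_mx 0 a)) [+ _]] := CG; apply; exact: FDE.
have cdF i : mctn p (fun q => dF F (fwd c q) i).
  by apply: on_source; have [_ /(_ (delta_mx 0 i)) [+ _]] := CF; apply.
have cddF i j : mctn p (fun q => ddF F (fwd c q) i j).
  apply: on_source.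
  by have [_ /(_ (delta_mx 0 j)) [_ /(_ (delta_mx 0 i)) [+ _]]] := CF; apply.
have chi : mctn p (fun q => ginv (gN d) (F (fwd c q))).
  apply: mctn_invmx => //; near=> q.
  have [cq dq] : overlap f c d q by near: q.
  by rewrite /F local_exprE //; exact: metric_unit.
have cchr a b : mctn p (fun q => chr1 (dG (gN d) (F (fwd c q))) a b).
  move=> i j; pose t e1 e2 e3 q := dG (gN d) (F (fwd c q)) e1 e2 e3.
  have -> : (fun q => chr1 (dG (gN d) (F (fwd c q))) a b i j) =
      (fun q => 2^-1 * (t a b j q + t b a j q + -1 * t j a b q)).
    by apply/funext => q; rewrite mxE mulN1r.
  apply: ctnM; first exact: ctn_cst.
  apply: ctnD; first by apply: ctnD; exact: cdh.
  by apply: ctnM; [exact: ctn_cst|exact: cdh].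
have caccel i j : mctn p (fun q => accel F (gN d) (fwd c q) i j).
  apply: mctnD => //; apply: mctn_mulmx => //.
  apply: mctn_sum => a; apply: mctn_sum => b; apply: mctn_scale => //.
  by apply: ctnM; exact: cdF.
have cnu : mctn p (nu d).
  apply: (mctn_near (A := (nu d \o bwd c) \o fwd c)).
    near=> q; have [cq dq] : overlap f c d q by near: q.
    by rewrite /= fwdK.
  apply: mctn_comp cfwd.
  by have := nfield_smooth nu ac ad 0; apply; exists p.
apply: mctn_mulmx; last first.
  apply: mctn_invmx.
    near=> q; have [cq dq] : overlap f c d q by near: q.
    exact: metric_unit.
  apply: on_source.
  by have [+ _] := gcoef_smooth g ac 1; apply; exists p.
apply: (mctn_near (A := fun q => \matrix_(a, b)
    (accel F (gN d) (fwd c q) a b *m gN d (F (fwd c q)) *m (nu d q)^T) 0 0)).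
  near=> q; have oq : overlap f c d q by near: q.
  rewrite (sff_accel iso) //; apply/matrixP => a b; rewrite [LHS]mxE [RHS]mxE.
  by case: oq => cq dq; rewrite /F local_exprE.
move=> i j; have -> : (fun q => (\matrix_(a, b) (accel F (gN d) (fwd c q) a b
    *m gN d (F (fwd c q)) *m (nu d q)^T) 0 0) i j) =
    (fun q => (accel F (gN d) (fwd c q) i j *m gN d (F (fwd c q)) *m (nu d q)^T) 0 0).
  by apply/funext => q; rewrite mxE.
by apply: mctn_mulmx; [exact: mctn_mulmx|exact: mctn_trmx].
Unshelve. all: by end_near. Qed.

Definition shape_at p := Defs.shape g gN f p (nu (chart_at (f p)) p).

(** Near [p] the operators [shape_at q] and [shape_in c d q] are conjugate by [shape_change], so the
    traces of their cubes agree, and the latter trace is continuous. *)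
Theorem trace_shape3_continuous :
  continuous (fun p => \tr (shape_at p *m shape_at p *m shape_at p)).
Proof.
move=> p; set c := chart_at p; set d := chart_at (f p).
have ac : atlas c by exact: chart_at_atlas.
have ad : atlas d by exact: chart_at_atlas.
have op : overlap f c d p by split; exact: chart_at_dom.
have nov : \forall q \near p, overlap f c d q.
  apply: open_nbhs_nbhs; split=> //.
  have -> : overlap f c d = overlap f c d `&` f @^-1` setT by rewrite preimage_setT setIT.
  by apply: (open_overlap iso); exact: openT.
pose S := shape_in c d.
have trE : {near p, (fun q => \tr (S q *m S q *m S q)) =1
    (fun q => \tr (shape_at q *m shape_at q *m shape_at q))}.
  near=> q; have oq : overlap f c d q by near: q.
  have [cq dq] := oq.
  have ac' := chart_at_atlas q; have ad' := chart_at_atlas (f q).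
  have [un _] := nfield_unit_normal nu ad dq.
  have [K uK KE] := shape_change iso ac ac' ad ad' oq (chart_at_dom q) (chart_at_dom (f q)) un.
  have SK : shape_at q *m K = K *m S q.
    by rewrite /shape_at /Defs.shape (nfield_compat nu ad ad' dq (chart_at_dom (f q))).
  have {}SK : shape_at q = K *m S q *m invmx K by rewrite -SK mulmxK.
  rewrite SK; have -> : K *m S q *m invmx K *m (K *m S q *m invmx K) *m (K *m S q *m invmx K)
    = K *m (S q *m (invmx K *m K) *m S q *m (invmx K *m K) *m S q) *m invmx K.
    by rewrite !mulmxA.
  by rewrite mulVmx // !mulmx1 [RHS]mxtrace_mulC mulKmx.
have cS : mctn p S by exact: shape_in_continuous.
have cT : ctn p (fun q => \tr (S q *m S q *m S q)).
  by apply: ctn_trace; apply: mctn_mulmx => //; exact: mctn_mulmx.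
rewrite /continuous_at -(nbhs_singleton trE).
by apply: cvg_trans cT; exact: near_eq_cvg.
Unshelve. all: by end_near. Qed.

End ShapeContinuity.

(** * Resolvent cubic *)

Lemma perm_count_mem {T : eqType} (s t : seq T) :
  (forall a, count_mem a s = count_mem a t) -> perm_eq s t.
Proof. by move=> H; apply/allP => a _; apply/eqP. Qed.

Section SymmetricFunctions.
Context {R : realFieldType}.
Implicit Types x y : 'I_4 -> R.

Local Notation vals x := [seq x i | i <- enum 'I_4].
Local Notation wvals x := [seq weig x r | r <- enum 'I_3].

(** Elementary symmetric functions written with power sums by Newton's identities, since traces and
    the scalar curvature provide power sums. *)
Definition e2 x : R := ((\sum_i x i) ^+ 2 - \sum_i x i ^+ 2) / 2.
Definition e3 x : R :=
  ((\sum_i x i) ^+ 3 - 3 * (\sum_i x i) * (\sum_i x i ^+ 2) + 2 * \sum_i x i ^+ 3) / 6.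
Definition w2 x : R := \sum_r weig x r ^+ 2.
Definition w3 x : R := \prod_r weig x r.

Lemma prod4E (F : 'I_4 -> R) : \prod_i F i = F o0 * F o1 * F o2 * F o3.
Proof.
rewrite !big_ord_recl big_ord0 mulr1 !mulrA.
by congr (F _ * F _ * F _ * F _); apply/val_inj.
Qed.

Lemma prod3E (F : 'I_3 -> R) : \prod_i F i = F t0 * F t1 * F t2.
Proof.
rewrite !big_ord_recl big_ord0 mulr1 !mulrA.
by congr (F _ * F _ * F _); apply/val_inj.
Qed.

(* The numbers 2 weig x r + e2 x / 3 are x0 x1 + x2 x3 and its two conjugates,
   the roots of the resolvent cubic of the quartic with roots x. *)
Lemma resolvent2 x :
  e2 x ^+ 2 / 3 - 2 * w2 x = (\sum_i x i) * e3 x - 4 * \prod_i x i.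
Proof.
rewrite /w2 /e2 /e3 sum3E /weig /wcoef !sum4E prod4E /qa /tnth /=.
by field.
Qed.

(** The left side is the product of the three roots [2 * weig x r + e2 x / 3], and the left side of
    [resolvent2] is their second symmetric function; as the [weig x r] sum to zero, their products
    in pairs sum to [- w2 x / 2]. *)
Lemma resolvent3 x :
  8 * w3 x - 2 / 3 * e2 x * w2 x + e2 x ^+ 3 / 27 =
  e3 x ^+ 2 + ((\sum_i x i) ^+ 2 - 4 * e2 x) * \prod_i x i.
Proof.
rewrite /w2 /w3 /e2 /e3 sum3E prod3E /weig /wcoef !sum4E prod4E /qa /tnth /=.
by field.
Qed.

(** The four symmetric functions are, up to sign, the coefficients of the monic quartic with roots
    [x], which determines the roots with multiplicity. *)
Lemma perm_vals x y : (\sum_i x i = \sum_i y i) -> e2 x = e2 y -> e3 x = e3 y ->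
  \prod_i x i = \prod_i y i -> perm_eq (vals x) (vals y).
Proof.
move=> h1 h2 h3 h4.
have poly z : \prod_(a <- vals z) ('X - a%:P) =
    'X ^+ 4 - (\sum_i z i)%:P * 'X ^+ 3 + (e2 z)%:P * 'X ^+ 2 - (e3 z)%:P * 'X
    + (\prod_i z i)%:P.
  have -> : e2 z = z o0 * z o1 + z o0 * z o2 + z o0 * z o3 + z o1 * z o2
      + z o1 * z o3 + z o2 * z o3 by rewrite /e2 !sum4E; field.
  have -> : e3 z = z o0 * z o1 * z o2 + z o0 * z o1 * z o3 + z o0 * z o2 * z o3
      + z o1 * z o2 * z o3 by rewrite /e3 !sum4E; field.
  rewrite sum4E prod4E enum4E !big_cons big_nil !polyCD !polyCM.
  ring.
by apply: prod_XsubC_eq; rewrite !poly h1 h2 h3 h4.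
Qed.

Lemma perm_wvals x y : w2 x = w2 y -> w3 x = w3 y -> perm_eq (wvals x) (wvals y).
Proof.
move=> h2 h3.
have poly z : \prod_(a <- wvals z) ('X - a%:P) =
    'X ^+ 3 - (2^-1 * w2 z)%:P * 'X - (w3 z)%:P.
  have w0 := weig_sum z.
  (* The cubic has no quadratic term because the Weyl eigenvalues sum to zero; eliminating the third
     one lets [ring] compare the coefficients. *)
  have s1 : weig z t2 = - weig z t0 - weig z t1.
    by apply/eqP; rewrite -subr_eq0; apply/eqP; rewrite -[RHS]w0; ring.
  have -> : 2^-1 * w2 z = weig z t0 * weig z t0 + weig z t0 * weig z t1
      + weig z t1 * weig z t1.
    by rewrite /w2 sum3E s1; field.
  rewrite /w3 prod3E enum3E !big_cons big_nil s1.
  move: (weig z t0) (weig z t1) => a b; rewrite !(polyCD, polyCM, polyCN); ring.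
by apply: prod_XsubC_eq; rewrite !poly h2 h3.
Qed.

Lemma perm_sum (I J : finType) (F : I -> R) (G : J -> R) (h : R -> R) :
  perm_eq [seq F i | i <- enum I] [seq G j | j <- enum J] ->
  \sum_i h (F i) = \sum_j h (G j).
Proof.
have E (K : finType) (f : K -> R) :
    \sum_i h (f i) = \sum_(a <- [seq f i | i <- enum K]) h a.
  by rewrite big_map big_enum.
by move=> FG; rewrite !E; exact: perm_big.
Qed.

Lemma perm_prod (I J : finType) (F : I -> R) (G : J -> R) :
  perm_eq [seq F i | i <- enum I] [seq G j | j <- enum J] ->
  \prod_i F i = \prod_j G j.
Proof.
have E (K : finType) (f : K -> R) :
    \prod_i f i = \prod_(a <- [seq f i | i <- enum K]) a.
  by rewrite big_map big_enum.
by move=> FG; rewrite !E; exact: perm_big.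
Qed.

(** Reordering [x] permutes the three [weig]. Instead of following the permutation, their symmetric
    functions are recovered from those of [x] through the resolvent identities. *)
Lemma perm_wvals_of_vals x y : perm_eq (vals x) (vals y) -> perm_eq (wvals x) (wvals y).
Proof.
move=> xy; have h1 := perm_sum id xy; have h2 := perm_sum (fun a => a ^+ 2) xy.
have h3 := perm_sum (fun a => a ^+ 3) xy; have h4 := perm_prod xy.
have he2 : e2 x = e2 y by rewrite /e2 h1 h2.
have he3 : e3 x = e3 y by rewrite /e3 h1 h2 h3.
have hw2 : w2 x = w2 y.
  have rx := resolvent2 x; have ry := resolvent2 y.
  move: rx; rewrite h1 he2 he3 h4 -ry => /addrI/oppr_inj/mulfI; apply.
  by rewrite pnatr_eq0.
apply: perm_wvals => //.
have rx := resolvent3 x; have ry := resolvent3 y.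
move: rx; rewrite h1 he2 he3 h4 hw2 -ry => /addIr/addIr/mulfI; apply.
by rewrite pnatr_eq0.
Qed.

End SymmetricFunctions.

(** The image of a connected space is an interval, so with two values it contains their midpoint; a
    monic quadratic cannot vanish at two distinct numbers and at their midpoint. *)
Lemma connected_quadratic_constant {R : realType} {T : topologicalType} (t : T -> R) (B C : R) :
  connected [set: T] -> continuous t -> (forall p, t p ^+ 2 + B * t p + C = 0) ->
  forall p q, t p = t q.
Proof.
move=> cT ct Q p q.
have : connected (t @` [set: T]).
  by apply: connected_continuous_connected => //; exact: continuous_subspaceT.
move=> /connected_intervalP it.
wlog pq : p q / t p <= t q.
  by move=> H; have [|/ltW] := leP (t p) (t q); [exact: H|move/H ->].
have [r _ rE] : (t @` [set: T]) ((t p + t q) / 2).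
  apply: (it (t p) (t q)); [by exists p|by exists q|].
  by apply/andP; split; lra.
have Qp := Q p; have Qq := Q q; have := Q r; rewrite rE => Qr.
have : (t p - t q) ^+ 2 = 0.
  (* The second difference of a monic quadratic depends only on the distance between the two end
     points. *)
  have -> : (t p - t q) ^+ 2 = 2 * (t p ^+ 2 + B * t p + C) + 2 * (t q ^+ 2 + B * t q + C)
    - 4 * (((t p + t q) / 2) ^+ 2 + B * ((t p + t q) / 2) + C) by field.
  by rewrite Qp Qq Qr !mulr0 subr0 addr0.
by move/eqP; rewrite sqrf_eq0 subr_eq0 => /eqP.
Qed.

(** * Proof of the theorem *)

Lemma multiplicities {R : realType} (x : 'I_4 -> R) (pm wm : R -> nat) :
  (forall a, pm a = count_mem a [seq x i | i <- enum 'I_4]) ->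
  (forall a, wm a = count_mem a [seq weig x r | r <- enum 'I_3]) ->
  [/\ distinct_eigenvalues wm 3 <-> distinct_eigenvalues pm 4,
      distinct_eigenvalues wm 2 <->
        (distinct_eigenvalues pm 3 \/
         (distinct_eigenvalues pm 2 /\ forall a, (0 < pm a)%N -> pm a = 2%N)),
      distinct_eigenvalues wm 1 <-> (exists a, (3 <= pm a)%N) &
      (exists a, (3 <= pm a)%N) ->
        (exists m, (m <= 2)%N /\ distinct_eigenvalues pm m) /\ forall r, weig x r = 0].
Proof.
move=> pmE wmE.
have dp k := distinct_eigenvalues_count k pmE.
have dw k := distinct_eigenvalues_count k wmE.
set s := [seq x i | i <- enum 'I_4] in pmE dp.
have sE : s = [:: x o0; x o1; x o2; x o3] by rewrite /s enum4E.
have ex3 : (exists a, (3 <= pm a)%N) <-> has (fun a => 2 < count_mem a s)%N s.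
  rewrite -exists_count; split=> -[a]; first by rewrite pmE; exists a.
  by move=> ka; exists a; rewrite pmE.
have all2 : (forall a, (0 < pm a)%N -> pm a = 2%N) <-> all (fun a => count_mem a s == 2%N) s.
  rewrite -forall_count; split=> H a; first by have := H a; rewrite pmE.
  by rewrite pmE; exact: H.
have := multiplicity_cases (x o0) (x o1) (x o2) (x o3); rewrite -sE.
set k := (_ + (_ + 1))%N => /and4P[/eqP c3 /eqP c2 /eqP c1 /implyP c4].
have wk : size (undup [seq weig x r | r <- enum 'I_3]) = k.
  by rewrite enum3E !size_undup_cons !inE weig01_eq weig02_eq weig12_eq.
have dwk j : distinct_eigenvalues wm j <-> (k == j).
  by rewrite -wk; apply: (iff_trans (dw j)); split=> /eqP.
have dpk j : distinct_eigenvalues pm j <-> (size (undup s) == j).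
  by apply: (iff_trans (dp j)); split=> /eqP.
split.
- by rewrite dwk dpk c3.
- rewrite dwk !dpk all2 c2; split=> [/orP[->|/andP[-> ->]]|[->|[-> ->]]] //.
  + by left.
  + by right.
  + by rewrite orbT.
- by rewrite dwk ex3 c1.
rewrite ex3 => h3; split.
  by exists (size (undup s)); split; [exact: c4|apply/dpk].
move: h3; rewrite -c1; rewrite /k => {c1 c2 c3 c4 wk dwk}.
(* [k = 1] makes the three eigenvalues coincide, and since they sum to zero they vanish. *)
rewrite addnA addn1 eqSS addn_eq0 !eqb0 !negbK -weig01_eq -weig02_eq -weig12_eq.
move=> /andP[w012 /eqP w12].
have w01 : weig x t0 = weig x t1 by case/orP: w012 => /eqP // ->; rewrite w12.
have w0 : weig x t2 = 0.
  have := weig_sum x; rewrite w01 w12 => /eqP.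
  rewrite (_ : _ + _ + _ = 3%:R * weig x t2); last by ring.
  by rewrite mulf_eq0 pnatr_eq0 => /eqP.
by apply: ord3P; rewrite ?w01 ?w12 w0.
Qed.

Section Isoparametric.
Context {R : realType} {M : manifold R 4} {N : manifold R 5}.
Variables (g : metric M) (gN : metric N) (o : orientation M) (f : M -> N).
Hypotheses (cM : connected [set: M]) (iso : isometric_immersion g gN f)
  (lcf : locally_conformally_flat gN).
Variables (b : bool) (c : R).
Hypotheses (csc : constant_sectional_curvature gN c)
  (scal : constant_fun (scalar_at g)).

Let unit_nu (nu : unit_normal_field gN f) p :
  unit_normal gN f (chart_at (f p)) p (nu (chart_at (f p)) p).
Proof. exact: nfield_unit_normal (chart_at_atlas _) (chart_at_dom _). Qed.

Lemma isoparametric_weyl : isoparametric g gN f ->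
  constant_eigenvalues 3 (weyl_mult g o b).
Proof.
move=> [nu [s sE]].
(* On an empty [M] any tuple works; otherwise the eigenvalues are compared with those at a base
   point. *)
have [[p0 _]|noM] := pselect (exists p : M, True); last first.
  by exists [tuple 0 | r < 3] => p; case: noM; exists p.
have [x0 [px0 wx0 _ _ _]] := point_structure iso lcf (unit_nu nu p0).
exists [tuple weig x0 r | r < 3] => p a.
have [x [px wx _ _ _]] := point_structure iso lcf (unit_nu nu p).
have xx0 : perm_eq [seq x i | i <- enum 'I_4] [seq x0 i | i <- enum 'I_4].
  by apply: perm_count_mem => e; rewrite -px -px0 !sE.
by rewrite wx; have /seq.permP -> := perm_wvals_of_vals xx0.
Qed.

Lemma weyl_isoparametric : constant_mean_curvature g gN f ->
  constant_eigenvalues 3 (weyl_mult g o b) -> isoparametric g gN f.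
Proof.
move=> [nu [H HE]] [s sE]; have [S SE] := scal; exists nu.
have [[p0 _]|noM] := pselect (exists p : M, True); last first.
  by exists [tuple 0 | r < 4] => p; case: noM; exists p.
pose t p := \tr (shape_at g nu p *m shape_at g nu p *m shape_at g nu p).
(* [p2] is the constant |A|^2 obtained by solving R = 12 c + H^2 - |A|^2, and [E2] is the resulting
   constant value of e_2. *)
pose p2 : R := H ^+ 2 - (S - 12 * c); pose E2 : R := (H ^+ 2 - p2) / 2.
have str p : exists x : 'I_4 -> R,
  [/\ forall a, principal_mult g gN f p (nu (chart_at (f p)) p) a =
        count_mem a [seq x i | i <- enum 'I_4],
      perm_eq [seq weig x r | r <- enum 'I_3] s,
      \sum_i x i = H, \sum_i x i ^+ 2 = p2 & t p = \sum_i x i ^+ 3].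
  have [x [px wx _ [tr1 tr3] sc]] := point_structure iso lcf (unit_nu nu p).
  exists x; have h1 : \sum_i x i = H by rewrite -tr1 -(HE p).
  split=> //.
  - by apply: perm_count_mem => a; rewrite -(wx o b) sE.
  - by rewrite /p2 -(SE p) (sc c csc) h1; ring.
have [x0 [px0 wx0 s0 q0 t0E]] := str p0.
pose K1 := E2 ^+ 2 / 3 - 2 * w2 x0.
pose K2 := 8 * w3 x0 - 2 / 3 * E2 * w2 x0 + E2 ^+ 3 / 27.
pose e3t p := (H ^+ 3 - 3 * H * p2 + 2 * t p) / 6.
have inv p (x : 'I_4 -> R) : perm_eq [seq weig x r | r <- enum 'I_3] s ->
    \sum_i x i = H -> \sum_i x i ^+ 2 = p2 -> t p = \sum_i x i ^+ 3 ->
  [/\ e2 x = E2, e3 x = e3t p, K1 = H * e3t p - 4 * \prod_i x i &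
      K2 = e3t p ^+ 2 + (H ^+ 2 - 4 * E2) * \prod_i x i].
  move=> ws h1 h2 h3.
  have wx : perm_eq [seq weig x r | r <- enum 'I_3] [seq weig x0 r | r <- enum 'I_3].
    by rewrite (perm_trans ws) // perm_sym.
  have W2 : w2 x0 = w2 x by rewrite /w2 (perm_sum (fun a => a ^+ 2) wx).
  have W3 : w3 x0 = w3 x by rewrite /w3 (perm_prod wx).
  have E2E : e2 x = E2 by rewrite /e2 h1 h2.
  have E3E : e3 x = e3t p by rewrite /e3 h1 h2 -h3.
  split=> //.
    by rewrite /K1 W2 -E2E resolvent2 h1 E3E.
  by rewrite /K2 W2 W3 -E2E resolvent3 h1 E3E.
(* The [K1] equation gives e_4 = (H e_3 - K1) / 4; substituting this into the [K2] equation leaves a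
   monic quadratic in e_3 with constant coefficients. *)
pose B : R := (H ^+ 2 - 4 * E2) * H / 4.
have quad p : e3t p ^+ 2 + B * e3t p + (- (H ^+ 2 - 4 * E2) * K1 / 4 - K2) = 0.
  have [x [_ ws h1 h2 h3]] := str p; have [_ _ k1 k2] := inv p x ws h1 h2 h3.
  by rewrite k1 k2 /B; field.
have ct : continuous e3t.
  move=> p; apply: (ctnM (f := fun p => H ^+ 3 - 3 * H * p2 + 2 * t p)); last exact: ctn_cst.
  apply: ctnD; first exact: ctn_cst.
  apply: ctnM; first exact: ctn_cst.
  exact: trace_shape3_continuous.
have e3C p : e3t p = e3t p0 by exact: connected_quadratic_constant cM ct quad p p0.
exists [tuple x0 i | i < 4] => p a.
have [x [px ws h1 h2 h3]] := str p; have [k1 k2 k3 _] := inv p x ws h1 h2 h3.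
have [l1 l2 l3 _] := inv p0 x0 wx0 s0 q0 t0E.
rewrite px; have /seq.permP -> : perm_eq [seq x i | i <- enum 'I_4] [seq x0 i | i <- enum 'I_4].
  apply: perm_vals; rewrite ?h1 ?s0 ?k1 ?l1 ?k2 ?l2 ?e3C //.
  (* With e_3 constant, the [K1] equation determines e_4 as well. *)
  move: k3; rewrite l3 e3C => /addrI/oppr_inj/mulfI -> //.
by [].
Qed.

End Isoparametric.

Theorem theorem1p4 (R : realType) (M : manifold R 4) (N : manifold R 5)
    (g : metric M) (gN : metric N) (o : orientation M) (iota : M -> N) :
  connected [set: M] ->
  isometric_immersion g gN iota ->
  locally_conformally_flat gN ->
  (* b = false: W^+, b = true: W^- *)
  forall b : bool,
  (forall (p : M) (nu : 'rV[R]_5),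
     unit_normal gN iota (chart_at (iota p)) p nu ->
     let pmult := principal_mult g gN iota p nu in
     let wmult := weyl_mult g o b p in
     [/\ distinct_eigenvalues wmult 3 <-> distinct_eigenvalues pmult 4,
         distinct_eigenvalues wmult 2 <->
           (distinct_eigenvalues pmult 3 \/
            (distinct_eigenvalues pmult 2 /\
             forall a, (0 < pmult a)%N -> pmult a = 2%N)),
         distinct_eigenvalues wmult 1 <-> (exists a, (3 <= pmult a)%N) &
         (exists a, (3 <= pmult a)%N) ->
           (exists m, (m <= 2)%N /\ distinct_eigenvalues pmult m) /\
           (forall i j k l, weyl_pm g o b p i j k l = 0)])
  /\
  (forall c : R,
     space_form gN c ->
     constant_fun (scalar_at g) ->
     constant_mean_curvature g gN iota ->
     (isoparametric g gN iota <-> constant_eigenvalues 3 (weyl_mult g o b))).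
Proof.
move=> cM iso lcf b; split.
  move=> p nu un; have [x [px wx W0 _ _]] := point_structure iso lcf un.
  have [h1 h2 h3 h4] := multiplicities px (wx o b).
  split=> // /h4[m0 w0]; split=> //; exact: W0.
move=> c [_ _ _ csc] scal cmc; split; first exact: (isoparametric_weyl _ iso lcf).
exact: (weyl_isoparametric cM iso lcf csc scal).
Qed.
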